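(* Let $R$ be a ring with local units and $\mathfrak C$ an $A$-coring. Suppose that functors $F:\mathcal M_R\to\mathcal M^{\mathfrak C}$ and $G:\mathcal M^{\mathfrak C}\to\mathcal M_R$ form an equivalence of categories. Put $\Sigma=F(R)$. Then the following statements hold: (i) $\Sigma$ is a locally projective right $A$-module (in the sense of Zimmermann-Huisgen); (ii) $F\cong-\otimes_R\Sigma$ and $G\cong-\otimes^{\mathfrak C}\Sigma^\dagger$, with $\Sigma^\dagger=\Sigma^*\otimes_RR$; (iii) there is a comatrix coring context $(R,A,\Sigma,\Sigma^\dagger,\sigma,\tau)$, and $\mathfrak C$ is isomorphic to the comatrix coring $\Sigma^*\otimes_R\Sigma$. If $\mathfrak C$ is flat as a left $A$-module, then the following statement holds as well: (iv) $\Sigma$ is faithfully flat as a left $R$-module. Conversely, (i), (iii) and (iv) imply that $\mathfrak C$ is flat as a left $A$-module and $(-\otimes_R\Sigma,\ \mathrm{Hom}^{\mathfrak C}(\Sigma,-)\otimes_RR)$ is a pair of inverse equivalences.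
   Context: $A$ is an associative unital ring; $A$-modules are unital. An $A$-coring is an $A$-bimodule $\mathfrak C$ with coassociative, counital $A$-bilinear maps $\Delta:\mathfrak C\to\mathfrak C\otimes_A\mathfrak C$ and $\varepsilon_{\mathfrak C}:\mathfrak C\to A$. $\mathcal M^{\mathfrak C}$ is the category of right $\mathfrak C$-comodules (right $A$-modules $M$ with a coassociative counital right $A$-linear coaction $\rho_M(m)=m_{[0]}\otimes_Am_{[1]}\in M\otimes_A\mathfrak C$) and colinear maps; $\mathrm{Hom}^{\mathfrak C}$ denotes colinear maps. A ring $R$ (not necessarily unital) has local units if for every finite subset $X\subset R$ there is $e\in R$ with $ex=x=xe$ for all $x\in X$; such a ring is firm. A right $R$-module $M$ is firm if $M\otimes_RR\to M$, $m\otimes r\mapsto mr$, is an isomorphism (similarly on the left); $\mathcal M_R$ is the category of firm right $R$-modules; a firm ring is a ring that is firm as a module over itself. A firm left $R$-module $\Sigma$ is flat if $-\otimes_R\Sigma$ is exact on all (possibly non-firm) right $R$-modules, and faithfully flat if moreover $-\otimes_R\Sigma$ is faithful on $\mathcal M_R$. ${}_R\mathcal M^{\mathfrak C}$ consists of right $\mathfrak C$-comodules that are firm left $R$-modules with commuting $A$-action such that the coaction is left $R$-linear. $\Sigma=F(R)$ carries the left $R$-action $r\cdot u=F(\lambda_r)(u)$, $\lambda_r$ being left multiplication by $r$ on $R$, and so lies in ${}_R\mathcal M^{\mathfrak C}$; in the converse $\Sigma$ is likewise an object of ${}_R\mathcal M^{\mathfrak C}$, so that the two functors (between $\mathcal M_R$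 and $\mathcal M^{\mathfrak C}$) are defined. $\Sigma^*=\mathrm{Hom}_A(\Sigma,A)$ has right $R$-action $(f\cdot r)(u)=f(ru)$. A right $A$-module $\Sigma$ is locally projective in the sense of Zimmermann-Huisgen if for every finite set $u_1,\dots,u_n\in\Sigma$ there are finitely many $e_j\in\Sigma$, $f_j\in\Sigma^*$ with $u_i=\sum_je_jf_j(u_i)$ for all $i$. Comatrix coring context. A tuple $(R,A,\Sigma,\Sigma^\dagger,\eta,\varepsilon)$ where $R,A$ are firm rings, $\Sigma$ is an $R$-$A$-bimodule and $\Sigma^\dagger$ an $A$-$R$-bimodule, both firm on both sides, $\eta:R\to\Sigma\otimes_A\Sigma^\dagger$ is $R$-bilinear, $\varepsilon:\Sigma^\dagger\otimes_R\Sigma\to A$ is $A$-bilinear, and, writing $\eta(r)=e_r\otimes_Af_r$ (summation understood), $e_r\,\varepsilon(f_r\otimes_Ru)=ru$ and $\varepsilon(\varphi\otimes_Re_r)f_r=\varphi r$ for all $r\in R,u\in\Sigma,\varphi\in\Sigma^\dagger$. The associated comatrix coring is $\Sigma^\dagger\otimes_R\Sigma$ with counit $\varepsilon$ and comultiplication $\varphi\otimes_Ru\mapsto\varphi\otimes_R\eta(r)\otimes_Ru^r$, where $r\otimes_Ru^r\in R\otimes_R\Sigma$ corresponds to $u$. For $\Sigma^\dagger=\Sigma^*\otimes_RR$ one has $\Sigma^\dagger\otimes_R\Sigma\cong\Sigma^*\otimes_R\Sigma$. Cotensor product. $N\otimes^{\mathfrak C}L=\ker(\rho_N\otimes_AL-N\otimes_A\rho_L)$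 for a right comodule $N$ and left comodule $L$. The left $\mathfrak C$-coaction on $\Sigma^\dagger=\Sigma^*\otimes_RR$ is $\varphi\otimes_Rr\mapsto\varphi(e_{s[0]})e_{s[1]}\otimes_A(f_s\cdot r^s)$, where $s\otimes_Rr^s\in R\otimes_RR$ corresponds to $r$, $\sigma(s)=e_s\otimes_Af_s\in\Sigma\otimes_A\Sigma^\dagger$, and $e_{s[0]}\otimes_Ae_{s[1]}$ is the coaction of $\mathfrak C$ on $e_s\in\Sigma$.
   Formalization: In (iii), the isomorphism of the comatrix coring with C is also required to carry the canonical coaction u ↦ e_r⊗f_r⊗u^r of Σ to its given C-coaction; with an unrelated coring isomorphism the converse is false (A=k, R=Σ=k×k, C=kg+kh, ρ(u)=u⊗g). *)

(* Defs.v *)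
From HB Require Import structures.
From mathcomp Require Import all_boot all_algebra boolp.
Set Implicit Arguments.
Unset Strict Implicit.
Unset Printing Implicit Defensive.
Import GRing.Theory.
Local Open Scope ring_scope.
Local Open Scope quotient_scope.

Record category := Category {
  obj :> Type;
  hom : obj -> obj -> Type;
  idm : forall x, hom x x;
  comp : forall x y z, hom y z -> hom x y -> hom x z;
  comp1m : forall x y (f : hom x y), comp (idm y) f = f;
  compm1 : forall x y (f : hom x y), comp f (idm x) = f;
  compA : forall w x y z (f : hom y z) (g : hom x y) (h : hom w x),
    comp f (comp g h) = comp (comp f g) h }.
Arguments idm {_} _.
Arguments comp {_ x y z} _ _.

Record functor (C D : category) := Functor {
  fobj :> C -> D;
  fmap : forall x y, hom x y -> hom (fobj x) (fobj y);
  fmap1 : forall x, fmap (idm x) = idm (fobj x);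
  fmapM : forall x y z (f : hom y z) (g : hom x y),
    fmap (comp f g) = comp (fmap f) (fmap g) }.
Arguments fmap {C D} _ {x y} _.

Definition fid (C : category) : functor C C :=
  @Functor C C id (fun _ _ f => f) (fun _ => erefl) (fun _ _ _ _ _ => erefl).

Program Definition fcomp (C D E : category) (G : functor D E) (F : functor C D) :
  functor C E :=
  @Functor C E (fun x => G (F x)) (fun x y f => fmap G (fmap F f)) _ _.
Next Obligation. by rewrite !fmap1. Qed.
Next Obligation. by rewrite !fmapM. Qed.

Definition is_iso (C : category) (x y : C) (f : hom x y) : Prop :=
  exists g : hom y x, comp g f = idm x /\ comp f g = idm y.

Definition nat_isomorphic (C D : category) (F G : functor C D) : Prop :=
  exists eta : forall x, hom (F x) (G x),
    (forall x y (f : hom x y), comp (eta y) (fmap F f) = comp (fmap G f) (eta x))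
    /\ forall x, is_iso (eta x).

Definition inverse_equivalences (C D : category)
  (F : functor C D) (G : functor D C) : Prop :=
  nat_isomorphic (fid C) (fcomp G F) /\ nat_isomorphic (fcomp F G) (fid D).

Record rng := Rng {
  rng_sort :> zmodType;
  rmul : rng_sort -> rng_sort -> rng_sort;
  rmulA : associative rmul;
  rmulDl : left_distributive rmul +%R;
  rmulDr : right_distributive rmul +%R }.
Arguments rmul {_} _ _.

Definition rng_of (A : pzRingType) : rng :=
  @Rng A *%R (@mulrA A) (@mulrDl A) (@mulrDr A).
(* The unit of [A], seen in the underlying ring without unit. *)
Definition rone (A : pzRingType) : rng_of A := (1 : A).
Coercion rng_of : GRing.PzRing.type >-> rng.

(* The zero ring: as it need not act unitally, a left (right) module over it is
   just an abelian group, and [bimod rng0 S], [bimod R rng0] below are the right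
   [S]-modules and the left [R]-modules. *)
Program Definition rng0 : rng := @Rng (GRing.Zmodule.clone 'I_1 _) (fun _ _ => 0) _ _ _.
Next Obligation. by []. Qed.
Next Obligation. by move=> x y z; rewrite addr0. Qed.
Next Obligation. by move=> x y z; rewrite addr0. Qed.

Definition has_local_units (R : rng) : Prop :=
  forall X : seq R, exists e : R, forall x, x \in X -> rmul e x = x /\ rmul x e = x.

Record bimod (R S : rng) := Bimod {
  bm_sort :> zmodType;
  lact : R -> bm_sort -> bm_sort;
  ract : bm_sort -> S -> bm_sort;
  lactDl : forall r r' m, lact (r + r') m = lact r m + lact r' m;
  lactDr : forall r m m', lact r (m + m') = lact r m + lact r m';
  lactM : forall r r' m, lact (rmul r r') m = lact r (lact r' m);
  ractDl : forall m m' s, ract (m + m') s = ract m s + ract m' s;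
  ractDr : forall m s s', ract m (s + s') = ract m s + ract m s';
  ractM : forall m s s', ract m (rmul s s') = ract (ract m s) s';
  lractA : forall r m s, lact r (ract m s) = ract (lact r m) s }.
Arguments lact {R S b} _ _.
Arguments ract {R S b} _ _.
Notation "r *> m" := (lact r m) (at level 40, left associativity).
Notation "m <* s" := (ract m s) (at level 40, left associativity).

Definition unital_left (A : pzRingType) (S : rng) (M : bimod A S) : Prop :=
  forall m : M, rone A *> m = m.
Definition unital_right (R : rng) (A : pzRingType) (M : bimod R A) : Prop :=
  forall m : M, m <* rone A = m.

Definition regular (R : rng) : bimod R R :=
  @Bimod R R R (@rmul R) (@rmul R)
    (fun r r' m => rmulDl r r' m) (fun r m m' => rmulDr r m m')
    (fun r r' m => esym (rmulA r r' m))
    (fun m m' s => rmulDl m m' s) (fun m s s' => rmulDr m s s')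
    (fun m s s' => rmulA m s s') (fun r m s => rmulA r m s).

Program Definition forget_left (R S : rng) (M : bimod R S) : bimod rng0 S :=
  @Bimod rng0 S M (fun _ _ => 0) (fun m s => m <* s) _ _ _ _ _ _ _.
Next Obligation. by rewrite addr0. Qed.
Next Obligation. by rewrite addr0. Qed.
Next Obligation. exact: ractDl. Qed.
Next Obligation. exact: ractDr. Qed.
Next Obligation. exact: ractM. Qed.
Next Obligation.
by apply: (@addrI _ (0 <* s)); rewrite -ractDl !addr0.
Qed.

Record bihom (R S : rng) (M N : bimod R S) := BiHom {
  bfun :> M -> N;
  bfunD : {morph bfun : x y / x + y};
  bfunL : forall r m, bfun (r *> m) = r *> bfun m;
  bfunR : forall m s, bfun (m <* s) = bfun m <* s }.

Lemma bihomP (R S : rng) (M N : bimod R S) (f g : bihom M N) : f =1 g -> f = g.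
Proof.
case: f g => [f fD fL fR] [g gD gL gR] /= /funext efg; subst g.
by congr BiHom; apply: Prop_irrelevance.
Qed.

Lemma morphD0 (U V : zmodType) (f : U -> V) : {morph f : x y / x + y} -> f 0 = 0.
Proof. by move=> fD; apply: (@addrI _ (f 0)); rewrite -fD !addr0. Qed.

Lemma morphDN (U V : zmodType) (f : U -> V) :
  {morph f : x y / x + y} -> {morph f : x / - x}.
Proof.
by move=> fD x; apply/eqP; rewrite -addr_eq0 -fD addNr (morphD0 fD).
Qed.

Lemma bfun0 (R S : rng) (M N : bimod R S) (f : bihom M N) : f 0 = 0.
Proof. exact: morphD0 (bfunD f). Qed.

Lemma lact0 (R S : rng) (M : bimod R S) (r : R) : r *> (0 : M) = 0.
Proof. by apply: (morphD0 (f := lact r)) => x y; rewrite lactDr. Qed.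
Lemma lactN (R S : rng) (M : bimod R S) (r : R) (m : M) : r *> (- m) = - (r *> m).
Proof. by apply: (morphDN (f := lact r)) => x y; rewrite lactDr. Qed.
Lemma ract0 (R S : rng) (M : bimod R S) (s : S) : (0 : M) <* s = 0.
Proof. by apply: (morphD0 (f := fun m : M => m <* s)) => x y; rewrite ractDl. Qed.
Lemma ractN (R S : rng) (M : bimod R S) (s : S) (m : M) : (- m) <* s = - (m <* s).
Proof. by apply: (morphDN (f := fun m : M => m <* s)) => x y; rewrite ractDl. Qed.
Lemma rract0 (R S : rng) (M : bimod R S) (m : M) : m <* (0 : S) = 0.
Proof. by apply: (morphD0 (f := fun s : S => m <* s)) => x y; rewrite ractDr. Qed.

Definition idb (R S : rng) (M : bimod R S) : bihom M M :=
  @BiHom R S M M id (fun _ _ => erefl) (fun _ _ => erefl) (fun _ _ => erefl).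
Arguments idb {R S} M.

Program Definition compb (R S : rng) (M N P : bimod R S)
  (f : bihom N P) (g : bihom M N) : bihom M P :=
  @BiHom R S M P (fun m => f (g m)) _ _ _.
Next Obligation. by move=> x y; rewrite !bfunD. Qed.
Next Obligation. by rewrite !bfunL. Qed.
Next Obligation. by rewrite !bfunR. Qed.

Program Definition zerob (R S : rng) (M N : bimod R S) : bihom M N :=
  @BiHom R S M N (fun=> 0) _ _ _.
Next Obligation. by move=> x y; rewrite addr0. Qed.
Next Obligation. by rewrite lact0. Qed.
Next Obligation. by rewrite ract0. Qed.

Program Definition addb (R S : rng) (M N : bimod R S) (f g : bihom M N) :
  bihom M N := @BiHom R S M N (fun m => f m + g m) _ _ _.
Next Obligation. by move=> x y; rewrite !bfunD addrACA. Qed.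
Next Obligation. by rewrite !bfunL lactDr. Qed.
Next Obligation. by rewrite !bfunR ractDl. Qed.

Program Definition oppb (R S : rng) (M N : bimod R S) (f : bihom M N) :
  bihom M N := @BiHom R S M N (fun m => - f m) _ _ _.
Next Obligation. by move=> x y; rewrite bfunD opprD. Qed.
Next Obligation. by rewrite bfunL lactN. Qed.
Next Obligation. by rewrite bfunR ractN. Qed.

Section BihomZmod.
Variables (R S : rng) (M N : bimod R S).

HB.instance Definition _ := gen_eqMixin (bihom M N).
HB.instance Definition _ := gen_choiceMixin (bihom M N).

Fact addbA : associative (@addb R S M N).
Proof. by move=> f g h; apply: bihomP => m /=; rewrite addrA. Qed.
Fact addbC : commutative (@addb R S M N).
Proof. by move=> f g; apply: bihomP => m /=; rewrite addrC. Qed.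
Fact add0b : left_id (zerob M N) (@addb R S M N).
Proof. by move=> f; apply: bihomP => m /=; rewrite add0r. Qed.
Fact addNb : left_inverse (zerob M N) (@oppb R S M N) (@addb R S M N).
Proof. by move=> f; apply: bihomP => m /=; rewrite addNr. Qed.

HB.instance Definition _ := GRing.isZmodule.Build (bihom M N) addbA addbC add0b addNb.

Lemma addbE (f g : bihom M N) m : (f + g) m = f m + g m.
Proof. by []. Qed.
End BihomZmod.

Lemma bij_right_inverse (U V : Type) (f : U -> V) :
  bijective f -> exists g, cancel g f.
Proof. by case=> g _ gK; exists g. Qed.

Program Definition binv (R S : rng) (M N : bimod R S) (f : bihom M N)
  (fB : bijective f) : bihom N M :=
  @BiHom R S N M (sval (cid (bij_right_inverse fB))) _ _ _.
Next Obligation.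
by case: cid => g /= gK x y; apply: (bij_inj fB); rewrite bfunD !gK.
Qed.
Next Obligation.
by case: cid => g /= gK; apply: (bij_inj fB); rewrite bfunL !gK.
Qed.
Next Obligation.
by case: cid => g /= gK; apply: (bij_inj fB); rewrite bfunR !gK.
Qed.

Lemma binvK (R S : rng) (M N : bimod R S) (f : bihom M N) (fB : bijective f) :
  cancel (binv fB) f.
Proof. by rewrite /binv /=; case: cid. Qed.
Lemma bfunK (R S : rng) (M N : bimod R S) (f : bihom M N) (fB : bijective f) :
  cancel f (binv fB).
Proof. by move=> x; apply: (bij_inj fB); rewrite binvK. Qed.

Section Submodule.
Variables (R S : rng) (M : bimod R S) (P : M -> Prop).
Hypotheses (P0 : P 0) (PD : forall x y, P x -> P y -> P (x + y))
  (PN : forall x, P x -> P (- x)) (PL : forall r x, P x -> P (r *> x))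
  (PR : forall x s, P x -> P (x <* s)).

Record sub_sort := SubElt { sub_val : M; sub_prop : P sub_val }.

Lemma sub_val_inj : injective sub_val.
Proof.
case=> [x Px] [y Py] /= exy; subst y.
by congr SubElt; apply: Prop_irrelevance.
Qed.

Let add (x y : sub_sort) := SubElt (PD (sub_prop x) (sub_prop y)).
Let opp (x : sub_sort) := SubElt (PN (sub_prop x)).

HB.instance Definition _ := gen_eqMixin sub_sort.
HB.instance Definition _ := gen_choiceMixin sub_sort.

Definition sub_isZmodule : GRing.isZmodule sub_sort.
Proof.
apply: (@GRing.isZmodule.Build sub_sort (SubElt P0) opp add).
- by move=> x y z; apply: sub_val_inj; rewrite /= addrA.
- by move=> x y; apply: sub_val_inj; rewrite /= addrC.
- by move=> x; apply: sub_val_inj; rewrite /= add0r.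
- by move=> x; apply: sub_val_inj; rewrite /= addNr.
Defined.

Definition sub_zmod : zmodType := HB.pack sub_sort sub_isZmodule.

Program Definition submod : bimod R S :=
  @Bimod R S sub_zmod (fun r x => SubElt (PL r (sub_prop x)))
    (fun x s => SubElt (PR s (sub_prop x))) _ _ _ _ _ _ _.
Next Obligation. by apply: sub_val_inj; rewrite /= lactDl. Qed.
Next Obligation. by apply: sub_val_inj; rewrite /= lactDr. Qed.
Next Obligation. by apply: sub_val_inj; rewrite /= lactM. Qed.
Next Obligation. by apply: sub_val_inj; rewrite /= ractDl. Qed.
Next Obligation. by apply: sub_val_inj; rewrite /= ractDr. Qed.
Next Obligation. by apply: sub_val_inj; rewrite /= ractM. Qed.
Next Obligation. by apply: sub_val_inj; rewrite /= lractA. Qed.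
End Submodule.

(* The tensor product over [S] of two abelian groups with a right and a left
   action of [S]: finite formal sums of pairs, modulo the congruence generated by
   the usual relations.  Inverses come from those of [M] and [N]. *)
Section Tensor.
Variables (S : rng) (M N : zmodType) (ra : M -> S -> M) (la : S -> N -> N).

Inductive teq : seq (M * N) -> seq (M * N) -> Prop :=
| teq_refl s : teq s s
| teq_sym s t : teq s t -> teq t s
| teq_trans s t u : teq s t -> teq t u -> teq s u
| teq_cat s s' t t' : teq s s' -> teq t t' -> teq (s ++ t) (s' ++ t')
| teq_comm s t : teq (s ++ t) (t ++ s)
| teq_addl m m' n : teq [:: (m + m', n)] [:: (m, n); (m', n)]
| teq_addr m n n' : teq [:: (m, n + n')] [:: (m, n); (m, n')]
| teq_0 n : teq [:: (0, n)] [::]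
| teq_bal m s n : teq [:: (ra m s, n)] [:: (m, la s n)].

Definition teqb : rel (seq (M * N)) := fun s t => `[< teq s t >].

Fact teqb_equiv : equiv_class_of teqb.
Proof.
split=> [s|s t|t s u]; first by apply/asboolP; apply: teq_refl.
  by apply/asboolP/asboolP => /teq_sym.
by move=> /asboolP st /asboolP tu; apply/asboolP; apply: teq_trans st tu.
Qed.
Canonical teqb_equivRel := EquivRelPack teqb_equiv.

Definition tens_sort : Type := {eq_quot teqb}.
HB.instance Definition _ := Choice.on tens_sort.
HB.instance Definition _ := EqQuotient.on tens_sort.

Definition tpi (s : seq (M * N)) : tens_sort := \pi_tens_sort s.

Lemma tpiP s t : tpi s = tpi t <-> teq s t.
Proof.
split=> [/eqmodP /asboolP //|st].
by apply/eqmodP; apply/asboolP.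
Qed.

Lemma tpiK (x : tens_sort) : tpi (repr x) = x.
Proof. exact: reprK. Qed.

Lemma repr_teq s : teq (repr (tpi s)) s.
Proof. by apply/tpiP; rewrite tpiK. Qed.

Definition tadd (x y : tens_sort) := tpi (repr x ++ repr y).
Definition topp (x : tens_sort) := tpi [seq (- p.1, p.2) | p <- repr x].

Lemma tadd_pi s t : tadd (tpi s) (tpi t) = tpi (s ++ t).
Proof. by apply/tpiP; apply: teq_cat; apply: repr_teq. Qed.

Lemma teq_oppK s : teq ([seq (- p.1, p.2) | p <- s] ++ s) [::].
Proof.
elim: s => [|[m n] s IHs]; first exact: teq_refl.
have e0 : teq ([:: (- m, n)] ++ [:: (m, n)]) [::].
  apply: teq_trans (teq_0 n); rewrite -(addNr m).
  exact/teq_sym/teq_addl.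
have -> : [seq (- p.1, p.2) | p <- (m, n) :: s] ++ (m, n) :: s =
    [:: (- m, n)] ++ (([seq (- p.1, p.2) | p <- s] ++ [:: (m, n)]) ++ s).
  by rewrite -catA.
apply: teq_trans (teq_cat (teq_refl _) (teq_cat (teq_comm _ _) (teq_refl _))) _.
exact: teq_cat e0 IHs.
Qed.

Fact taddA : associative tadd.
Proof.
move=> x y z; rewrite -(tpiK x) -(tpiK y) -(tpiK z).
by rewrite !tadd_pi catA.
Qed.
Fact taddC : commutative tadd.
Proof.
move=> x y; rewrite -(tpiK x) -(tpiK y) !tadd_pi.
by apply/tpiP; apply: teq_comm.
Qed.
Fact tadd0 : left_id (tpi [::]) tadd.
Proof. by move=> x; rewrite -(tpiK x) tadd_pi. Qed.
Fact taddN : left_inverse (tpi [::]) topp tadd.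
Proof.
move=> x; rewrite -{2}(tpiK x) /topp tadd_pi.
by apply/tpiP; apply: teq_oppK.
Qed.

HB.instance Definition _ := GRing.isZmodule.Build tens_sort taddA taddC tadd0 taddN.
Definition tens_zmod : zmodType := GRing.Zmodule.clone tens_sort _.

Definition pure_raw (m : M) (n : N) : tens_sort := tpi [:: (m, n)].

Lemma tens_sumE (x : tens_sort) : x = \sum_(p <- repr x) pure_raw p.1 p.2.
Proof.
rewrite -{1}(tpiK x); elim: (repr x) => [|[m n] s IHs]; first by rewrite big_nil.
by rewrite big_cons -IHs -cat1s -tadd_pi.
Qed.

Lemma pure_rawDl m m' n : pure_raw (m + m') n = pure_raw m n + pure_raw m' n.
Proof.
by rewrite [RHS]tadd_pi; apply/tpiP; apply: teq_addl.
Qed.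
Lemma pure_rawDr m n n' : pure_raw m (n + n') = pure_raw m n + pure_raw m n'.
Proof.
by rewrite [RHS]tadd_pi; apply/tpiP; apply: teq_addr.
Qed.
Lemma pure_raw_bal m s n : pure_raw (ra m s) n = pure_raw m (la s n).
Proof. by apply/tpiP; apply: teq_bal. Qed.

Lemma tens_raw_ind (P : tens_sort -> Prop) :
  (forall m n, P (pure_raw m n)) -> (forall x y, P x -> P y -> P (x + y)) ->
  forall x, P x.
Proof.
move=> Pp PD x; rewrite -(tpiK x); elim: (repr x) => [|[m n] s IHs].
  have -> : tpi [::] = pure_raw 0 0 by apply/tpiP/teq_sym/teq_0.
  exact: Pp.
by rewrite -cat1s -tadd_pi; apply: PD => //; apply: Pp.
Qed.

Section Lift.
Variables (V : zmodType) (b : M -> N -> V).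
Definition lift_raw (x : tens_sort) : V := \sum_(p <- repr x) b p.1 p.2.

Hypotheses (bDl : forall m m' n, b (m + m') n = b m n + b m' n)
  (bDr : forall m n n', b m (n + n') = b m n + b m n')
  (bbal : forall m s n, b (ra m s) n = b m (la s n)).

Let lift_pi s : lift_raw (tpi s) = \sum_(p <- s) b p.1 p.2.
Proof.
have b0 n : b 0 n = 0 by apply: (morphD0 (f := b^~ n)) => x y; apply: bDl.
suff teqE u v : teq u v -> \sum_(p <- u) b p.1 p.2 = \sum_(p <- v) b p.1 p.2.
  exact/teqE/repr_teq.
elim=> {u v s} //.
- by move=> s t u _ -> _ ->.
- by move=> s s' t t' _ e _ e'; rewrite !big_cat /= e e'.
- by move=> s t; rewrite !big_cat /= addrC.
- by move=> m m' n; rewrite !big_cons !big_nil /= !addr0 bDl.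
- by move=> m n n'; rewrite !big_cons !big_nil /= !addr0 bDr.
- by move=> n; rewrite big_seq1 big_nil b0.
- by move=> m s n; rewrite !big_seq1 bbal.
Qed.

Lemma lift_rawE m n : lift_raw (pure_raw m n) = b m n.
Proof. by rewrite lift_pi big_seq1. Qed.

Lemma lift_rawD : {morph lift_raw : x y / x + y}.
Proof.
move=> x y; rewrite -(tpiK x) -(tpiK y).
by rewrite -[X in lift_raw X]/(tadd _ _) tadd_pi !lift_pi big_cat.
Qed.
End Lift.
End Tensor.

Section TensorBimod.
Variables (R S T : rng) (M : bimod R S) (N : bimod S T).

Let X := tens_zmod (@ract R S M) (@lact S T N).
Let p (m : M) (n : N) : X := pure_raw (@ract R S M) (@lact S T N) m n.
Let la (r : R) (x : X) : X := lift_raw (fun m n => p (r *> m) n) x.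
Let ra (x : X) (t : T) : X := lift_raw (fun m n => p m (n <* t)) x.

Let laE r m n : la r (p m n) = p (r *> m) n.
Proof.
rewrite /la lift_rawE // => [m1 m2 n1|m1 n1 n2|m1 s n1].
- by rewrite lactDr /p pure_rawDl.
- by rewrite /p pure_rawDr.
- by rewrite lractA /p pure_raw_bal.
Qed.
Let laD r x y : la r (x + y) = la r x + la r y.
Proof.
rewrite /la lift_rawD // => [m1 m2 n1|m1 n1 n2|m1 s n1].
- by rewrite lactDr /p pure_rawDl.
- by rewrite /p pure_rawDr.
- by rewrite lractA /p pure_raw_bal.
Qed.
Let raE t m n : ra (p m n) t = p m (n <* t).
Proof.
rewrite /ra lift_rawE // => [m1 m2 n1|m1 n1 n2|m1 s n1].
- by rewrite /p pure_rawDl.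
- by rewrite ractDl /p pure_rawDr.
- by rewrite -lractA /p pure_raw_bal.
Qed.
Let raD t x y : ra (x + y) t = ra x t + ra y t.
Proof.
rewrite /ra lift_rawD // => [m1 m2 n1|m1 n1 n2|m1 s n1].
- by rewrite /p pure_rawDl.
- by rewrite ractDl /p pure_rawDr.
- by rewrite -lractA /p pure_raw_bal.
Qed.

Program Definition tens : bimod R T := @Bimod R T X la ra _ _ _ _ _ _ _.
Next Obligation.
elim/tens_raw_ind: m => [m n|x y IHx IHy]; last by rewrite !laD IHx IHy addrACA.
by rewrite !laE lactDl /p pure_rawDl.
Qed.
Next Obligation.
elim/tens_raw_ind: m => [m n|x y IHx IHy]; last by rewrite !laD IHx IHy.
by rewrite !laE lactM.
Qed.
Next Obligation.
elim/tens_raw_ind: m => [m n|x y IHx IHy]; last by rewrite !raD IHx IHy addrACA.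
by rewrite !raE ractDr /p pure_rawDr.
Qed.
Next Obligation.
elim/tens_raw_ind: m => [m n|x y IHx IHy]; last by rewrite !raD IHx IHy.
by rewrite !raE ractM.
Qed.
Next Obligation.
elim/tens_raw_ind: m => [m n|x y IHx IHy]; last by rewrite raD !laD raD IHx IHy.
by rewrite raE !laE raE.
Qed.

Definition pure (m : M) (n : N) : tens := p m n.

Lemma tens_sum (x : tens) : exists s : seq (M * N), x = \sum_(q <- s) pure q.1 q.2.
Proof. by exists (repr (x : tens_sort _ _)); apply: tens_sumE. Qed.
Lemma pureDl m m' n : pure (m + m') n = pure m n + pure m' n.
Proof. exact: pure_rawDl. Qed.
Lemma pureDr m n n' : pure m (n + n') = pure m n + pure m n'.
Proof. exact: pure_rawDr. Qed.
Lemma pure_bal m s n : pure (m <* s) n = pure m (s *> n).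
Proof. exact: pure_raw_bal. Qed.
Lemma lact_pure r m n : r *> pure m n = pure (r *> m) n.
Proof. exact: laE. Qed.
Lemma ract_pure m n t : pure m n <* t = pure m (n <* t).
Proof. exact: raE. Qed.
Lemma tens_ind (P : tens -> Prop) :
  (forall m n, P (pure m n)) -> (forall x y, P x -> P y -> P (x + y)) ->
  forall x, P x.
Proof. exact: tens_raw_ind. Qed.

Local Obligation Tactic := intros; cbv beta.

Section Lift.
Variables (V : bimod R T) (b : M -> N -> V).
Hypotheses (bDl : forall m m' n, b (m + m') n = b m n + b m' n)
  (bDr : forall m n n', b m (n + n') = b m n + b m n')
  (bbal : forall m s n, b (m <* s) n = b m (s *> n))
  (bL : forall r m n, b (r *> m) n = r *> b m n)
  (bR : forall m n t, b m (n <* t) = b m n <* t).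

Program Definition lift : bihom tens V :=
  @BiHom R T tens V (lift_raw b) _ _ _.
Next Obligation. exact: lift_rawD. Qed.
Next Obligation.
elim/tens_ind: m => [m n|x y IHx IHy]; first by rewrite lact_pure !lift_rawE.
by rewrite lactDr !lift_rawD // IHx IHy lactDr.
Qed.
Next Obligation.
elim/tens_ind: m => [m n|x y IHx IHy]; first by rewrite ract_pure !lift_rawE.
by rewrite ractDl !lift_rawD // IHx IHy ractDl.
Qed.

Lemma liftE m n : lift (pure m n) = b m n.
Proof. exact: lift_rawE. Qed.
End Lift.
End TensorBimod.
Local Obligation Tactic := intros; cbv beta.

Arguments tens : simpl never.
Arguments pure {R S T M N} m n : simpl never.
Arguments lift {R S T M N V} b bDl bDr bbal bL bR.
Notation "M ⊗ N" := (tens M N) (at level 40, left associativity).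

(* Keep [/=] from unfolding the maps out of a tensor product. *)
Arguments bfun {R S M N} b _ : simpl never.

Lemma idbE (R S : rng) (M : bimod R S) (m : M) : idb M m = m.
Proof. by []. Qed.
Lemma compbE (R S : rng) (M N P : bimod R S) (f : bihom N P) (g : bihom M N) m :
  compb f g m = f (g m).
Proof. by []. Qed.

Definition addE := (bfunD, pureDl, pureDr, lactDr, ractDl).

Program Definition tmap (R S T : rng) (M M' : bimod R S) (N N' : bimod S T)
  (f : bihom M M') (g : bihom N N') : bihom (M ⊗ N) (M' ⊗ N') :=
  lift (fun m n => pure (f m) (g n)) _ _ _ _ _.
Next Obligation. by rewrite !addE. Qed.
Next Obligation. by rewrite !addE. Qed.
Next Obligation. by rewrite bfunL bfunR pure_bal. Qed.
Next Obligation. by rewrite bfunL lact_pure. Qed.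
Next Obligation. by rewrite bfunR ract_pure. Qed.
Notation "f ⊠ g" := (tmap f g) (at level 40, left associativity).

Lemma tmapE (R S T : rng) (M M' : bimod R S) (N N' : bimod S T)
  (f : bihom M M') (g : bihom N N') m n : (f ⊠ g) (pure m n) = pure (f m) (g n).
Proof. exact: liftE. Qed.

Lemma tmap1 (R S T : rng) (M : bimod R S) (N : bimod S T) (x : M ⊗ N) :
  (idb M ⊠ idb N) x = x.
Proof.
by elim/tens_ind: x => [m n|x y IHx IHy]; rewrite ?tmapE // !addE IHx IHy.
Qed.

Section Assoc.
Variables (Q R S T : rng) (M : bimod Q R) (N : bimod R S) (P : bimod S T).

Let f (x : M ⊗ N) (p : P) : M ⊗ (N ⊗ P) :=
  lift_raw (fun m n => pure m (pure n p)) x.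
Let fE m n p : f (pure m n) p = pure m (pure n p).
Proof.
by rewrite /f lift_rawE // => *; rewrite ?addE // pure_bal lact_pure.
Qed.
Let fD x y p : f (x + y) p = f x p + f y p.
Proof.
by rewrite /f lift_rawD // => *; rewrite ?addE // pure_bal lact_pure.
Qed.

Program Definition assoc : bihom (M ⊗ N ⊗ P) (M ⊗ (N ⊗ P)) := lift f _ _ _ _ _.
Next Obligation. exact: fD. Qed.
Next Obligation.
elim/tens_ind: m => [m k|x y IHx IHy]; first by rewrite !fE !addE.
by rewrite !fD IHx IHy addrACA.
Qed.
Next Obligation.
elim/tens_ind: m => [m k|x y IHx IHy]; first by rewrite ract_pure !fE pure_bal.
by rewrite ractDl !fD IHx IHy.
Qed.
Next Obligation.
elim/tens_ind: m => [m k|x y IHx IHy]; first by rewrite lact_pure !fE lact_pure.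
by rewrite lactDr !fD IHx IHy lactDr.
Qed.
Next Obligation.
elim/tens_ind: m => [m k|x y IHx IHy]; first by rewrite !fE !ract_pure.
by rewrite !fD IHx IHy ractDl.
Qed.

Lemma assocE m n p : assoc (pure (pure m n) p) = pure m (pure n p).
Proof. by rewrite liftE fE. Qed.

Let g (m : M) (y : N ⊗ P) : M ⊗ N ⊗ P :=
  lift_raw (fun n p => pure (pure m n) p) y.
Let gE m n p : g m (pure n p) = pure (pure m n) p.
Proof.
by rewrite /g lift_rawE // => *; rewrite ?addE // -pure_bal ract_pure.
Qed.
Let gD m x y : g m (x + y) = g m x + g m y.
Proof.
by rewrite /g lift_rawD // => *; rewrite ?addE // -pure_bal ract_pure.
Qed.

Program Definition assocV : bihom (M ⊗ (N ⊗ P)) (M ⊗ N ⊗ P) := lift g _ _ _ _ _.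
Next Obligation.
elim/tens_ind: n => [k p|x y IHx IHy]; first by rewrite !gE !addE.
by rewrite !gD IHx IHy addrACA.
Qed.
Next Obligation. exact: gD. Qed.
Next Obligation.
elim/tens_ind: n => [k p|x y IHx IHy]; first by rewrite lact_pure !gE pure_bal.
by rewrite lactDr !gD IHx IHy.
Qed.
Next Obligation.
elim/tens_ind: n => [k p|x y IHx IHy]; first by rewrite !gE !lact_pure.
by rewrite !gD IHx IHy lactDr.
Qed.
Next Obligation.
elim/tens_ind: n => [k p|x y IHx IHy]; first by rewrite ract_pure !gE ract_pure.
by rewrite ractDl !gD IHx IHy ractDl.
Qed.

Lemma assocVE m n p : assocV (pure m (pure n p)) = pure (pure m n) p.
Proof. by rewrite liftE gE. Qed.
End Assoc.
Arguments assoc {Q R S T M N P}.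
Arguments assocV {Q R S T M N P}.

Program Definition mulr_map (R S : rng) (M : bimod R S) : bihom (M ⊗ regular S) M :=
  lift (N := regular S) (V := M) (fun m (s : S) => m <* s) _ _ _ _ _.
Next Obligation. by rewrite ractDl. Qed.
Next Obligation. by rewrite ractDr. Qed.
Next Obligation. by rewrite -ractM. Qed.
Next Obligation. by rewrite lractA. Qed.
Next Obligation. by rewrite -ractM. Qed.
Arguments mulr_map {R S} M.

Program Definition mull_map (R S : rng) (M : bimod R S) : bihom (regular R ⊗ M) M :=
  lift (M := regular R) (V := M) (fun (r : R) m => r *> m) _ _ _ _ _.
Next Obligation. by rewrite lactDl. Qed.
Next Obligation. by rewrite lactDr. Qed.
Next Obligation. by rewrite -lactM. Qed.
Next Obligation. by rewrite -lactM. Qed.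
Next Obligation. by rewrite lractA. Qed.
Arguments mull_map {R S} M.

Lemma mulr_mapE (R S : rng) (M : bimod R S) (m : M) (s : regular S) :
  mulr_map M (pure m s) = m <* (s : S).
Proof. exact: liftE. Qed.
Lemma mull_mapE (R S : rng) (M : bimod R S) (r : regular R) (m : M) :
  mull_map M (pure r m) = (r : R) *> m.
Proof. exact: liftE. Qed.

Definition firm_right (R S : rng) (M : bimod R S) : Prop := bijective (mulr_map M).
Definition firm_left (R S : rng) (M : bimod R S) : Prop := bijective (mull_map M).
Definition firm_ring (R : rng) : Prop :=
  firm_right (regular R) /\ firm_left (regular R).

(* Every finite subset of [M] has a common right unit in [S]; when [S] has local
   units this is equivalent to [M] being firm. *)
Definition sunital (R S : rng) (M : bimod R S) : Prop :=
  forall X : seq M, exists e : S, forall m, m \in X -> m <* e = m.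

Lemma sunital_firm (R S : rng) (M : bimod R S) :
  has_local_units S -> sunital M -> firm_right M.
Proof.
move=> hS hM; pose f := mulr_map M.
have key (x : M ⊗ regular S) : exists e : S, x = pure (f x) (e : regular S).
  have [s ->] := tens_sum x.
  have [e eX] := hS [seq (q.2 : S) | q <- s]; exists e.
  have : {subset [seq (q.2 : S) | q <- s] <= [seq (q.2 : S) | q <- s]} by [].
  elim: {1 3 4}s => [_|[m r] t IHt sub].
    rewrite !big_nil bfun0; apply/esym.
    by apply: (morphD0 (f := fun z => pure z (e : regular S))) => y z; rewrite pureDl.
  rewrite !big_cons bfunD pureDl; congr (_ + _); last first.
    by apply: IHt => y yt; apply: sub; rewrite /= inE yt orbT.
  rewrite /f mulr_mapE pure_bal; apply: esym.
  have er : (r : S) *> (e : regular S) = r.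
    by apply: (proj2 (eX r _)); apply: sub; rewrite /= inE eqxx.
  by rewrite er.
have finj : injective f.
  move=> x y exy; have [e ex] := key (x - y).
  apply/eqP; rewrite -subr_eq0; apply/eqP; rewrite ex bfunD.
  rewrite (morphDN (bfunD f)) exy subrr.
  by apply: (morphD0 (f := fun z => pure z (e : regular S))) => z w; rewrite pureDl.
have fsurj m : exists x, f x = m.
  have [e eM] := hM [:: m]; exists (pure m (e : regular S)).
  by rewrite mulr_mapE eM // inE.
exists (fun m => sval (cid (fsurj m))) => x; last by case: cid.
by apply: finj; case: cid.
Qed.

Lemma sunital_tens (R S T : rng) (M : bimod R S) (N : bimod S T) :
  sunital N -> sunital (M ⊗ N).
Proof.
move=> hN X; have [c cE] := choice (@tens_sum R S T M N).
have [e eN] := hN (flatten [seq [seq q.2 | q <- c x] | x <- X]).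
exists e => x xX; have : {subset [seq q.2 | q <- c x] <=
    flatten [seq [seq q.2 | q <- c x] | x <- X]}.
  by move=> n nx; apply/flattenP; exists [seq q.2 | q <- c x] => //; apply: map_f.
rewrite [x in x <* _]cE [RHS]cE; move: (c x) => s.
elim: s => [_|[m n] t IHt sub]; first by rewrite big_nil ract0.
rewrite big_cons ractDl IHt => [|y yt]; last by apply: sub; rewrite /= inE yt orbT.
by congr (_ + _); rewrite ract_pure eN // sub //= inE eqxx.
Qed.

Lemma sunital_regular (S : rng) : has_local_units S -> sunital (regular S).
Proof.
move=> hS X; have [e eX] := hS X.
by exists e => x xX; rewrite /= (proj2 (eX _ xX)).
Qed.

Lemma firm_sunital (R S : rng) (M : bimod R S) :
  has_local_units S -> firm_right M -> sunital M.
Proof.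
move=> hS fM X.
have [e eX] := sunital_tens (sunital_regular hS) [seq binv fM m | m <- X].
exists e => m mX; rewrite -{2}(binvK fM m) -(eX _ (map_f _ mX)).
by rewrite bfunR binvK.
Qed.

Lemma sunital_sub (R S : rng) (M : bimod R S) (P : M -> Prop) P0 PD PN PL PR :
  sunital M -> sunital (@submod R S M P P0 PD PN PL PR).
Proof.
move=> hM X; have [e eX] := hM [seq sub_val x | x <- X].
by exists e => x xX; apply: sub_val_inj; rewrite /= eX // map_f.
Qed.

Lemma firm_tens_regular (R S : rng) (M : bimod R S) :
  has_local_units S -> firm_right (M ⊗ regular S).
Proof. by move=> hS; apply/sunital_firm/sunital_tens/sunital_regular. Qed.

Lemma firm_unital_left (A : pzRingType) (S : rng) (M : bimod A S) :
  firm_left M -> unital_left M.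
Proof.
move=> fM m; rewrite -(binvK fM m); elim/tens_ind: (binv fM m) => [a n|x y IHx IHy].
  by rewrite mull_mapE -lactM /=; congr (_ *> _); apply: mul1r.
by rewrite !addE IHx IHy.
Qed.

Lemma firm_unital_right (R : rng) (A : pzRingType) (M : bimod R A) :
  firm_right M -> unital_right M.
Proof.
move=> fM m; rewrite -(binvK fM m); elim/tens_ind: (binv fM m) => [n a|x y IHx IHy].
  by rewrite mulr_mapE -ractM /=; congr (_ <* _); apply: mulr1.
by rewrite !addE IHx IHy.
Qed.

Record firm_module (R : rng) := FirmModule {
  fm_mod :> bimod rng0 R;
  fm_firm : firm_right fm_mod }.

Lemma comp1b (R S : rng) (M N : bimod R S) (f : bihom M N) : compb (idb N) f = f.
Proof. exact: bihomP. Qed.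
Lemma compb1 (R S : rng) (M N : bimod R S) (f : bihom M N) : compb f (idb M) = f.
Proof. exact: bihomP. Qed.

Program Definition firm_cat (R : rng) : category :=
  @Category (firm_module R) (fun M N => bihom M N) (fun M => idb M)
    (fun M N P f g => compb f g) _ _ _.
Next Obligation. exact: bihomP. Qed.
Next Obligation. exact: bihomP. Qed.
Next Obligation. exact: bihomP. Qed.

(* [- ⊗ N] preserves exactness at the middle of [M1 -> M2 -> M3], for all right
   modules in the class [P]. *)
Definition flat_on (R S : rng) (P : bimod rng0 R -> Prop) (N : bimod R S) : Prop :=
  forall (M1 M2 M3 : bimod rng0 R) (f : bihom M1 M2) (g : bihom M2 M3),
    P M1 -> P M2 -> P M3 ->
    (forall y, g y = 0 <-> exists x, f x = y) ->
    forall y, (g ⊠ idb N) y = 0 <-> exists x, (f ⊠ idb N) x = y.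

Definition flat_left (R S : rng) (N : bimod R S) : Prop :=
  flat_on (fun _ => True) N.

Definition unital_flat_left (A : pzRingType) (S : rng) (N : bimod A S) : Prop :=
  flat_on (fun M => unital_right M) N.

Definition faithfully_flat_left (R S : rng) (N : bimod R S) : Prop :=
  flat_left N /\
  forall (M M' : firm_module R) (f g : bihom M M'),
    f ⊠ idb N = g ⊠ idb N -> f = g.

Section RightHom.
Variables (R B A : rng) (M : bimod R A) (N : bimod B A).

(* Hom_A(M, N), with [(b *> f) u = b *> f u] and [(f <* r) u = f (r *> u)]. *)
Let H : zmodType := GRing.Zmodule.clone (bihom (forget_left M) (forget_left N)) _.

Program Definition rhom_lact (b : B) (f : H) : H :=
  @BiHom _ _ (forget_left M) (forget_left N) (fun u => b *> (f u : N)) _ _ _.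
Next Obligation. by move=> x y; rewrite bfunD lactDr. Qed.
Next Obligation. by rewrite (bfun0 f) lact0. Qed.
Next Obligation. by rewrite bfunR lractA. Qed.

Program Definition rhom_ract (f : H) (r : R) : H :=
  @BiHom _ _ (forget_left M) (forget_left N) (fun u => f (r *> (u : M))) _ _ _.
Next Obligation. by move=> x y; rewrite lactDr bfunD. Qed.
Next Obligation. by rewrite lact0 (bfun0 f). Qed.
Next Obligation. by rewrite lractA (bfunR f). Qed.

Lemma rhom_lactE b f u : rhom_lact b f u = b *> (f u : N).
Proof. by []. Qed.
Lemma rhom_ractE f r u : rhom_ract f r u = f (r *> (u : M)).
Proof. by []. Qed.

Program Definition rhom : bimod B R := @Bimod B R H rhom_lact rhom_ract _ _ _ _ _ _ _.
Next Obligation. by apply: bihomP => u; rewrite addbE !rhom_lactE lactDl. Qed.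
Next Obligation. by apply: bihomP => u; rewrite addbE !rhom_lactE addbE lactDr. Qed.
Next Obligation. by apply: bihomP => u; rewrite !rhom_lactE lactM. Qed.
Next Obligation. exact: bihomP. Qed.
Next Obligation.
by apply: bihomP => u; rewrite addbE !rhom_ractE lactDl (bfunD (m : bihom _ _)).
Qed.
Next Obligation. by apply: bihomP => u; rewrite !rhom_ractE lactM. Qed.
Next Obligation. exact: bihomP. Qed.
End RightHom.

Definition dual (R A : rng) (M : bimod R A) : bimod A R := rhom M (regular A).

Definition dagger (R A : rng) (M : bimod R A) : bimod A R := dual M ⊗ regular R.

Definition locally_projective (R A : rng) (M : bimod R A) : Prop :=
  forall us : seq M, exists ef : seq (M * dual M),
    forall u, u \in us -> u = \sum_(p <- ef) p.1 <* (p.2 u : A).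

Record coring (A : pzRingType) := Coring {
  cor_mod :> bimod A A;
  cor_unitl : unital_left cor_mod;
  cor_unitr : unital_right cor_mod;
  comul : bihom cor_mod (cor_mod ⊗ cor_mod);
  counit : bihom cor_mod (regular A);
  comul_assoc : forall c,
    assoc ((comul ⊠ idb _) (comul c)) = (idb _ ⊠ comul) (comul c);
  counitl : forall c, mull_map _ ((counit ⊠ idb _) (comul c)) = c;
  counitr : forall c, mulr_map _ ((idb _ ⊠ counit) (comul c)) = c }.
Arguments comul {A} c0.
Arguments counit {A} c0.

Definition isomorphic_by (A : pzRingType) (D C : coring A) (theta : bihom D C) : Prop :=
  [/\ bijective theta,
      forall d, counit C (theta d) = counit D d
    & forall d, comul C (theta d) = (theta ⊠ theta) (comul D d)].

(* An [R]-[A]-bimodule which is a right [C]-comodule with left [R]-linear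
   coaction; right [C]-comodules are the case [R := rng0]. *)
Record comod (A : pzRingType) (R : rng) (C : coring A) := Comod {
  com_mod :> bimod R A;
  com_unit : unital_right com_mod;
  coact : bihom com_mod (com_mod ⊗ C);
  coact_assoc : forall m,
    assoc ((coact ⊠ idb C) (coact m)) = (idb _ ⊠ comul C) (coact m);
  coact_counit : forall m, mulr_map _ ((idb _ ⊠ counit C) (coact m)) = m }.
Arguments coact {A R C} c.

Definition is_left_coaction (A : pzRingType) (C : coring A) (R : rng)
    (L : bimod A R) (lam : bihom L (C ⊗ L)) : Prop :=
  [/\ unital_left L,
      forall x, assoc ((comul C ⊠ idb L) (lam x)) = (idb C ⊠ lam) (lam x)
    & forall x, mull_map L ((counit C ⊠ idb L) (lam x)) = x].

(* Left [C]-comodules with a right [R]-action by colinear maps. *)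
Record lcomod (A : pzRingType) (C : coring A) (R : rng) := LComod {
  lcom_mod :> bimod A R;
  lcoact : bihom lcom_mod (C ⊗ lcom_mod);
  lcoactP : is_left_coaction lcoact }.
Arguments lcoact {A C R} l.

Section Comod.
Variables (A : pzRingType) (C : coring A).

Definition is_colinear (R : rng) (M N : comod R C) (f : bihom M N) : Prop :=
  forall m, coact N (f m) = (f ⊠ idb C) (coact M m).

Record colin (R : rng) (M N : comod R C) := Colin {
  colin_fun :> bihom M N;
  colinP : is_colinear colin_fun }.

Lemma colin_eq (R : rng) (M N : comod R C) (f g : colin M N) : f =1 g -> f = g.
Proof.
case: f g => [f fP] [g gP] /= /bihomP efg; subst g.
by congr Colin; apply: Prop_irrelevance.
Qed.

Program Definition colin_id (R : rng) (M : comod R C) : colin M M := Colin (colin_fun := idb M) _.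
Next Obligation. by move=> m; rewrite tmap1. Qed.

Lemma tmap_comp (R S T : rng) (M M' M'' : bimod R S) (N N' N'' : bimod S T)
  (f : bihom M M') (f' : bihom M' M'') (g : bihom N N') (g' : bihom N' N'') x :
  (f' ⊠ g') ((f ⊠ g) x) = (compb f' f ⊠ compb g' g) x.
Proof.
by elim/tens_ind: x => [m n|x y IHx IHy]; rewrite ?tmapE // !addE IHx IHy.
Qed.

Program Definition colin_comp (R : rng) (M N P : comod R C)
  (f : colin N P) (g : colin M N) : colin M P := Colin (colin_fun := compb f g) _.
Next Obligation.
move=> m; rewrite /= !colinP tmap_comp.
by congr ((_ ⊠ _) _); apply: bihomP.
Qed.

Program Definition comod_cat : category :=
  @Category (comod rng0 C) (fun M N => colin M N) (fun M => colin_id M)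
    (fun M N P f g => colin_comp f g) _ _ _.
Next Obligation. exact: colin_eq. Qed.
Next Obligation. exact: colin_eq. Qed.
Next Obligation. exact: colin_eq. Qed.

Lemma lact_rng0 (S : rng) (M : bimod rng0 S) (r : rng0) (m : M) : r *> m = 0.
Proof.
apply: (@addrI _ (r *> m)); rewrite -lactDl addr0.
by congr (_ *> _); rewrite [LHS]ord1 [RHS]ord1.
Qed.

Program Definition forget_map (R S : rng) (M N : bimod R S) (f : bihom M N) :
  bihom (forget_left M) (forget_left N) :=
  @BiHom _ _ (forget_left M) (forget_left N) f (bfunD f) _ (bfunR f).
Next Obligation. by rewrite !lact_rng0 (bfun0 f). Qed.

(* The identity of the underlying abelian groups. *)
Program Definition forget_tens (R S T : rng) (M : bimod R S) (N : bimod S T) :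
  bihom (forget_left (M ⊗ N)) (forget_left M ⊗ N) :=
  @BiHom _ _ (forget_left (M ⊗ N)) (forget_left M ⊗ N) (fun x : M ⊗ N => x) _ _ _.
Next Obligation. by []. Qed.
Next Obligation. by rewrite !lact_rng0. Qed.
Next Obligation. by []. Qed.

Program Definition comod_forget (R : rng) (M : comod R C) : comod rng0 C :=
  @Comod A rng0 C (forget_left M) (@com_unit _ _ _ M)
    (compb (forget_tens M C) (forget_map (coact M))) _ _.
Next Obligation. exact: (coact_assoc m). Qed.
Next Obligation. exact: (coact_counit m). Qed.

(* An associative action of [R] on a right comodule by colinear maps, i.e. a left
   [R]-action which commutes with [A] and makes the coaction left [R]-linear. *)
Definition is_left_action (R : rng) (M : comod rng0 C) (L : R -> colin M M) : Prop :=
  (forall r r' m, L (r + r') m = L r m + L r' m) /\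
  (forall r r' m, L (rmul r r') m = L r (L r' m)).

Section AddLeft.
Variables (R : rng) (M : comod rng0 C) (L : R -> colin M M) (LP : is_left_action L).

Program Definition bimod_add : bimod R A :=
  @Bimod R A M (fun r m => L r m) (fun m a => m <* a) _ _ _ _ _ _ _.
Next Obligation. exact: LP.1. Qed.
Next Obligation. exact: bfunD. Qed.
Next Obligation. exact: LP.2. Qed.
Next Obligation. exact: ractDl. Qed.
Next Obligation. exact: ractDr. Qed.
Next Obligation. exact: ractM. Qed.
Next Obligation. by rewrite bfunR. Qed.

Program Definition coact_add : bihom bimod_add (bimod_add ⊗ C) :=
  @BiHom R A bimod_add (bimod_add ⊗ C) (coact M) _ _ _.
Next Obligation. exact: (bfunD (coact M)). Qed.
Next Obligation. exact: (colinP (L r) m). Qed.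
Next Obligation. exact: (bfunR (coact M)). Qed.

Program Definition comod_add : comod R C :=
  @Comod A R C bimod_add (@com_unit _ _ _ M) coact_add _ _.
Next Obligation. exact: (@coact_assoc _ _ _ M m). Qed.
Next Obligation. exact: (@coact_counit _ _ _ M m). Qed.
End AddLeft.
End Comod.

Section TensCoact.
Variables (Q R A : rng) (M : bimod Q R) (S : bimod R A) (C : bimod A A).
Variables (D : bihom C (C ⊗ C)) (rho : bihom S (S ⊗ C)).

Definition tens_coact : bihom (M ⊗ S) (M ⊗ S ⊗ C) :=
  compb assocV (idb M ⊠ rho).

Lemma tens_coactE m u : tens_coact (pure m u) = assocV (pure m (rho u)).
Proof. by rewrite compbE tmapE. Qed.

Lemma tens_coact_assoc m u :
  assoc ((rho ⊠ idb C) (rho u)) = (idb S ⊠ D) (rho u) ->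
  assoc ((tens_coact ⊠ idb C) (tens_coact (pure m u)))
    = (idb (M ⊗ S) ⊠ D) (tens_coact (pure m u)).
Proof.
move=> rhoA; rewrite tens_coactE.
have -> (x : S ⊗ C) : (idb (M ⊗ S) ⊠ D) (assocV (pure m x))
    = assocV (pure m ((idb S ⊠ D) x)).
  elim/tens_ind: x => [v c|x y IHx IHy]; last by rewrite !addE IHx IHy.
  by rewrite assocVE !tmapE assocVE.
rewrite -rhoA; elim/tens_ind: (rho u) => [v c|x y IHx IHy].
  rewrite assocVE !tmapE tens_coactE.
  elim/tens_ind: (rho v) => [w d|x y IHx IHy]; last by rewrite !addE IHx IHy.
  by rewrite assocVE !assocE assocVE.
by rewrite !addE IHx IHy.
Qed.

Lemma tens_coact_counit (eps : bihom C (regular A)) m u :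
  mulr_map _ ((idb _ ⊠ eps) (tens_coact (pure m u)))
    = pure m (mulr_map _ ((idb _ ⊠ eps) (rho u))).
Proof.
rewrite tens_coactE; elim/tens_ind: (rho u) => [v c|x y IHx IHy].
  by rewrite assocVE !tmapE !mulr_mapE ract_pure.
by rewrite !addE IHx IHy.
Qed.
End TensCoact.

Lemma tens_unitr (Q R : rng) (A : pzRingType) (M : bimod Q R) (N : bimod R A) :
  unital_right N -> unital_right (M ⊗ N).
Proof.
move=> hN x; elim/tens_ind: x => [m n|x y IHx IHy]; last by rewrite !addE IHx IHy.
by rewrite ract_pure hN.
Qed.

Lemma tens_unitl (Q R : rng) (A : pzRingType) (M : bimod A Q) (N : bimod Q R) :
  unital_left M -> unital_left (M ⊗ N).
Proof.
move=> hM x; elim/tens_ind: x => [m n|x y IHx IHy]; last by rewrite !addE IHx IHy.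
by rewrite lact_pure hM.
Qed.

Section TensFunctor.
Variables (A : pzRingType) (C : coring A) (R : rng) (Sigma : comod R C).

Program Definition tens_comod (Q : rng) (M : bimod Q R) : comod Q C :=
  @Comod A Q C (M ⊗ Sigma) (tens_unitr (@com_unit _ _ _ Sigma))
    (tens_coact M (coact Sigma)) _ _.
Next Obligation.
elim/tens_ind: m => [m u|x y IHx IHy].
  exact/tens_coact_assoc/coact_assoc.
by rewrite !bfunD IHx IHy.
Qed.
Next Obligation.
elim/tens_ind: m => [m u|x y IHx IHy].
  by rewrite tens_coact_counit coact_counit.
by rewrite !bfunD IHx IHy.
Qed.

Program Definition tens_colin (Q : rng) (M N : bimod Q R) (f : bihom M N) :
  colin (tens_comod M) (tens_comod N) := Colin (colin_fun := f ⊠ idb Sigma) _.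
Next Obligation.
move=> x; elim/tens_ind: x => [m u|x y IHx IHy]; last by rewrite !bfunD IHx IHy.
rewrite tmapE [LHS]tens_coactE [coact _ _ in RHS]tens_coactE.
elim/tens_ind: (coact Sigma u) => [v c|x y IHx IHy]; last by rewrite !addE IHx IHy.
by rewrite !assocVE !tmapE.
Qed.

Program Definition tens_functor : functor (firm_cat R) (comod_cat C) :=
  @Functor (firm_cat R) (comod_cat C) (fun M => tens_comod M)
    (fun M N f => tens_colin f) _ _.
Next Obligation. by apply: colin_eq => m; apply: tmap1. Qed.
Next Obligation.
apply: colin_eq => m; apply: esym.
rewrite -[LHS]/((f ⊠ idb Sigma) ((g ⊠ idb Sigma) m)) tmap_comp.
by congr ((_ ⊠ _) _); apply: bihomP.
Qed.
End TensFunctor.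

Section HomFunctor.
Variables (A : pzRingType) (C : coring A) (R : rng) (Sigma : comod R C).
Hypothesis (hR : has_local_units R).

Let colinear (N : comod rng0 C) (f : rhom Sigma N) : Prop :=
  is_colinear (M := comod_forget Sigma) (N := comod_forget N) f.

Lemma tmap_addl (Q S T : rng) (M M' : bimod Q S) (N N' : bimod S T)
  (f f' : bihom M M') (g : bihom N N') x :
  ((f + f') ⊠ g) x = (f ⊠ g) x + (f' ⊠ g) x.
Proof.
elim/tens_ind: x => [m n|x y IHx IHy]; last by rewrite !bfunD IHx IHy addrACA.
by rewrite !tmapE addbE pureDl.
Qed.

Lemma tmap_0l (Q S T : rng) (M M' : bimod Q S) (N N' : bimod S T)
  (g : bihom N N') x : ((0 : bihom M M') ⊠ g) x = 0.
Proof.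
by apply: (@addrI _ (((0 : bihom M M') ⊠ g) x)); rewrite -tmap_addl !addr0.
Qed.

Lemma tmap_oppl (Q S T : rng) (M M' : bimod Q S) (N N' : bimod S T)
  (f : bihom M M') (g : bihom N N') x : ((- f) ⊠ g) x = - (f ⊠ g) x.
Proof. by apply/eqP; rewrite -addr_eq0 -tmap_addl addNr tmap_0l. Qed.

Let colinear0 N : @colinear N 0.
Proof. by move=> u; rewrite [RHS]tmap_0l; apply: (bfun0 (coact (comod_forget N))). Qed.
Let colinearD N f g : @colinear N f -> colinear g -> colinear (f + g).
Proof.
move=> fP gP u; rewrite [RHS]tmap_addl.
exact: etrans (bfunD (coact (comod_forget N)) _ _) (congr2 +%R (fP u) (gP u)).
Qed.
Let colinearN N f : @colinear N f -> colinear (- f).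
Proof.
move=> fP u; rewrite [RHS]tmap_oppl.
exact: etrans (morphDN (bfunD (coact (comod_forget N))) _) (congr1 -%R (fP u)).
Qed.
Let colinearL N r f : @colinear N f -> colinear (r *> f).
Proof. by move=> fP; rewrite lact_rng0. Qed.
Let colinearR N f r : @colinear N f -> colinear (f <* r).
Proof.
move=> fP u; rewrite [LHS](fP (r *> (u : Sigma))).
rewrite -[X in (f ⊠ _) X]/(coact Sigma (r *> (u : Sigma))) bfunL.
rewrite -[X in _ = _ X]/(coact Sigma u).
elim/tens_ind: (coact Sigma u) => [v c|x y IHx IHy].
  by rewrite lact_pure [LHS]tmapE [RHS]tmapE.
by rewrite lactDr [LHS]bfunD [RHS]bfunD IHx IHy.
Qed.

(* [Hom^C(Sigma, N)], with right [R]-action [(f <* r) u = f (r *> u)]. *)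
Definition colin_mod (N : comod rng0 C) : bimod rng0 R :=
  submod (@colinear0 N) (@colinearD N) (@colinearN N) (@colinearL N) (@colinearR N).

Program Definition colin_map (N N' : comod rng0 C) (g : colin N N') :
  bihom (colin_mod N) (colin_mod N') :=
  @BiHom _ _ (colin_mod N) (colin_mod N')
    (fun f => @SubElt _ _ (rhom Sigma N') _ (compb (forget_map g) (sub_val f)) _) _ _ _.
Next Obligation.
move=> u; rewrite [LHS](colinP g (sub_val f u)) [coact _ _ in LHS](sub_prop f u).
pose h : bihom (forget_left Sigma) (forget_left N) := sub_val f.
rewrite -[LHS]/((forget_map g ⊠ idb C) ((h ⊠ idb C) (coact (comod_forget Sigma) u))).
by rewrite tmap_comp; congr ((_ ⊠ _) _); apply: bihomP.
Qed.
Next Obligation.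
by move=> f f'; apply: sub_val_inj; apply: bihomP => u; apply: (bfunD g).
Qed.
Next Obligation.
by apply: sub_val_inj; apply: bihomP => u; apply: (bfunL g).
Qed.
Next Obligation. by apply: sub_val_inj; apply: bihomP. Qed.

Program Definition hom_functor : functor (comod_cat C) (firm_cat R) :=
  @Functor (comod_cat C) (firm_cat R)
    (fun N => FirmModule (firm_tens_regular (colin_mod N) hR))
    (fun N N' g => colin_map g ⊠ idb (regular R)) _ _.
Next Obligation.
apply: bihomP => y; rewrite -[RHS]tmap1; congr ((_ ⊠ _) y).
by apply: bihomP => f; apply: sub_val_inj; apply: bihomP.
Qed.
Next Obligation.
apply: bihomP => w; rewrite [RHS]tmap_comp; congr ((_ ⊠ _) w); last exact: bihomP.
by apply: bihomP => h; apply: sub_val_inj; apply: bihomP.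
Qed.
End HomFunctor.

Section Cotensor.
Variables (A : pzRingType) (C : coring A) (R : rng) (L : lcomod C R).
Hypotheses (hR : has_local_units R) (hL : firm_right L).

Let equalized (N : comod rng0 C) (x : N ⊗ L) : Prop :=
  assoc ((coact N ⊠ idb L) x) = (idb N ⊠ lcoact L) x.

Let equalized0 N : @equalized N 0.
Proof. by rewrite /equalized !bfun0. Qed.
Let equalizedD N x y : @equalized N x -> equalized y -> equalized (x + y).
Proof. by rewrite /equalized !bfunD => -> ->. Qed.
Let equalizedN N x : @equalized N x -> equalized (- x).
Proof.
rewrite /equalized => xP.
by rewrite !(morphDN (bfunD _)) xP.
Qed.
Let equalizedL N r x : @equalized N x -> equalized (r *> x).
Proof. by rewrite /equalized !bfunL => ->. Qed.
Let equalizedR N x r : @equalized N x -> equalized (x <* r).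
Proof. by rewrite /equalized !bfunR => ->. Qed.

(* [N ⊗^C L], the kernel of [rho_N ⊗ L - N ⊗ rho_L], as a right [R]-module. *)
Definition cotens (N : comod rng0 C) : bimod rng0 R :=
  submod (@equalized0 N) (@equalizedD N) (@equalizedN N) (@equalizedL N) (@equalizedR N).

Lemma cotens_firm N : firm_right (cotens N).
Proof. exact/(sunital_firm hR)/sunital_sub/sunital_tens/firm_sunital. Qed.

Program Definition cotens_map (N N' : comod rng0 C) (g : colin N N') :
  bihom (cotens N) (cotens N') :=
  @BiHom _ _ (cotens N) (cotens N')
    (fun x => @SubElt _ _ (N' ⊗ L) _ ((g ⊠ idb L) (sub_val x)) _) _ _ _.
Next Obligation.
rewrite /equalized; case: x => x /= xP; rewrite tmap_comp.
have -> : compb (coact N') g = compb (g ⊠ idb C) (coact N).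
  by apply: bihomP => n; rewrite !compbE colinP.
rewrite -[idb L in LHS]comp1b -[X in assoc X]tmap_comp.
have -> (y : N ⊗ C ⊗ L) : assoc ((g ⊠ idb C ⊠ idb L) y) = (g ⊠ idb (C ⊗ L)) (assoc y).
  elim/tens_ind: y => [y l|y z IHy IHz]; last by rewrite !bfunD IHy IHz.
  elim/tens_ind: y => [n c|y z IHy IHz]; last by rewrite !addE IHy IHz.
  by rewrite !(tmapE, assocE).
by rewrite xP !tmap_comp !compb1 !comp1b.
Qed.
Next Obligation. by move=> x y; apply: sub_val_inj; apply: (bfunD (g ⊠ idb L)). Qed.
Next Obligation. by apply: sub_val_inj; apply: (bfunL (g ⊠ idb L)). Qed.
Next Obligation. by apply: sub_val_inj; apply: (bfunR (g ⊠ idb L)). Qed.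

Program Definition cotens_functor : functor (comod_cat C) (firm_cat R) :=
  @Functor (comod_cat C) (firm_cat R) (fun N => FirmModule (cotens_firm N))
    (fun N N' g => cotens_map g) _ _.
Next Obligation. by apply: bihomP => z; apply: sub_val_inj; apply: tmap1. Qed.
Next Obligation.
apply: bihomP => w; apply: sub_val_inj; apply: esym.
apply: etrans (tmap_comp _ _ _ _ _) _.
by congr ((_ ⊠ _) _); apply: bihomP.
Qed.
End Cotensor.

Record comatrix_context (R A : rng) (S : bimod R A) (S' : bimod A R) := ComatrixContext {
  ctx_firm_ringl : firm_ring R;
  ctx_firm_ringr : firm_ring A;
  ctx_firm_left : firm_left S;
  ctx_firm_right : firm_right S;
  ctx_firm_left' : firm_left S';
  ctx_firm_right' : firm_right S';
  ctx_eta : bihom (regular R) (S ⊗ S');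
  ctx_eps : bihom (S' ⊗ S) (regular A);
  (* e_r eps(f_r ⊗ u) = r u *)
  ctx_triangle : forall (r : regular R) u,
    mulr_map S ((idb S ⊠ ctx_eps) (assoc (pure (ctx_eta r) u))) = (r : R) *> u;
  (* eps(phi ⊗ e_r) f_r = phi r *)
  ctx_triangle' : forall phi (r : regular R),
    mull_map S' ((ctx_eps ⊠ idb S') (assocV (pure phi (ctx_eta r)))) = phi <* (r : R) }.

Section Comatrix.
Variables (R : rng) (A : pzRingType) (S : bimod R A) (S' : bimod A R).
Variable (k : comatrix_context S S').

(* u |-> e_r ⊗ (f_r ⊗ u^r), where r ⊗ u^r in R ⊗ S corresponds to u *)
Definition comatrix_coact : bihom S (S ⊗ (S' ⊗ S)) :=
  compb assoc (compb (ctx_eta k ⊠ idb S) (binv (ctx_firm_left k))).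

(* phi ⊗ u |-> (phi ⊗ e_r) ⊗ (f_r ⊗ u^r) *)
Definition comatrix_comul : bihom (S' ⊗ S) (S' ⊗ S ⊗ (S' ⊗ S)) :=
  tens_coact S' comatrix_coact.

Lemma comatrix_coactE r u : comatrix_coact (r *> u) = assoc (pure (ctx_eta k r) u).
Proof.
rewrite !compbE -[r *> u](mull_mapE (r : regular R)) bfunK.
by rewrite tmapE.
Qed.

Lemma comatrix_comulE phi u :
  comatrix_comul (pure phi u) = assocV (pure phi (comatrix_coact u)).
Proof. exact: tens_coactE. Qed.

Lemma firm_left_ind (P : S -> Prop) :
  (forall r u, P (r *> u)) -> (forall u v, P u -> P v -> P (u + v)) -> forall u, P u.
Proof.
move=> Pr PD u; rewrite -(binvK (ctx_firm_left k) u).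
elim/tens_ind: (binv _ u) => [r v|x y IHx IHy]; first by rewrite mull_mapE.
by rewrite bfunD; apply: PD.
Qed.

Lemma comatrix_coact_assoc u :
  assoc ((comatrix_coact ⊠ idb _) (comatrix_coact u))
    = (idb _ ⊠ comatrix_comul) (comatrix_coact u).
Proof.
elim/firm_left_ind: u => [r u|u v IHu IHv]; last by rewrite !bfunD IHu IHv.
elim/firm_left_ind: u => [s w|u v IHu IHv]; last by rewrite lactDr !bfunD IHu IHv.
rewrite [X in _ = _ X]comatrix_coactE.
have -> : comatrix_coact (r *> (s *> w)) = r *> assoc (pure (ctx_eta k s) w).
  by rewrite bfunL comatrix_coactE.
have -> (v : S) y : (idb S ⊠ comatrix_comul) (assoc (pure y v))
    = (idb S ⊠ assocV) (assoc (pure y (comatrix_coact v))).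
  elim/tens_ind: y => [e f|x y IHx IHy]; last by rewrite !addE IHx IHy.
  by rewrite !assocE !tmapE comatrix_comulE.
rewrite [X in _ = (_ ⊠ _) (assoc (pure _ X))]comatrix_coactE.
elim/tens_ind: (ctx_eta k s) => [e f|x y IHx IHy]; last by rewrite !addE IHx IHy.
rewrite assocE lact_pure !tmapE comatrix_coactE.
elim/tens_ind: (ctx_eta k r) => [e' f'|x y IHx IHy]; last by rewrite !addE IHx IHy.
by rewrite !assocE !tmapE assocVE.
Qed.

Lemma comatrix_assoc c :
  assoc ((comatrix_comul ⊠ idb _) (comatrix_comul c))
    = (idb _ ⊠ comatrix_comul) (comatrix_comul c).
Proof.
elim/tens_ind: c => [phi u|x y IHx IHy]; last by rewrite !bfunD IHx IHy.
exact/tens_coact_assoc/comatrix_coact_assoc.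
Qed.

Lemma comatrix_counitl c :
  mull_map _ ((ctx_eps k ⊠ idb _) (comatrix_comul c)) = c.
Proof.
elim/tens_ind: c => [phi u|x y IHx IHy]; last by rewrite !bfunD IHx IHy.
rewrite comatrix_comulE.
elim/firm_left_ind: u => [r u|u v IHu IHv]; last by rewrite !addE IHu IHv.
rewrite comatrix_coactE -pure_bal -(ctx_triangle' k).
elim/tens_ind: (ctx_eta k r) => [e f|x y IHx IHy]; last by rewrite !addE IHx IHy.
by rewrite assocE !assocVE !tmapE !mull_mapE lact_pure.
Qed.

Lemma comatrix_counitr c :
  mulr_map _ ((idb _ ⊠ ctx_eps k) (comatrix_comul c)) = c.
Proof.
elim/tens_ind: c => [phi u|x y IHx IHy]; last by rewrite !bfunD IHx IHy.
rewrite tens_coact_counit; congr pure.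
elim/firm_left_ind: u => [r u|u v IHu IHv]; last by rewrite !addE IHu IHv.
by rewrite comatrix_coactE (ctx_triangle k).
Qed.

Definition comatrix_coring : coring A :=
  @Coring A (S' ⊗ S)
    (tens_unitl (firm_unital_left (ctx_firm_left' k)))
    (tens_unitr (firm_unital_right (ctx_firm_right k)))
    comatrix_comul (ctx_eps k) comatrix_assoc comatrix_counitl comatrix_counitr.
End Comatrix.

Section Setting.
Variables (A : pzRingType) (C : coring A) (R : rng).

Section Dagger.
Variables (Sigma : comod R C) (k : comatrix_context Sigma (dagger Sigma)).

(* u |-> phi(u_[0]) u_[1] *)
Program Definition contract (phi : dual Sigma) :
  bihom (forget_left Sigma) (forget_left C) :=
  @BiHom _ _ (forget_left Sigma) (forget_left C)
    (fun u => mull_map C ((phi ⊠ idb C) (coact Sigma u))) _ _ _.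
Next Obligation.
move=> u v; rewrite (bfunD (coact Sigma)) (bfunD (phi ⊠ idb C)).
exact: (bfunD (mull_map C)).
Qed.
Next Obligation.
rewrite !lact_rng0 (bfun0 (coact Sigma)) (bfun0 (phi ⊠ idb C)).
exact: (bfun0 (mull_map C)).
Qed.
Next Obligation.
rewrite (bfunR (coact Sigma)) (bfunR (phi ⊠ idb C)).
exact: (bfunR (mull_map C)).
Qed.

Lemma contractD phi psi : contract (phi + psi) = contract phi + contract psi.
Proof.
apply: bihomP => u; rewrite addbE -[LHS]/(mull_map C (((phi + psi) ⊠ idb C) _)).
by rewrite tmap_addl; apply: (bfunD (mull_map C)).
Qed.

Lemma contractR phi (s : R) (u : Sigma) : contract (phi <* s) u = contract phi (s *> u).
Proof.
rewrite -[RHS]/(mull_map C ((phi ⊠ idb C) (coact Sigma (s *> u)))) bfunL.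
congr (mull_map C _); elim/tens_ind: (coact Sigma u) => [v c|x y IHx IHy].
  by rewrite lact_pure [LHS]tmapE [RHS]tmapE.
by rewrite lactDr [LHS]bfunD [RHS]bfunD IHx IHy.
Qed.

Lemma contractL phi (a : rng_of A) (u : Sigma) :
  contract (a *> phi) u = a *> (contract phi u : C).
Proof.
rewrite -[contract phi u]/(mull_map C ((phi ⊠ idb C) (coact Sigma u))) -bfunL.
congr (mull_map C _); elim/tens_ind: (coact Sigma u) => [v c|x y IHx IHy].
  rewrite [LHS]tmapE [X in _ = a *> X]tmapE.
  by rewrite -[RHS]/(a *> (pure (M := regular A) (phi v) c)) lact_pure.
by rewrite [LHS]bfunD [X in _ = a *> X]bfunD IHx IHy [RHS]lactDr.
Qed.

(* The left [C]-coaction phi ⊗ r |-> phi(e_s[0]) e_s[1] ⊗ (f_s r^s) of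
   [Sigma^* ⊗ R]; by right linearity of sigma, e_s ⊗ (f_s r^s) = sigma(r). *)
Program Definition dagger_coact : bihom (dagger Sigma) (C ⊗ dagger Sigma) :=
  lift (M := dual Sigma) (N := regular R) (V := C ⊗ dagger Sigma)
    (fun phi r => (contract phi ⊠ idb (dagger Sigma)) (ctx_eta k r)) _ _ _ _ _.
Next Obligation. by rewrite contractD tmap_addl. Qed.
Next Obligation.
by rewrite (bfunD (ctx_eta k)) (bfunD (contract m ⊠ _)).
Qed.
Next Obligation.
rewrite bfunL; elim/tens_ind: (ctx_eta k n) => [e f|x y IHx IHy].
  by rewrite lact_pure [LHS]tmapE [RHS]tmapE contractR.
by rewrite lactDr [LHS]bfunD [RHS]bfunD IHx IHy.
Qed.
Next Obligation.
elim/tens_ind: (ctx_eta k n) => [e f|x y IHx IHy].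
  rewrite [LHS]tmapE contractL [X in _ = r *> X]tmapE.
  by rewrite -[RHS]/(r *> (pure (contract m e : C) f)) lact_pure.
by rewrite [LHS]bfunD [X in _ = r *> X]bfunD IHx IHy [RHS]lactDr.
Qed.
Next Obligation. by rewrite bfunR; apply: (bfunR (contract m ⊠ _)). Qed.
End Dagger.

(* [C] is isomorphic to the comatrix coring of the context [k], in such a way that
   the coaction of [Sigma] corresponds to u |-> e_r ⊗ (f_r ⊗ u^r).  An isomorphism
   of corings unrelated to the coaction would not relate [- ⊗_R Sigma] to [C]: for
   A a field, R = A * A, Sigma = R and C = A g + A h with g and h grouplike, let both
   factors of Sigma be coacted on through g. *)
Definition is_comatrix_coring (Sigma : comod R C)
    (k : comatrix_context Sigma (dagger Sigma)) : Prop :=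
  exists theta : bihom (comatrix_coring k) C,
    isomorphic_by theta /\
    forall u, coact Sigma u = (idb Sigma ⊠ theta) (comatrix_coact k u).

Section LocalUnits.
Hypothesis (hR : has_local_units R).

Lemma regular_firm : firm_right (forget_left (regular R)).
Proof. exact/(sunital_firm hR)/(sunital_regular hR). Qed.

Definition regular_module : firm_cat R := FirmModule regular_firm.

Program Definition left_mul (r : R) : hom regular_module regular_module :=
  @BiHom _ _ (forget_left (regular R)) (forget_left (regular R)) (rmul r) _ _ _.
Next Obligation. by move=> x y; rewrite rmulDr. Qed.
Next Obligation. by rewrite !lact_rng0; apply: (lact0 (regular R)). Qed.
Next Obligation. exact: rmulA. Qed.

Definition image_action (F : functor (firm_cat R) (comod_cat C)) (r : R) :
  colin (F regular_module) (F regular_module) := fmap F (left_mul r).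
End LocalUnits.
End Setting.

(* Main.v *)
(* Let F be an equivalence and Sigma = F(R).  Each firm M is generated by its orbit
   maps r |-> m r from R, which gives F = - ⊗_R Sigma as in the Eilenberg-Watts
   theorem.  For a right A-module X the map
     can_X : Hom_A(Sigma, X) ⊗_R Sigma -> X ⊗_A C,   f ⊗ u |-> f(u_[0]) ⊗ u_[1],
   is a universal arrow from - ⊗_R Sigma to the cofree comodule X ⊗_A C, hence it is
   bijective.  For X = A this identifies C with Sigma^* ⊗_R Sigma.  Comparing X = A
   with X = Sigma, and using that - ⊗_R Sigma reflects isomorphisms, one gets
   Sigma ⊗_A Sigma^* ⊗_R R = End_A(Sigma) ⊗_R R; the element of the left side
   corresponding to the action of r is sigma(r), and sigma(e) for a local unit e is a
   finite dual basis, whence local projectivity.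
   For any comatrix context, y r = y(e_r) ⊗ f_r for y in N ⊗_A Sigma^†, where
   y acts on Sigma through eps.  So N ⊗_A Sigma^† embeds into Hom_A(Sigma, N),
   N ⊗^C Sigma^† = Hom^C(Sigma, N) ⊗_R R, and Sigma^† is a flat left A-module.
   If C is flat, kernels in M^C are computed in A-modules, so the equivalence
   - ⊗_R Sigma is exact.  Conversely, if Sigma is faithfully flat, tensoring the exact
   sequence 0 -> Hom^C(Sigma, N) ⊗_R R -> N ⊗_A Sigma^† -> N ⊗_A C ⊗_A Sigma^† with
   Sigma gives 0 -> N -> N ⊗_A C -> N ⊗_A C ⊗_A C, so the counit of the adjunction is
   bijective, and then so is the unit. *)
From HB Require Import structures.
From mathcomp Require Import all_boot all_algebra boolp.
Require Import Defs.
Set Implicit Arguments.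
Unset Strict Implicit.
Unset Printing Implicit Defensive.
Import GRing.Theory.
Local Open Scope ring_scope.
Local Open Scope quotient_scope.
Local Obligation Tactic := intros; cbv beta.

(** * Equivalences and universal arrows *)

Definition faithful (C D : category) (F : functor C D) : Prop :=
  forall (x y : C) (f g : hom x y), fmap F f = fmap F g -> f = g.
Definition full (C D : category) (F : functor C D) : Prop :=
  forall (x y : C) (g : hom (F x) (F y)), exists f : hom x y, fmap F f = g.
Definition essentially_surjective (C D : category) (F : functor C D) : Prop :=
  forall d : D, exists x : C, exists f : hom (F x) d, is_iso f.

Lemma is_iso_id (C : category) (x : C) : is_iso (idm x).
Proof. by exists (idm x); rewrite comp1m. Qed.

Lemma is_iso_comp (C : category) (x y z : C) (f : hom y z) (g : hom x y) :
  is_iso f -> is_iso g -> is_iso (comp f g).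
Proof.
move=> [f' [f'f ff']] [g' [g'g gg']]; exists (comp g' f'); split.
  by rewrite -compA [comp f' _]compA f'f comp1m.
by rewrite -compA [comp g _]compA gg' comp1m.
Qed.

Lemma is_iso_fmap (C D : category) (F : functor C D) (x y : C) (f : hom x y) :
  is_iso f -> is_iso (fmap F f).
Proof. by move=> [g [gf fg]]; exists (fmap F g); rewrite -!fmapM gf fg !fmap1. Qed.

Section NaturalIsomorphisms.
Variables (C D E : category).

Lemma nat_iso_sym (F G : functor C D) : nat_isomorphic F G -> nat_isomorphic G F.
Proof.
move=> [eta [etaN etaI]]; exists (fun x => sval (cid (etaI x))); split=> [x y f|x].
  case: (cid (etaI x)) (cid (etaI y)) => [ix [ixl ixr]] [iy [iyl iyr]] /=.
  by rewrite -[LHS]compm1 -ixr compA -[X in comp X _]compA -etaN !compA iyl comp1m.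
by case: cid => ix [ixl ixr] /=; exists (eta x).
Qed.

Lemma nat_iso_trans (F G H : functor C D) :
  nat_isomorphic F G -> nat_isomorphic G H -> nat_isomorphic F H.
Proof.
move=> [a [aN aI]] [b [bN bI]]; exists (fun x => comp (b x) (a x)).
split=> [x y f|x]; last exact: is_iso_comp.
by rewrite -compA aN compA bN compA.
Qed.

Lemma nat_iso_whisker_l (F F' : functor C D) (G : functor D E) :
  nat_isomorphic F F' -> nat_isomorphic (fcomp G F) (fcomp G F').
Proof.
move=> [a [aN aI]]; exists (fun x => fmap G (a x)); split=> [x y f|x].
  by rewrite /= -!fmapM aN.
exact: (is_iso_fmap G (aI x)).
Qed.

Lemma nat_iso_whisker_r (F : functor C D) (G G' : functor D E) :
  nat_isomorphic G G' -> nat_isomorphic (fcomp G F) (fcomp G' F).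
Proof.
move=> [a [aN aI]]; exists (fun x => a (F x)); split=> [x y f|x].
  exact: aN.
exact: aI.
Qed.

Lemma nat_iso_assoc (B : category) (F : functor B C) (G : functor C D) (H : functor D E) :
  nat_isomorphic (fcomp H (fcomp G F)) (fcomp (fcomp H G) F).
Proof.
exists (fun x => idm (H (G (F x)))); split=> [x y f|x].
  by rewrite comp1m compm1.
exact: is_iso_id.
Qed.

Lemma nat_iso_1comp (F : functor C D) : nat_isomorphic (fcomp (fid D) F) F.
Proof.
exists (fun x => idm (F x)); split=> [x y f|x]; first by rewrite comp1m compm1.
exact: is_iso_id.
Qed.

Lemma nat_iso_comp1 (F : functor C D) : nat_isomorphic (fcomp F (fid C)) F.
Proof.
exists (fun x => idm (F x)); split=> [x y f|x]; first by rewrite comp1m compm1.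
exact: is_iso_id.
Qed.
End NaturalIsomorphisms.

Lemma nat_iso_faithful (C : category) (F : functor C C) : nat_isomorphic (fid C) F -> faithful F.
Proof.
move=> [a [aN aI]] x y f g efg; have [b [ba ab]] := aI y.
by rewrite -[f]comp1m -[g]comp1m -ba -!compA [comp _ f]aN [comp _ g]aN efg.
Qed.

Lemma inverse_equivalences_faithful (C D : category) (F : functor C D) (G : functor D C) :
  inverse_equivalences F G -> faithful F.
Proof.
by move=> [/nat_iso_faithful GF_f _] x y f g efg; apply: GF_f; rewrite /= efg.
Qed.

Lemma inverse_equivalences_sym (C D : category) (F : functor C D) (G : functor D C) :
  inverse_equivalences F G -> inverse_equivalences G F.
Proof. by move=> [a b]; split; apply: nat_iso_sym. Qed.

Lemma inverse_equivalences_congr (C D : category) (F F' : functor C D) (G : functor D C) :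
  nat_isomorphic F F' -> inverse_equivalences F G -> inverse_equivalences F' G.
Proof.
move=> FF' [a b]; split; first exact/(nat_iso_trans a)/nat_iso_whisker_l.
by apply: nat_iso_trans b; apply/nat_iso_whisker_r/nat_iso_sym.
Qed.

Lemma inverse_equivalences_dense (C D : category) (F : functor C D) (G : functor D C) :
  inverse_equivalences F G -> essentially_surjective F.
Proof. by move=> [_ [b [_ bI]]] d; exists (G d), (b d); apply: bI. Qed.
(** The preimage of [g] is [G g] transported along the unit [a]. Since [G] is faithful, it is enough
    to compare images under [G], where naturality of [a] applies. *)
Lemma inverse_equivalences_full (C D : category) (F : functor C D) (G : functor D C) :
  inverse_equivalences F G -> full F.
Proof.
move=> FG x y g; have [[a [aN aI]] _] := FG; have [b [ba ab]] := aI y.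
exists (comp b (comp (fmap G g) (a x))).
apply: (inverse_equivalences_faithful (inverse_equivalences_sym FG)).
have [c [ca ac]] := aI x.
rewrite -[LHS]compm1 -[RHS]compm1 -ac /= [LHS]compA [RHS]compA; congr (comp _ c).
by rewrite -[LHS](aN _ _ (comp b _)) /= !compA ab comp1m.
Qed.

(** [G ≅ G F H ≅ H]: a right inverse of an equivalence is isomorphic to its inverse. *)
Lemma inverse_unique (C D : category) (F : functor C D) (G H : functor D C) :
  inverse_equivalences F G -> nat_isomorphic (fcomp F H) (fid D) -> nat_isomorphic G H.
Proof.
move=> [GF _] FH; apply: nat_iso_trans (nat_iso_sym (nat_iso_comp1 G)) _.
apply: nat_iso_trans (nat_iso_whisker_l G (nat_iso_sym FH)) _.
apply: nat_iso_trans (nat_iso_assoc _ _ _) _.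
apply: nat_iso_trans (nat_iso_1comp H); apply: nat_iso_whisker_r.
exact: nat_iso_sym.
Qed.

Section UniversalArrows.
Variables (C D : category) (F : functor C D).

(** The value at [d] of a right adjoint of [F], given pointwise so that no adjoint functor has to be
    built first. *)
Definition universal_arrow (d : D) (p : C) (e : hom (F p) d) : Prop :=
  (forall (m : C) (t : hom (F m) d), exists k : hom m p, comp e (fmap F k) = t) /\
  (forall (m : C) (k k' : hom m p),
     comp e (fmap F k) = comp e (fmap F k') -> k = k').

Lemma full_faithful_conservative :
  full F -> faithful F -> forall (x y : C) (f : hom x y), is_iso (fmap F f) -> is_iso f.
Proof.
move=> F1 F2 x y f [g [gf fg]]; have [h hg] := F1 _ _ g.
by exists h; split; apply: F2; rewrite fmapM hg ?gf ?fg fmap1.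
Qed.

(** Compare [e] with an isomorphism [t : F m -> d] whose inverse is [t']. Here [t = e F(k)], and
    [t' e = F(l)] by fullness. Uniqueness gives [k l = 1], so [F(k) t'] is inverse to [e]. *)
Lemma universal_arrow_iso (d : D) (p : C) (e : hom (F p) d) :
  full F -> faithful F -> essentially_surjective F -> universal_arrow e -> is_iso e.
Proof.
move=> F1 F2 F3 [eE eI]; have [m [t [t' [t't tt']]]] := F3 d.
have [k ek] := eE m t; have [l el] := F1 _ _ (comp t' e).
have kl : comp k l = idm p.
  by apply: eI; rewrite fmapM compA ek el compA tt' fmap1 comp1m compm1.
exists (comp (fmap F k) t'); split; last by rewrite compA ek.
by rewrite -compA -el -fmapM kl fmap1.
Qed.

(** The unit [u] at [x] is defined by [e F(u) = 1]. As [e] is invertible, [F(u)] is its inverse, and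
    [F] reflects isomorphisms. *)
Lemma adjoint_inverse_equivalences (G : functor D C) (e : forall d, hom (F (G d)) d) :
  (forall d, universal_arrow (e d)) ->
  (forall d d' (f : hom d d'), comp (e d') (fmap F (fmap G f)) = comp f (e d)) ->
  (forall d, is_iso (e d)) ->
  (forall x y (f : hom x y), is_iso (fmap F f) -> is_iso f) ->
  inverse_equivalences F G.
Proof.
move=> eU eN eI FR; split; last first.
  by exists e; split=> [d d' f|//]; apply: eN.
have uE x : exists u : hom x (G (F x)), comp (e (F x)) (fmap F u) = idm (F x).
  exact: (eU (F x)).1.
exists (fun x => sval (cid (uE x))); split=> [x y f|x].
  case: (cid (uE x)) (cid (uE y)) => ux uxP [uy uyP] /=.
  apply: (eU (F y)).2; rewrite !fmapM !compA uyP eN -compA uxP.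
  by rewrite comp1m compm1.
case: cid => u /= uP; apply: FR; have [i [ie ei]] := eI (F x).
suff -> : fmap F u = i by exists (e (F x)).
by rewrite -[LHS]comp1m -ie -compA uP compm1.
Qed.
End UniversalArrows.

(** * Tensor products over rings with local units *)

Lemma inj_surj_bij (T U : Type) (f : T -> U) :
  injective f -> (forall y, exists x, f x = y) -> bijective f.
Proof.
move=> fI fS; exists (fun y => sval (cid (fS y))) => [x|y]; last by case: cid.
by apply: fI; case: cid.
Qed.

Lemma bij_surj (T U : Type) (f : T -> U) : bijective f -> forall y, exists x, f x = y.
Proof. by case=> g _ fg y; exists (g y). Qed.

Lemma bij_factor (T U V : Type) (f : U -> V) (g : T -> U) (h : T -> V) :
  bijective f -> bijective h -> (forall x, f (g x) = h x) -> bijective g.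
Proof.
move=> [f' fK f'K] [h' hK h'K] e; exists (h' \o f) => [x|y]; rewrite /= ?e //.
by apply: (can_inj fK); rewrite e h'K.
Qed.

Lemma bfunN (R S : rng) (M N : bimod R S) (f : bihom M N) : {morph f : x / - x}.
Proof. exact: morphDN (bfunD f). Qed.

Lemma bfunB (R S : rng) (M N : bimod R S) (f : bihom M N) : {morph f : x y / x - y}.
Proof. by move=> x y; rewrite bfunD bfunN. Qed.

Lemma bihom_inj (R S : rng) (M N : bimod R S) (f : bihom M N) :
  (forall x, f x = 0 -> x = 0) -> injective f.
Proof.
by move=> f0 x y exy; apply/eqP; rewrite -subr_eq0; apply/eqP/f0; rewrite bfunB exy subrr.
Qed.

Lemma pure0l (R S T : rng) (M : bimod R S) (N : bimod S T) (n : N) :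
  pure (0 : M) n = 0.
Proof. by apply: (morphD0 (f := pure^~ n)) => x y; rewrite pureDl. Qed.

Lemma pure0r (R S T : rng) (M : bimod R S) (N : bimod S T) (m : M) :
  pure m (0 : N) = 0.
Proof. by apply: (morphD0 (f := pure m)) => x y; rewrite pureDr. Qed.

(** The target is a mere abelian group, so that maps with different module structures can be
    compared. *)
Lemma tens_hom_eq (R S T : rng) (M : bimod R S) (N : bimod S T) (V : zmodType)
  (f g : M ⊗ N -> V) :
  {morph f : x y / x + y} -> {morph g : x y / x + y} ->
  (forall m n, f (pure m n) = g (pure m n)) -> f =1 g.
Proof. by move=> fD gD fg; elim/tens_ind => // x y IHx IHy; rewrite fD gD IHx IHy. Qed.

Lemma assocK (Q R S T : rng) (M : bimod Q R) (N : bimod R S) (P : bimod S T) :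
  cancel (@assoc Q R S T M N P) assocV.
Proof.
elim/tens_ind => [x p|x y IHx IHy]; last by rewrite !bfunD IHx IHy.
elim/tens_ind: x => [m n|x y IHx IHy]; last by rewrite !addE IHx IHy.
by rewrite assocE assocVE.
Qed.

Lemma assocVK (Q R S T : rng) (M : bimod Q R) (N : bimod R S) (P : bimod S T) :
  cancel (@assocV Q R S T M N P) assoc.
Proof.
elim/tens_ind => [m y|x y IHx IHy]; last by rewrite !bfunD IHx IHy.
elim/tens_ind: y => [n p|x y IHx IHy]; last by rewrite !addE IHx IHy.
by rewrite assocVE assocE.
Qed.

Lemma assoc_bij (Q R S T : rng) (M : bimod Q R) (N : bimod R S) (P : bimod S T) :
  bijective (@assoc Q R S T M N P).
Proof. exists assocV; [exact: assocK | exact: assocVK]. Qed.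

Lemma tmap_bij (R S T : rng) (M M' : bimod R S) (N N' : bimod S T)
  (f : bihom M M') (g : bihom N N') :
  bijective f -> bijective g -> bijective (f ⊠ g).
Proof.
move=> fB gB; exists (binv fB ⊠ binv gB); apply: tens_ind => [m n|x y IHx IHy];
  by rewrite ?bfunD ?IHx ?IHy // !tmapE ?bfunK ?binvK.
Qed.

Lemma unital_local_units (A : pzRingType) : has_local_units A.
Proof. by move=> X; exists (rone A) => x _; rewrite /= mul1r mulr1. Qed.

Lemma unital_firm_right (R : rng) (A : pzRingType) (M : bimod R A) :
  unital_right M -> firm_right M.
Proof.
by move=> hM; apply: sunital_firm (@unital_local_units A) _ => X; exists (rone A).
Qed.

Lemma unital_firm_left (A : pzRingType) (R : rng) (M : bimod A R) :
  unital_left M -> firm_left M.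
Proof.
move=> hM; apply: inj_surj_bij => [|m]; last by exists (pure (rone A : regular A) m);
  rewrite mull_mapE.
suff e x : x = pure (rone A : regular A) (mull_map M x) by move=> x y xy; rewrite [x]e [y]e xy.
elim/tens_ind: x => [a m|x y IHx IHy]; last by rewrite !addE -IHx -IHy.
by rewrite mull_mapE -pure_bal; congr pure; rewrite /= mul1r.
Qed.

Lemma unital_firm_ring (A : pzRingType) : firm_ring A.
Proof.
split; first by apply: unital_firm_right => a; apply: mulr1.
by apply: unital_firm_left => a; apply: mul1r.
Qed.

Section LocalUnits.
Variables (R : rng) (hR : has_local_units R).

(** With [e] a common right unit of the [r_i], each [m_i ⊗ r_i] equals [m_i r_i ⊗ e], and the sum
    collapses. *)
Lemma tens_regular_pure (Q : rng) (M : bimod Q R) (x : M ⊗ regular R) :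
  exists e : R, x = pure (mulr_map M x) (e : regular R).
Proof.
have [e ex] := sunital_tens (sunital_regular hR) [:: x]; exists e.
rewrite -[LHS](ex x) ?inE //.
elim/tens_ind: {ex} x => [m r|x y IHx IHy]; last by rewrite !addE IHx IHy.
by rewrite mulr_mapE pure_bal ract_pure.
Qed.

(** Thus [M ⊗ R] is the submodule [M R] even for [M] not firm, and equalities in it can be tested in
    [M]. *)
Lemma mulr_map_inj (Q : rng) (M : bimod Q R) : injective (mulr_map M).
Proof.
by apply: bihom_inj => x x0; have [e ->] := tens_regular_pure x; rewrite x0 pure0l.
Qed.

Lemma regular_firm_ring : firm_ring R.
Proof. by split; apply: (sunital_firm hR) (sunital_regular hR). Qed.

Lemma firm_right_unit (Q : rng) (M : bimod Q R) (m : M) :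
  firm_right M -> exists e : R, m <* e = m.
Proof.
by move=> /(firm_sunital hR) /(_ [:: m]) [e eP]; exists e; apply: eP; rewrite inE.
Qed.

Lemma firm_left_unit (Q : rng) (M : bimod R Q) (X : seq M) :
  firm_left M -> exists e : R, forall m, m \in X -> e *> m = m.
Proof.
move=> hM; have [c cE] := choice (fun m => @tens_sum _ _ _ _ _ (binv hM m)).
have [e eP] := hR (flatten [seq [seq (q.1 : R) | q <- c m] | m <- X]).
exists e => m mX; rewrite -{2}(binvK hM m) -{1}(binvK hM m) cE.
have : {subset [seq (q.1 : R) | q <- c m] <=
    flatten [seq [seq (q.1 : R) | q <- c m] | m <- X]}.
  by move=> n nx; apply/flattenP; exists [seq (q.1 : R) | q <- c m] => //; apply: map_f.
elim: (c m) => [|[r n] t IHt] sub; first by rewrite big_nil bfun0 lact0.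
rewrite big_cons bfunD lactDr IHt => [|y yt]; last by apply: sub; rewrite /= inE yt orbT.
congr (_ + _); rewrite mull_mapE -lactM (eP r _).1 //.
by apply: sub; rewrite inE eqxx.
Qed.

(** If [g] kills [y = m ⊗ e], then [m e = f x] for some [x], and [y = m e ⊗ e' = f x ⊗ e'] whenever
    [e e' = e]. *)
Lemma regular_flat : flat_left (regular R).
Proof.
move=> M1 M2 M3 f g _ _ _ fg y; split=> [|[x <-]]; last first.
  have gf m : g (f m) = 0 by apply/fg; exists m.
  elim/tens_ind: x => [m r|x z IHx IHz]; last by rewrite !bfunD IHx IHz addr0.
  by rewrite !tmapE gf pure0l.
have [e ->] := tens_regular_pure y; move: (mulr_map M2 y) => m {y}; rewrite tmapE => gm0.
have [x xP] : exists x, f x = m <* e.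
  by apply/fg; rewrite bfunR -(mulr_mapE (g m) (e : regular R)) gm0 bfun0.
have [e' e'P] := hR [:: e]; exists (pure x (e' : regular R)).
rewrite tmapE xP pure_bal; congr pure; apply: (e'P e _).2.
by rewrite inE.
Qed.
End LocalUnits.

(** * Additivity of full and faithful functors *)

Section DirectSum.
Variables (R S : rng) (M N : bimod R S).

Program Definition dsum : bimod R S :=
  @Bimod R S (GRing.Zmodule.clone (M * N)%type _)
    (fun r x => (r *> x.1, r *> x.2)) (fun x s => (x.1 <* s, x.2 <* s)) _ _ _ _ _ _ _.
Next Obligation. by rewrite !lactDl. Qed.
Next Obligation. by rewrite !lactDr. Qed.
Next Obligation. by rewrite !lactM. Qed.
Next Obligation. by rewrite !ractDl. Qed.
Next Obligation. by rewrite !ractDr. Qed.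
Next Obligation. by rewrite !ractM. Qed.
Next Obligation. by rewrite !lractA. Qed.

Program Definition proj1b : bihom dsum M := @BiHom _ _ dsum M (fun x => x.1) _ _ _.
Next Obligation. by []. Qed.
Next Obligation. by []. Qed.
Next Obligation. by []. Qed.
Program Definition proj2b : bihom dsum N := @BiHom _ _ dsum N (fun x => x.2) _ _ _.
Next Obligation. by []. Qed.
Next Obligation. by []. Qed.
Next Obligation. by []. Qed.

Program Definition pairb (P : bimod R S) (f : bihom P M) (g : bihom P N) : bihom P dsum :=
  @BiHom _ _ P dsum (fun x => (f x, g x)) _ _ _.
Next Obligation. by move=> x y; rewrite !bfunD. Qed.
Next Obligation. by rewrite !bfunL. Qed.
Next Obligation. by rewrite !bfunR. Qed.

Lemma dsum_sunital : has_local_units S -> firm_right M -> firm_right N -> sunital dsum.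
Proof.
move=> hS fM fN X.
have [e eX] := firm_sunital hS fM (map fst X).
have [e' eX'] := firm_sunital hS fN (map snd X).
have [u uP] := hS [:: e; e'].
exists u => -[m n] mnX; rewrite /= -[m in LHS]eX; last exact: (map_f fst mnX).
rewrite -[n in LHS]eX'; last exact: (map_f snd mnX).
rewrite -!ractM !(uP _ _).2 ?inE ?eqxx ?orbT //.
by rewrite eX ?eX' // ?(map_f fst mnX) // (map_f snd mnX).
Qed.
End DirectSum.

Section ColinearSums.
Variables (A : pzRingType) (R : rng) (C : coring A) (M N : comod R C).

Program Definition colin_zero : colin M N := Colin (colin_fun := 0 : bihom M N) _.
Next Obligation. by move=> m; rewrite tmap_0l; apply: bfun0. Qed.

Program Definition colin_add (f g : colin M N) : colin M N :=
  Colin (colin_fun := (f : bihom M N) + g) _.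
Next Obligation. by move=> m; rewrite tmap_addl addbE bfunD !colinP. Qed.
End ColinearSums.

Lemma firm_cat_iso (R : rng) (M N : firm_cat R) (f : hom M N) :
  is_iso f <-> bijective (f : bihom _ _).
Proof.
split=> [[g [gf fg]]|fB].
  exists (g : bihom _ _) => x.
    exact: (congr1 (fun h : hom M M => (h : bihom _ _) x) gf).
  exact: (congr1 (fun h : hom N N => (h : bihom _ _) x) fg).
by exists (binv fB); split; apply: bihomP => x; rewrite /= compbE ?bfunK ?binvK.
Qed.

Lemma comod_cat_iso (A : pzRingType) (C : coring A) (M N : comod_cat C) (f : hom M N) :
  is_iso f <-> bijective (f : colin _ _).
Proof.
split=> [[g [gf fg]]|fB].
  exists (g : colin _ _) => x.
    exact: (congr1 (fun h : hom M M => (h : colin _ _) x) gf).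
  exact: (congr1 (fun h : hom N N => (h : colin _ _) x) fg).
have gP : is_colinear (M := N) (N := M) (binv fB).
  move=> x; rewrite -{2}(binvK fB x) (colinP (f : colin M N)) tmap_comp.
  have -> : compb (binv fB) (f : colin M N) = idb M.
    by apply: bihomP => y; rewrite compbE bfunK.
  by rewrite compb1 tmap1.
exists (Colin gP); split; apply: colin_eq => x /=.
  exact: bfunK.
exact: binvK.
Qed.

Section Additivity.
Variables (A : pzRingType) (C : coring A) (R : rng) (hR : has_local_units R).
Variable F : functor (firm_cat R) (comod_cat C).
Hypotheses (Ffull : full F) (Ffaithful : faithful F).

Lemma fmap_comp (M N P : firm_cat R) (f : bihom N P) (g : bihom M N) (x : F M) :
  (fmap F (compb f g : hom M P) : colin _ _) x =
  (fmap F (f : hom N P) : colin _ _) ((fmap F (g : hom M N) : colin _ _) x).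
Proof. by rewrite -[compb f g]/(comp (c := firm_cat R) f g) fmapM. Qed.

(** A preimage [k] of the zero map satisfies [k 0 = k], because both sides become zero under [F];
    hence [k = 0]. *)
Lemma full_faithful_0 (M N : firm_cat R) (x : F M) :
  (fmap F (0 : hom M N) : colin _ _) x = 0.
Proof.
have [k kP] := Ffull (colin_zero _ _ : hom (F M) (F N)).
have -> : 0 = k.
  have kk : comp k (0 : hom M M) = comp k (idm M).
    by apply: Ffaithful; rewrite !fmapM kP; apply: colin_eq.
  by rewrite -[k]compm1 -kk; apply: bihomP => m; apply/esym/(bfun0 (k : bihom _ _)).
by rewrite kP.
Qed.

(** The preimage [k] of [F p1 + F p2] is the codiagonal of [N ⊕ N], since [k i1 = k i2 = 1] by
    faithfulness. Then [f + g] is [k] after the pair [h] of [f] and [g]. *)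
Lemma full_faithful_add (M N : firm_cat R) (f g : hom M N) (x : F M) :
  (fmap F (f + g : bihom _ _) : colin _ _) x =
  (fmap F f : colin _ _) x + (fmap F g : colin _ _) x.
Proof.
have NN : firm_right (dsum N N).
  exact/(sunital_firm hR)/dsum_sunital/fm_firm/fm_firm.
pose D : firm_cat R := FirmModule NN.
pose p1 : hom D N := proj1b N N; pose p2 : hom D N := proj2b N N.
pose i1 : hom N D := pairb (idb N) 0; pose i2 : hom N D := pairb 0 (idb N).
have [k kP] := Ffull (colin_add (fmap F p1 : colin _ _) (fmap F p2 : colin _ _) : hom (F D) (F N)).
have kE y : (fmap F k : colin _ _) y = (fmap F p1 : colin _ _) y + (fmap F p2 : colin _ _) y.
  by rewrite kP.
have pi (p : hom D N) (i : hom N D) y :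
    (fmap F p : colin _ _) ((fmap F i : colin _ _) y) = (fmap F (comp p i) : colin _ _) y.
  by rewrite fmapM.
have k1 : comp k i1 = idm N.
  apply/Ffaithful/colin_eq => y; rewrite -pi kE !pi.
  have -> : comp p2 i1 = 0 by apply: bihomP.
  have -> : comp p1 i1 = idm N by apply: bihomP.
  by rewrite full_faithful_0 addr0.
have k2 : comp k i2 = idm N.
  apply/Ffaithful/colin_eq => y; rewrite -pi kE !pi.
  have -> : comp p1 i2 = 0 by apply: bihomP.
  have -> : comp p2 i2 = idm N by apply: bihomP.
  by rewrite full_faithful_0 add0r.
pose h : hom M D := pairb f g.
have -> : f + g = comp k h.
  apply: bihomP => m.
  have e1 := congr1 (fun u : hom N N => (u : bihom _ _) ((f : bihom _ _) m)) k1.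
  have e2 := congr1 (fun u : hom N N => (u : bihom _ _) ((g : bihom _ _) m)) k2.
  rewrite addbE -[(f : bihom _ _) m]e1 -[(g : bihom _ _) m]e2.
  rewrite -[LHS](bfunD (k : bihom _ _)); congr (bfun (k : bihom _ _) _).
  by congr pair; rewrite /= ?addr0 ?add0r.
rewrite fmapM -[LHS]/((fmap F k : colin _ _) ((fmap F h : colin _ _) x)) kE.
rewrite -2![(fmap F _ : colin _ _) ((fmap F h : colin _ _) x)]fmap_comp.
by congr ((fmap F _ : colin _ _) x + (fmap F _ : colin _ _) x); apply: bihomP.
Qed.
End Additivity.

(** * The Eilenberg-Watts theorem *)

Section EilenbergWatts.
Variables (A : pzRingType) (C : coring A) (R : rng) (hR : has_local_units R).
Variable F : functor (firm_cat R) (comod_cat C).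
Hypotheses (Ffull : full F) (Ffaithful : faithful F) (Fdense : essentially_surjective F).

Local Notation RR := (regular_module hR).

Lemma image_action_is_left_action : is_left_action (image_action hR F).
Proof.
split=> r r' m.
  rewrite -(full_faithful_add hR Ffull Ffaithful); congr ((fmap F _ : colin _ _) m).
  by apply: bihomP => x; apply: rmulDl.
rewrite -[RHS]fmap_comp; congr ((fmap F _ : colin _ _) m).
by apply: bihomP => x; apply/esym/rmulA.
Qed.

Variable hF : is_left_action (image_action hR F).
Let Sigma : comod R C := comod_add hF.

Program Definition orbit_map (M : firm_module R) (m : M) : bihom (forget_left (regular R)) M :=
  @BiHom _ _ (forget_left (regular R)) M (fun r : R => m <* r) _ _ _.
Next Obligation. by move=> r r'; rewrite ractDr. Qed.
Next Obligation. by rewrite !lact_rng0; apply: rract0. Qed.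
Next Obligation. by rewrite -ractM. Qed.

Definition watts_fun (M : firm_module R) (m : M) (u : Sigma) : F M :=
  (fmap F (orbit_map m : hom RR (M : firm_cat R)) : colin _ _) u.

Program Definition watts (M : firm_module R) : bihom (M ⊗ Sigma) (F M) :=
  lift (@watts_fun M) _ _ _ _ _.
Next Obligation.
rewrite /watts_fun -(full_faithful_add hR Ffull Ffaithful).
by congr ((fmap F _ : colin _ _) _); apply: bihomP => r; apply: ractDl.
Qed.
Next Obligation. exact: bfunD. Qed.
Next Obligation.
rewrite /watts_fun -[_ *> n]/((fmap F (left_mul hR s) : colin _ _) n) -fmap_comp.
by congr ((fmap F _ : colin _ _) _); apply: bihomP => r; apply/esym/ractM.
Qed.
Next Obligation.
rewrite !lact_rng0 /watts_fun.
have -> : orbit_map (0 : M) = 0 by apply: bihomP => s; apply: ract0.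
exact: full_faithful_0.
Qed.
Next Obligation. exact: (bfunR (fmap F (orbit_map m : hom RR (M : firm_cat R)) : colin _ _)). Qed.

Lemma watts_colinear (M : firm_module R) :
  is_colinear (M := tens_comod Sigma M) (N := F M) (watts M).
Proof.
move=> x; elim/tens_ind: x => [m u|x y IHx IHy]; last by rewrite !bfunD IHx IHy.
rewrite liftE [coact (tens_comod _ _) _]tens_coactE.
have -> := colinP (fmap F (orbit_map m : hom RR (M : firm_cat R)) : colin _ _) u.
rewrite -[coact (F RR) u]/(coact Sigma u).
elim/tens_ind: (coact Sigma u) => [v c|x y IHx IHy]; last by rewrite [LHS]bfunD IHx IHy !addE.
by rewrite assocVE [LHS]tmapE [RHS]tmapE liftE.
Qed.

Definition watts_colin (M : firm_module R) : colin (tens_comod Sigma M) (F M) :=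
  Colin (@watts_colinear M).

Lemma watts_natural (M N : firm_module R) (f : bihom M N) x :
  watts N ((f ⊠ idb Sigma) x) = (fmap F (f : hom (M : firm_cat R) N) : colin _ _) (watts M x).
Proof.
elim/tens_ind: x => [m u|x y IHx IHy]; last by rewrite !bfunD IHx IHy.
rewrite tmapE !liftE /watts_fun -fmap_comp; congr ((fmap F _ : colin _ _) _).
by apply: bihomP => r; apply/esym/bfunR.
Qed.

Program Definition pure_colin (M : firm_module R) (m : M) : colin (F RR) (tens_comod Sigma M) :=
  Colin (colin_fun := @BiHom _ _ (F RR) (M ⊗ Sigma) (fun u => pure m (u : Sigma)) _ _ _) _.
Next Obligation. by move=> x y; rewrite pureDr. Qed.
Next Obligation. by rewrite !lact_rng0; apply: pure0r. Qed.
Next Obligation. by rewrite ract_pure. Qed.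
Next Obligation.
move=> u; rewrite [LHS]tens_coactE -[coact Sigma u]/(coact (F RR) u).
elim/tens_ind: (coact (F RR) u) => [v c|x y IHx IHy].
  by rewrite [LHS]assocVE [RHS]tmapE.
by rewrite [RHS]bfunD -IHx -IHy -bfunD -pureDr.
Qed.

(* The orbit maps r |-> m r are jointly epic, and [F], being full and faithful, keeps
   them so; the inverse [h] is the map through which all u |-> m ⊗ u factor. *)
Lemma watts_iso (M : firm_module R) : bijective (watts M).
Proof.
have [P [j [i [ij ji]]]] := Fdense (tens_comod Sigma M : comod_cat C).
have kE (m : M) : exists k : hom RR P,
    fmap F k = comp i (pure_colin m : hom (F RR) (tens_comod Sigma M : comod_cat C)).
  exact: Ffull.
pose k m : bihom _ _ := sval (cid (kE m)).
have kP m u : (fmap F (k m : hom RR P) : colin _ _) u = (i : colin _ _) (pure m (u : Sigma)).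
  by rewrite /k; case: cid => f /= ->.
have kD m m' : k (m + m') = k m + k m'.
  apply/Ffaithful/colin_eq => u; rewrite kP (full_faithful_add hR Ffull Ffaithful) !kP.
  by rewrite pureDl bfunD.
have kB m s r : k (m <* s) r = k m (rmul s r).
  rewrite -[RHS]/(compb (k m) (left_mul hR s) r); congr (bfun _ r).
  apply/Ffaithful/colin_eq => u; rewrite fmap_comp !kP pure_bal.
  by [].
have [K KE] : exists K : bihom (M ⊗ regular R) P,
    forall m (r : R), K (pure m (r : regular R)) = k m r.
  unshelve eexists; first apply: (@lift _ _ _ M (regular R) P (fun m (r : R) => k m r)).
  - by move=> m m' r; rewrite kD.
  - by move=> m r r'; apply: (bfunD (k m)).
  - by move=> m s r; rewrite kB.
  - move=> r m s; rewrite !lact_rng0 (_ : k 0 = 0) //.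
    by apply: (@addrI _ (k 0)); rewrite -kD !addr0.
  - by move=> m r s; apply: (bfunR (k m)).
  - by move=> m r; apply: liftE.
(* By firmness of [M] the maps [k m] glue to one map [l], which restricts to [k m] along each orbit
   map. *)
pose l : hom (M : firm_cat R) P := compb K (binv (fm_firm M)).
have lE m : comp l (orbit_map m : hom RR (M : firm_cat R)) = k m.
  apply: bihomP => r; rewrite /= !compbE -[_ r]/(m <* (r : R)).
  by rewrite -(mulr_mapE m (r : regular R)) bfunK KE.
pose h : colin (F M) (tens_comod Sigma M) := comp j (fmap F l).
have hE m (u : Sigma) : h (watts_fun m u) = pure m u.
  rewrite /watts_fun -[LHS]/((j : colin _ _) ((fmap F l : colin _ _) _)).
  rewrite -fmap_comp -[compb _ _]/(comp l (orbit_map m : hom RR (M : firm_cat R))) lE kP.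
  exact: (congr1 (fun f : hom (tens_comod Sigma M : comod_cat C) _ =>
    (f : colin _ _) (pure m u)) ji).
exists h => x.
  elim/tens_ind: x => [m u|x y IHx IHy]; last by rewrite !bfunD IHx IHy.
  by rewrite liftE hE.
(* [t] induces [watts M] after [h]. It fixes every orbit map, hence every element [m = m e]. *)
have [t tP] := Ffull (comp
  (watts_colin M : hom (tens_comod Sigma M : comod_cat C) (F M)) (h : hom (F M) _)).
have tE y : (fmap F t : colin _ _) y = watts M (h y) by rewrite tP.
rewrite -tE (_ : t = idm _) ?fmap1 //.
apply: bihomP => m; have [e <-] := firm_right_unit hR m (fm_firm M).
have et : comp t (orbit_map m : hom RR (M : firm_cat R)) = orbit_map m.
  apply/Ffaithful/colin_eq => u.
  by rewrite [LHS]fmap_comp tE -[X in h X]/(watts_fun m u) hE liftE.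
exact (congr1 (fun o : bihom (forget_left (regular R)) M => o (e : regular R)) et).
Qed.

Lemma watts_nat_iso : nat_isomorphic F (tens_functor Sigma).
Proof.
apply: nat_iso_sym; exists (fun M => watts_colin M).
split=> [M N f|M]; first by apply: colin_eq => x; apply: watts_natural.
exact/comod_cat_iso/watts_iso.
Qed.

(** The orbit map of [r] in [R] is left multiplication by [r], so [watts] at [M = R] is the action
    map. *)
Lemma image_firm_left : firm_left Sigma.
Proof.
have [g gl gr] := watts_iso (FirmModule (regular_firm hR)).
have e x : watts (FirmModule (regular_firm hR)) x = mull_map Sigma x.
  apply: (@tens_hom_eq _ _ _ (regular R) Sigma).
  - exact: (bfunD (watts (FirmModule (regular_firm hR)))).
  - exact: (bfunD (mull_map Sigma)).
  by move=> r u; rewrite mull_mapE liftE; congr ((fmap F _ : colin _ _) u); apply: bihomP.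
by exists g => x; [rewrite -e | rewrite -e]; [apply: gl | apply: gr].
Qed.
End EilenbergWatts.

(** * Cofree comodules and evaluation *)

Program Definition forget_tensV (R S T : rng) (M : bimod R S) (N : bimod S T) :
  bihom (forget_left M ⊗ N) (forget_left (M ⊗ N)) :=
  @BiHom _ _ (forget_left M ⊗ N) (forget_left (M ⊗ N)) (fun x : M ⊗ N => x) _ _ _.
Next Obligation. by []. Qed.
Next Obligation. by rewrite !lact_rng0. Qed.
Next Obligation. by []. Qed.

Lemma mulr_map_natural (R S : rng) (M N : bimod R S) (f : bihom M N) (x : M ⊗ regular S) :
  mulr_map N ((f ⊠ idb (regular S)) x) = f (mulr_map M x).
Proof.
elim/tens_ind: x => [m s|x y IHx IHy]; last by rewrite !bfunD IHx IHy.
by rewrite tmapE !mulr_mapE bfunR.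
Qed.

(** Half of the universal property of [E ⊗ S] as firm coreflection of [E]; over a ring with local
    units, [mulr_map_inj] gives uniqueness. *)
Lemma firm_lift (R S : rng) (M E : bimod R S) (g : bihom M E) :
  firm_right M -> exists k : bihom M (E ⊗ regular S), forall m, mulr_map E (k m) = g m.
Proof.
move=> hM; exists (compb (g ⊠ idb (regular S)) (binv hM)) => m.
by rewrite compbE mulr_map_natural binvK.
Qed.

Section Curry.
Variables (R A B : rng) (S : bimod R A) (X : bimod B A) (M : bimod rng0 R).

Program Definition slice (t : bihom (M ⊗ S) (forget_left X)) (m : M) : rhom S X :=
  @BiHom _ _ (forget_left S) (forget_left X) (fun u => t (pure m (u : S))) _ _ _.
Next Obligation. by move=> u v; rewrite pureDr bfunD. Qed.
Next Obligation. by rewrite !lact_rng0 [pure m _]pure0r bfun0. Qed.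
Next Obligation. by rewrite -[pure m _]ract_pure bfunR. Qed.

Program Definition curry (t : bihom (M ⊗ S) (forget_left X)) :
  bihom M (forget_left (rhom S X)) :=
  @BiHom _ _ M (forget_left (rhom S X)) (slice t) _ _ _.
Next Obligation. move=> m m'; apply: bihomP => u; rewrite -[LHS]/(t (pure (m + m') (u : S))).
by rewrite pureDl bfunD. Qed.
Next Obligation.
by rewrite !lact_rng0; apply: bihomP => u; rewrite -[LHS]/(t (pure 0 _)) pure0l bfun0.
Qed.
Next Obligation. by apply: bihomP => u; rewrite -[LHS]/(t (pure _ _)) pure_bal. Qed.
End Curry.

Section Cofree.
Variables (A : pzRingType) (C : coring A).

Program Definition cofree (B : rng) (X : bimod B A) : comod B C :=
  @Comod A B C (X ⊗ C) (tens_unitr (@cor_unitr _ C)) (tens_coact X (comul C)) _ _.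
Next Obligation.
elim/tens_ind: m => [x c|x y IHx IHy]; last by rewrite !bfunD IHx IHy.
exact/tens_coact_assoc/comul_assoc.
Qed.
Next Obligation.
elim/tens_ind: m => [x c|x y IHx IHy]; last by rewrite !bfunD IHx IHy.
by rewrite tens_coact_counit counitr.
Qed.

Definition cofree_counit (B : rng) (X : bimod B A) : bihom (X ⊗ C) X :=
  compb (mulr_map X) (idb X ⊠ counit C).

Lemma cofree_counit_coact (B : rng) (X : bimod B A) (z : X ⊗ C) :
  (cofree_counit X ⊠ idb C) (coact (cofree X) z) = z.
Proof.
elim/tens_ind: z => [x c|x y IHx IHy]; last by rewrite !bfunD IHx IHy.
rewrite [coact _ _]tens_coactE -[in RHS](counitl c).
elim/tens_ind: (comul C c) => [c1 c2|y z IHy IHz]; last by rewrite !addE IHy IHz.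
by rewrite assocVE !tmapE mull_mapE compbE tmapE mulr_mapE pure_bal.
Qed.

(** By the left counit law a colinear map into [X ⊗ C] is determined by its composite with
    [X ⊗ counit]. Together with [cofree_colinear] this is the adjunction of forgetful and cofree
    functors. *)
Lemma to_cofree (B : rng) (X : bimod B A) (N : comod B C) (t : bihom N (cofree X)) n :
  is_colinear t -> t n = (compb (cofree_counit X) t ⊠ idb C) (coact N n).
Proof.
by move=> tP; rewrite -[LHS]cofree_counit_coact tP tmap_comp; congr ((_ ⊠ _) _).
Qed.
End Cofree.

Lemma cofree_colinear (A : pzRingType) (C : coring A) (B : rng) (N : comod B C)
  (X : bimod B A) (f : bihom N X) :
  is_colinear (N := cofree C X) (compb (f ⊠ idb C) (coact N)).
Proof.
move=> n; rewrite -[LHS]/(assocV ((idb X ⊠ comul C) ((f ⊠ idb C) (coact N n)))).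
have -> (z : N ⊗ C) : assocV ((idb X ⊠ comul C) ((f ⊠ idb C) z))
    = (f ⊠ idb C ⊠ idb C) (assocV ((idb N ⊠ comul C) z)).
  elim/tens_ind: z => [v c|x y IHx IHy]; last by rewrite !bfunD IHx IHy.
  rewrite !tmapE; elim/tens_ind: (comul C c) => [a b|x y IHx IHy].
    by rewrite !assocVE !tmapE.
  by rewrite !addE IHx IHy.
by rewrite -coact_assoc assocK tmap_comp; congr ((_ ⊠ _) _).
Qed.

(** * The canonical map from Hom_A(Sigma, X) ⊗ R ⊗ Sigma to X ⊗ C *)

Section Can.
Variables (A : pzRingType) (C : coring A) (R : rng) (hR : has_local_units R).
Variables (Sigma : comod R C) (B : rng) (X : bimod B A).

(* u |-> f(u_[0]) ⊗ u_[1] *)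
Definition cohom (f : rhom Sigma X) (u : Sigma) : X ⊗ C :=
  (f ⊠ idb C) (coact (comod_forget Sigma) u).

Lemma cohomDl f g u : cohom (f + g) u = cohom f u + cohom g u.
Proof. by rewrite /cohom [LHS]tmap_addl. Qed.

Lemma cohomDr f u v : cohom f (u + v) = cohom f u + cohom f v.
Proof. by rewrite /cohom (bfunD (coact (comod_forget Sigma))) [LHS]bfunD. Qed.

Lemma cohom_bal f (r : R) (u : Sigma) : cohom (f <* r) u = cohom f (r *> u).
Proof.
rewrite /cohom -[X in _ = (f ⊠ _) X]/(coact Sigma (r *> u)) bfunL.
rewrite -[X in (f <* r ⊠ _) X]/(coact Sigma u).
elim/tens_ind: (coact Sigma u) => [v c|x y IHx IHy].
  by rewrite lact_pure [LHS]tmapE [RHS]tmapE.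
by rewrite lactDr [LHS]bfunD [RHS]bfunD IHx IHy.
Qed.

Lemma cohomL b f u : cohom (b *> f) u = b *> cohom f u.
Proof.
rewrite /cohom; elim/tens_ind: (coact _ u) => [v c|x y IHx IHy].
  by rewrite [LHS]tmapE [X in _ = _ *> X]tmapE -[LHS]/(pure (b *> (f v : X)) c) -lact_pure.
by rewrite [LHS]bfunD [X in _ = _ *> X]bfunD IHx IHy [RHS](@lactDr _ _ (X ⊗ C)).
Qed.

Lemma cohomR f u (a : rng_of A) : cohom f (u <* a) = cohom f u <* a.
Proof. by rewrite /cohom (bfunR (coact (comod_forget Sigma))) [LHS]bfunR. Qed.

Lemma cohom_counit f u : cofree_counit C X (cohom f u) = f u.
Proof.
rewrite -[in RHS](coact_counit (u : comod_forget Sigma)) /cohom.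
elim/tens_ind: (coact _ u) => [v c|x y IHx IHy].
  rewrite [X in cofree_counit _ _ X]tmapE [X in f (mulr_map _ X)]tmapE !mulr_mapE.
  by rewrite compbE tmapE mulr_mapE [RHS](bfunR f).
rewrite [X in cofree_counit _ _ X]bfunD [LHS]bfunD IHx IHy.
by rewrite !(bfunD (idb _ ⊠ _)) (bfunD (mulr_map _)) [RHS](bfunD f).
Qed.

(** The factor [R] replaces [Hom_A(Sigma, X)], which need not be firm, by its firm part, so that the
    source is the image of an object of [firm_cat R]. *)
Program Definition can : bihom (rhom Sigma X ⊗ regular R ⊗ Sigma) (X ⊗ C) :=
  lift (fun x u => cohom (mulr_map (rhom Sigma X) x) u) _ _ _ _ _.
Next Obligation. by rewrite bfunD cohomDl. Qed.
Next Obligation. by rewrite cohomDr. Qed.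
Next Obligation. by rewrite bfunR cohom_bal. Qed.
Next Obligation. by rewrite bfunL cohomL. Qed.
Next Obligation. by rewrite cohomR. Qed.

Lemma canE x u : can (pure x u) = cohom (mulr_map (rhom Sigma X) x) u.
Proof. exact: liftE. Qed.
End Can.

(** * Universal arrows from - ⊗ Sigma *)

Section TensorHomAdjunction.
Variables (A : pzRingType) (C : coring A) (R : rng) (hR : has_local_units R).
Variables (Sigma : comod R C).

Section CanUniversal.
Variables (B : rng) (X : bimod B A) (hX : unital_right X).
Let Y := forget_left X.

Let firmE : firm_right (forget_left (rhom Sigma X ⊗ regular R)).
Proof.
by apply: (sunital_firm hR); apply: (@sunital_tens _ _ _ (rhom Sigma X)); apply: sunital_regular.
Qed.

Definition can_module : firm_cat R := FirmModule firmE.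

(** The same function as [can] without the left [B]-action, since objects of [comod_cat] carry
    none. *)
Definition can_forget : bihom (can_module ⊗ Sigma) (cofree C Y) :=
  compb (forget_tens X C) (compb (forget_map (can Sigma X)) (forget_tensV _ _)).

Lemma can_forgetE x u : can_forget (pure x u) = cohom (mulr_map (rhom Sigma X) x) u.
Proof. exact (canE (X:=X) (x : rhom Sigma X ⊗ regular R) u). Qed.

Lemma can_forget_colinear :
  is_colinear (M := tens_comod Sigma can_module) (N := cofree C Y) can_forget.
Proof.
move=> z; elim/tens_ind: z => [x u|x y IHx IHy]; last by rewrite !bfunD IHx IHy.
rewrite can_forgetE [coact (tens_comod _ _) _]tens_coactE.
pose f : bihom (comod_forget Sigma) Y := mulr_map (rhom Sigma X) x.
rewrite -[cohom _ u]/(compb (f ⊠ idb C) (coact (comod_forget Sigma)) u) cofree_colinear.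
rewrite -[coact (comod_forget Sigma) u]/(coact Sigma u).
elim/tens_ind: (coact Sigma u) => [v c|y z IHy IHz]; last by rewrite [LHS]bfunD IHy IHz !addE.
by rewrite [LHS]tmapE assocVE [RHS]tmapE can_forgetE.
Qed.

(** For firm [M], colinear maps [M ⊗ Sigma -> X ⊗ C] are linear maps [M ⊗ Sigma -> X], hence maps
    [M -> Hom_A(Sigma, X)], hence maps into the firm part [Hom_A(Sigma, X) ⊗ R]. *)
Lemma can_universal :
  universal_arrow (F := tens_functor Sigma) (d := cofree C Y : comod_cat C) (p := can_module)
    (Colin can_forget_colinear).
Proof.
split=> [M t|M k k' kk'].
  pose g := curry (X := X) (compb (cofree_counit C Y) (t : colin _ _)).
  have [k kP] := firm_lift g (fm_firm (M : firm_module R)).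
  exists (compb (forget_tensV _ _) k); apply: colin_eq => x.
  elim/tens_ind: x => [m u|x y IHx IHy]; last by rewrite !bfunD IHx IHy.
  rewrite -[LHS]/(can_forget ((compb (forget_tensV _ _) k ⊠ idb Sigma) (pure m u))).
  rewrite tmapE can_forgetE -[mulr_map _ _]/(mulr_map (forget_left (rhom Sigma X)) (k m)) kP.
  rewrite [RHS](to_cofree _ (colinP (t : colin _ _))).
  rewrite -[coact _ _]/(coact (tens_comod Sigma M) (pure m u)) tens_coactE.
  rewrite /cohom -[coact (comod_forget Sigma) u]/(coact Sigma u).
  elim/tens_ind: (coact Sigma u) => [w c|x y IHx IHy]; last by rewrite !addE -IHx -IHy.
  by rewrite assocVE [LHS]tmapE [RHS]tmapE.
apply: bihomP => m; apply: (mulr_map_inj hR); apply: bihomP => u.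
rewrite -2!cohom_counit -2!can_forgetE; congr (cofree_counit _ _ _).
have e := congr1 (fun h : hom (tens_comod Sigma M : comod_cat C) (cofree C Y) =>
  (h : colin _ _) (pure m u)) kk'.
rewrite -2!(tmapE _ (idb Sigma)); exact: e.
Qed.

Lemma can_bij :
  full (tens_functor Sigma) -> faithful (tens_functor Sigma) ->
  essentially_surjective (tens_functor Sigma) ->
  bijective (can Sigma X).
Proof.
move=> h1 h2 h3.
have /comod_cat_iso canB := universal_arrow_iso h1 h2 h3 can_universal.
have [g gl gr] := canB.
by exists g => x; [apply: gl | apply: gr].
Qed.
End CanUniversal.

Section Evaluation.
Variable N : comod rng0 C.

Definition ev_module : firm_cat R := FirmModule (firm_tens_regular (colin_mod Sigma N) hR).

Program Definition ev : bihom (ev_module ⊗ Sigma) N :=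
  lift (V := N) (fun x u => (sub_val (mulr_map (colin_mod Sigma N) x) : rhom Sigma N) u) _ _ _ _ _.
Next Obligation. by rewrite bfunD. Qed.
Next Obligation. exact: (bfunD (sub_val (mulr_map (colin_mod Sigma N) m) : rhom Sigma N)). Qed.
Next Obligation. by rewrite bfunR. Qed.
Next Obligation. by rewrite !lact_rng0 bfun0. Qed.
Next Obligation. exact: (bfunR (sub_val (mulr_map (colin_mod Sigma N) m) : rhom Sigma N)). Qed.

Lemma evE x u : ev (pure x u) = (sub_val (mulr_map (colin_mod Sigma N) x) : rhom Sigma N) u.
Proof. exact: liftE. Qed.

Lemma ev_colinear : is_colinear (M := tens_comod Sigma ev_module) (N := N) ev.
Proof.
move=> z; elim/tens_ind: z => [x u|x y IHx IHy]; last by rewrite !bfunD IHx IHy.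
rewrite evE [coact (tens_comod _ _) _]tens_coactE.
rewrite [LHS](sub_prop (mulr_map (colin_mod Sigma N) x) u).
rewrite -[coact (comod_forget Sigma) u]/(coact Sigma u).
elim/tens_ind: (coact Sigma u) => [v c|y z IHy IHz]; last by rewrite [LHS]bfunD IHy IHz !addE.
by rewrite [LHS]tmapE assocVE [RHS]tmapE evE.
Qed.

Definition ev_colin : colin (tens_comod Sigma ev_module) N := Colin ev_colinear.

Program Definition to_forget (M : bimod rng0 A) : bihom M (forget_left M) :=
  @BiHom _ _ M (forget_left M) (fun x => x) _ _ _.
Next Obligation. by []. Qed.
Next Obligation. by rewrite !lact_rng0. Qed.
Next Obligation. by []. Qed.

(** As for [can_universal], with colinear maps out of [Sigma]: the slices [u |-> t(m ⊗ u)] of a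
    colinear [t] are colinear, because [M ⊗ Sigma] is coacted on through [Sigma]. *)
Lemma ev_universal :
  universal_arrow (F := tens_functor Sigma) (d := N : comod_cat C) (p := ev_module) ev_colin.
Proof.
split=> [M t|M k k' kk'].
  pose t' : bihom (M ⊗ Sigma) N := (t : colin _ _).
  pose g0 := curry (X := N) (compb (to_forget N) t').
  have gP m : is_colinear (M := comod_forget Sigma) (N := comod_forget N) (g0 m : rhom Sigma N).
    move=> u; rewrite -[LHS]/(coact N (t' (pure m (u : Sigma)))) (colinP (t : colin _ _)).
    rewrite [coact (tens_comod _ _) _]tens_coactE -[coact (comod_forget _) u]/(coact Sigma u).
    elim/tens_ind: (coact Sigma u) => [v c|y z IHy IHz]; last by rewrite !addE IHy IHz.
    by rewrite assocVE [LHS]tmapE [RHS]tmapE.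
  pose G m : colin_mod Sigma N := @SubElt _ _ (rhom Sigma N) _ (g0 m) (gP m).
  have [g gE] : exists g : bihom M (colin_mod Sigma N), forall m, sub_val (g m) = g0 m.
    unshelve eexists.
      apply: (@BiHom _ _ M (colin_mod Sigma N) G).
      - by move=> m m'; apply: sub_val_inj; apply: (bfunD g0).
      - by move=> r m; rewrite !lact_rng0; apply: sub_val_inj; apply: (bfun0 g0).
      - by move=> m r; apply: sub_val_inj; apply: (bfunR g0).
    by [].
  have [k kP] := firm_lift g (fm_firm (M : firm_module R)).
  exists k; apply: colin_eq => x.
  elim/tens_ind: x => [m u|x y IHx IHy]; last by rewrite !bfunD IHx IHy.
  rewrite -[LHS]/(ev ((k ⊠ idb Sigma) (pure m u))) tmapE evE kP gE.
  by [].
apply: bihomP => m; apply: (mulr_map_inj hR); apply: sub_val_inj; apply: bihomP => u.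
rewrite -2!evE.
have e := congr1 (fun h : hom (tens_comod Sigma M : comod_cat C) N =>
  (h : colin _ _) (pure m u)) kk'.
rewrite -2!(tmapE _ (idb Sigma)); exact: e.
Qed.
End Evaluation.

Lemma ev_natural (N N' : comod rng0 C) (g : colin N N') (x : ev_module N ⊗ Sigma) :
  ev N' ((colin_map Sigma g ⊠ idb (regular R) ⊠ idb Sigma) x) = g (ev N x).
Proof.
elim/tens_ind: x => [x u|x y IHx IHy]; last by rewrite !bfunD IHx IHy.
by rewrite tmapE !evE mulr_map_natural.
Qed.

(** Through [inverse_unique], this identifies any inverse of [- ⊗ Sigma] with
    [Hom^C(Sigma, -) ⊗ R]. *)
Lemma hom_functor_counit :
  full (tens_functor Sigma) -> faithful (tens_functor Sigma) ->
  essentially_surjective (tens_functor Sigma) ->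
  nat_isomorphic (fcomp (tens_functor Sigma) (hom_functor Sigma hR)) (fid (comod_cat C)).
Proof.
move=> h1 h2 h3; exists ev_colin; split=> [N N' g|N].
  by apply: colin_eq => x; apply: ev_natural.
exact: (universal_arrow_iso h1 h2 h3 (ev_universal N)).
Qed.
End TensorHomAdjunction.

(** * Comatrix coring contexts *)

Section ComatrixContext.
Variables (A : pzRingType) (R : rng) (hR : has_local_units R).
Variables (S : bimod R A) (S' : bimod A R) (k : comatrix_context S S').

Definition pair_left (B : rng) (N : bimod B A) (y : N ⊗ S') (u : S) : N :=
  mulr_map N ((idb N ⊠ ctx_eps k) (assoc (pure y u))).

Lemma pair_leftE (B : rng) (N : bimod B A) n x u :
  pair_left (pure n x : N ⊗ S') u = n <* (ctx_eps k (pure x u) : A).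
Proof. by rewrite /pair_left assocE tmapE mulr_mapE. Qed.

Lemma pair_leftDl (B : rng) (N : bimod B A) (y z : N ⊗ S') u :
  pair_left (y + z) u = pair_left y u + pair_left z u.
Proof. by rewrite /pair_left !addE. Qed.

Lemma pair_leftDr (B : rng) (N : bimod B A) (y : N ⊗ S') u v :
  pair_left y (u + v) = pair_left y u + pair_left y v.
Proof. by rewrite /pair_left !addE. Qed.

Lemma pair_left_eta (r : R) u : pair_left (ctx_eta k r) u = r *> u.
Proof. exact: ctx_triangle. Qed.

Program Definition pairing (B : rng) (N : bimod B A) : bihom (N ⊗ S') (rhom S N) :=
  @BiHom _ _ (N ⊗ S') (rhom S N)
    (fun y => @BiHom _ _ (forget_left S) (forget_left N) (pair_left y) _ _ _) _ _ _.
Next Obligation. by move=> u v; apply: pair_leftDr. Qed.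
Next Obligation. by rewrite !lact_rng0 /pair_left pure0r !bfun0. Qed.
Next Obligation. by rewrite /pair_left -[pure y _]ract_pure !bfunR. Qed.
Next Obligation. by move=> y z; apply: bihomP => u; apply: pair_leftDl. Qed.
Next Obligation.
by apply: bihomP => u; rewrite -[LHS]/(pair_left (r *> m) u) /pair_left -lact_pure !bfunL.
Qed.
Next Obligation.
by apply: bihomP => u; rewrite -[LHS]/(pair_left (m <* s) u) /pair_left pure_bal.
Qed.

Lemma pairingE (B : rng) (N : bimod B A) (y : N ⊗ S') u : pairing N y u = pair_left y u.
Proof. by []. Qed.

Lemma pair_left_natural (B : rng) (N N' : bimod B A) (g : bihom N N') y u :
  pair_left ((g ⊠ idb S') y) u = g (pair_left y u).
Proof.
elim/tens_ind: y => [n x|y z IHy IHz]; last by rewrite bfunD !pair_leftDl bfunD IHy IHz.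
by rewrite tmapE !pair_leftE bfunR.
Qed.

(* Both sides are [n eps(x ⊗ e_r) ⊗ f_r] when [y = n ⊗ x]. *)
Lemma pairing_eta (B : rng) (N : bimod B A) (y : N ⊗ S') (r : R) :
  ((pairing N y : bihom _ _) ⊠ idb S') (ctx_eta k r) = y <* r.
Proof.
elim/tens_ind: y => [n x|y z IHy IHz]; last first.
  by rewrite (bfunD (pairing N)) [LHS]tmap_addl IHy IHz [RHS](@ractDl _ _ (N ⊗ S')).
have -> : (pure n x : N ⊗ S') <* r = pure n (x <* r) by exact: ract_pure.
rewrite -(ctx_triangle' k).
elim/tens_ind: (ctx_eta k r) => [e f|y z IHy IHz]; last by rewrite [LHS]bfunD IHy IHz !addE.
rewrite [LHS]tmapE assocVE tmapE mull_mapE.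
by rewrite -[X in pure X f]/(pair_left (pure n x) e) pair_leftE [LHS]pure_bal.
Qed.

(** If [y = y e], then [y] is the image of [eta(e)] under [pairing y ⊗ S'], so it vanishes with
    [pairing y]. *)
Lemma pairing_inj (B : rng) (N : bimod B A) : injective (pairing N).
Proof.
apply: bihom_inj => y y0.
have hy : sunital (N ⊗ S') by apply/sunital_tens/(firm_sunital hR)/(ctx_firm_right' k).
have [e ey] := hy [:: y]; rewrite -[y]ey ?inE //.
rewrite -pairing_eta y0.
exact: (@tmap_0l _ _ _ (forget_left S) (forget_left N) S' S' (idb S') (ctx_eta k e)).
Qed.

Lemma dagger_unit (x : S') : exists e : R, x <* e = x.
Proof. exact/firm_right_unit/(ctx_firm_right' k). Qed.

(** For [y = y e] and [eta(e)] the sum of the [e_i ⊗ f_i], [y] is the sum of the [y(e_i) ⊗ f_i]. By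
    naturality [g] kills each [y(e_i)], so a preimage under [f] can be taken termwise. *)
Lemma dagger_flat (P : bimod rng0 A -> Prop) : flat_on P S'.
Proof.
move=> M1 M2 M3 f g _ _ _ fg y; split=> [gy|[x <-]]; last first.
  have gf m : g (f m) = 0 by apply/fg; exists m.
  elim/tens_ind: x => [m r|x z IHx IHz]; last by rewrite !bfunD IHx IHz addr0.
  by rewrite !tmapE gf pure0l.
have hy : sunital (M2 ⊗ S') by apply/sunital_tens/(firm_sunital hR)/(ctx_firm_right' k).
have [e ey] := hy [:: y]; rewrite -[y]ey ?inE // -pairing_eta.
elim/tens_ind: (ctx_eta k e) => [u x|w z [w' IHw] [z' IHz]]; last first.
  by exists (w' + z'); rewrite bfunD IHw IHz [RHS]bfunD.
have [m mP] : exists m, f m = pair_left y u.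
  by apply/fg; rewrite -pair_left_natural gy /pair_left pure0l !bfun0.
by exists (pure m x); rewrite tmapE mP [RHS]tmapE.
Qed.
End ComatrixContext.

(** * Comodules whose coaction comes from a comatrix context *)

Section CoactionThroughContext.
Variables (A : pzRingType) (C : coring A) (R : rng) (hR : has_local_units R).
Variables (Sigma : comod R C) (S' : bimod A R) (k : comatrix_context Sigma S').
Variable theta : bihom (S' ⊗ Sigma) C.
Hypothesis coactE : forall u, coact Sigma u = (idb Sigma ⊠ theta) (comatrix_coact k u).

Lemma coact_lact (r : R) u :
  coact Sigma (r *> u) = (idb Sigma ⊠ theta) (assoc (pure (ctx_eta k r) u)).
Proof. by rewrite coactE comatrix_coactE. Qed.

(** At [r u], move [r] to [x] and use [x r = eps(x ⊗ e_r) f_r]. So the coaction determines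
    [theta]. *)
Lemma theta_coact x u :
  theta (pure x u) = mull_map C ((ctx_eps k ⊠ idb C) (assocV (pure x (coact Sigma u)))).
Proof.
elim/(firm_left_ind k): u => [r u|u v IHu IHv]; last by rewrite !addE IHu IHv.
rewrite -pure_bal -(ctx_triangle' k) coact_lact.
elim/tens_ind: (ctx_eta k r) => [e f|y z IHy IHz]; last by rewrite !addE IHy IHz.
by rewrite assocVE assocE !tmapE assocVE tmapE !mull_mapE -lact_pure bfunL.
Qed.

(** The mirror image of [comatrix_coact], sending [x r] to [theta(x ⊗ e_r) ⊗ f_r]. In the context of
    an equivalence it is [dagger_coact], by [dagger_coactE]. *)
Definition left_coact : bihom S' (C ⊗ S') :=
  compb (theta ⊠ idb S') (compb assocV (compb (idb S' ⊠ ctx_eta k) (binv (ctx_firm_right' k)))).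

Lemma left_coactE x (r : R) :
  left_coact (x <* r) = (theta ⊠ idb S') (assocV (pure x (ctx_eta k r))).
Proof. by rewrite !compbE -[x <* r](mulr_mapE x (r : regular R)) bfunK tmapE. Qed.

(** For [y = n ⊗ x] both sides are [n eps(x ⊗ u_[0]) ⊗ u_[1]], by [theta_coact]. *)
Lemma pair_left_coact (B : rng) (N : bimod B A) (y : N ⊗ S') u :
  pair_left k (assocV ((idb N ⊠ left_coact) y)) u = cohom (pairing k N y) u.
Proof.
elim/tens_ind: y => [n x|y z IHy IHz]; last first.
  by rewrite !bfunD pair_leftDl IHy IHz cohomDl.
have [r <-] := dagger_unit hR k x.
have -> : pairing k N (pure n (x <* r)) = pairing k N (pure n x) <* r.
  by rewrite -bfunR ract_pure.
rewrite cohom_bal tmapE left_coactE.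
have -> z : pair_left k (assocV (pure (idb N n) ((theta ⊠ idb S') (assocV (pure x z))))) u
    = pure n (theta (pure x (pair_left k z u))).
  elim/tens_ind: z => [e f|y z IHy IHz]; last first.
    by rewrite !addE !pair_leftDl !addE IHy IHz.
  by rewrite assocVE tmapE assocVE !pair_leftE -ract_pure bfunR ract_pure.
rewrite pair_left_eta theta_coact /cohom -[coact (comod_forget _) _]/(coact Sigma (r *> u)).
elim/tens_ind: (coact Sigma (r *> u)) => [v c|y z IHy IHz]; last by rewrite !addE IHy IHz.
rewrite assocVE tmapE mull_mapE -pure_bal [RHS]tmapE.
by rewrite -[X in _ = pure X _]/(pair_left k (pure n x) v) pair_leftE.
Qed.

(** The injective [pairing] for [N ⊗ C] turns the two sides of the cotensor condition into
    [u |-> rho(y(u))] and [u |-> y(u_[0]) ⊗ u_[1]]. *)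
Lemma equalized_colinear (N : comod rng0 C) (y : N ⊗ S') :
  assoc ((coact N ⊠ idb S') y) = (idb N ⊠ left_coact) y <->
  is_colinear (M := comod_forget Sigma) (N := comod_forget N) (pairing k N y : rhom Sigma N).
Proof.
have e : assoc ((coact N ⊠ idb S') y) = (idb N ⊠ left_coact) y <->
    (coact N ⊠ idb S') y = assocV ((idb N ⊠ left_coact) y).
  by split=> [<-|->]; rewrite ?assocK ?assocVK.
rewrite e; split=> [ey u|yP].
  rewrite -[LHS]/(coact N (pair_left k y u)) -pair_left_natural ey.
  exact: pair_left_coact.
apply: (pairing_inj hR (k := k)); apply: bihomP => u.
rewrite pairingE pair_left_natural pairingE pair_left_coact.
exact: yP.
Qed.

Section Beta.
Variable N : comod rng0 C.

Program Definition hom_tens : bihom (colin_mod Sigma N ⊗ regular R) (N ⊗ S') :=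
  lift (M := colin_mod Sigma N) (N := regular R) (V := N ⊗ S')
    (fun f r => (((sub_val f : rhom Sigma N) : bihom _ _) ⊠ idb S') (ctx_eta k r)) _ _ _ _ _.
Next Obligation. exact: (@tmap_addl _ _ _ (forget_left Sigma) (forget_left N)). Qed.
Next Obligation. by rewrite (bfunD (ctx_eta k)) (bfunD (_ ⊠ idb S')). Qed.
Next Obligation.
rewrite bfunL; elim/tens_ind: (ctx_eta k n) => [e f|x y IHx IHy].
  by rewrite lact_pure [LHS]tmapE [RHS]tmapE.
by rewrite lactDr [LHS]bfunD [RHS]bfunD IHx IHy.
Qed.
Next Obligation.
by rewrite !lact_rng0; apply: (@tmap_0l _ _ _ (forget_left Sigma) (forget_left N)).
Qed.
Next Obligation.
rewrite bfunR.
exact: (bfunR ((sub_val m : bihom (forget_left Sigma) (forget_left N)) ⊠ idb S')).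
Qed.

Lemma hom_tensE f (r : R) :
  hom_tens (pure f (r : regular R)) = ((sub_val f : rhom Sigma N) ⊠ idb S') (ctx_eta k r).
Proof. exact: liftE. Qed.

(** This is [f(e_r) eps(f_r ⊗ u) = f(r u)]; it makes [hom_tens] injective. *)
Lemma pairing_hom_tens w :
  pairing k N (hom_tens w) = sub_val (mulr_map (colin_mod Sigma N) w).
Proof.
elim/tens_ind: w => [f r|x y IHx IHy]; last first.
  by rewrite (bfunD hom_tens) (bfunD (pairing k N)) IHx IHy (bfunD (mulr_map _)).
apply: bihomP => u; rewrite hom_tensE mulr_mapE.
rewrite -[RHS]/((sub_val f : rhom Sigma N) ((r : R) *> u)) -(pair_left_eta k).
elim/tens_ind: (ctx_eta k r) => [e g|x y IHx IHy].
  rewrite tmapE -[LHS]/(pair_left k (pure _ _) u) !pair_leftE.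
  exact: (esym (bfunR (sub_val f : bihom (forget_left Sigma) (forget_left N)) e _)).
rewrite [X in pairing _ _ X]bfunD (bfunD (pairing k N)) pair_leftDl.
by rewrite [RHS](bfunD (sub_val f : bihom (forget_left Sigma) (forget_left N))) -IHx -IHy.
Qed.

Lemma hom_tens_inj : injective hom_tens.
Proof.
move=> w w' e; apply: (mulr_map_inj hR); apply: sub_val_inj.
by rewrite -2!pairing_hom_tens e.
Qed.

(** If [y = y e] is equalized, then [pairing y] is colinear and [pairing y ⊗ e] is a preimage, by
    [pairing_eta]. *)
Lemma hom_tens_image (y : N ⊗ S') :
  assoc ((coact N ⊠ idb S') y) = (idb N ⊠ left_coact) y <-> exists w, hom_tens w = y.
Proof.
rewrite equalized_colinear; split=> [yP|[w <-]]; last first.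
  by rewrite pairing_hom_tens; apply: sub_prop.
have hy : sunital (N ⊗ S') by apply/sunital_tens/(firm_sunital hR)/(ctx_firm_right' k).
have [e ey] := hy [:: y].
pose f : colin_mod Sigma N := @SubElt _ _ (rhom Sigma N) _ (pairing k N y) yP.
exists (pure f (e : regular R)).
by rewrite hom_tensE -[RHS]ey ?inE // -(pairing_eta k).
Qed.
End Beta.

Section CoringMorphism.
Hypotheses (thetaU : forall d, counit C (theta d) = ctx_eps k d)
  (thetaM : forall d, comul C (theta d) = (theta ⊠ theta) (comatrix_comul k d)).

(* By bilinearity of eta, eta(r s) = e_r ⊗ f_r s = r e_s ⊗ f_s, and both sides
   at [x r s] are theta(x ⊗ e_r) ⊗ theta(f_r ⊗ e_s) ⊗ f_s. *)
Lemma left_coact_is_coaction : is_left_coaction left_coact.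
Proof.
split=> [|x|x]; first exact: firm_unital_left (ctx_firm_left' k).
  have [s <-] := dagger_unit hR k x; have [r <-] := dagger_unit hR k x.
  have e1 : left_coact (x <* r <* s) = (theta ⊠ idb S') (assocV (pure x (r *> ctx_eta k s))).
    by rewrite -ractM left_coactE -bfunL.
  rewrite [X in assoc (_ X)]e1 bfunR left_coactE.
  pose T z w := (theta ⊠ idb (C ⊗ S')) (assocV (pure x
    ((idb Sigma ⊠ compb (theta ⊠ idb S') assocV) (assoc (pure z w))))).
  transitivity (T (ctx_eta k r) (ctx_eta k s)).
    elim/tens_ind: (ctx_eta k s) => [e f|y z IHy IHz]; last by rewrite /T !addE IHy IHz.
    rewrite lact_pure assocVE !tmapE thetaM comatrix_comulE comatrix_coactE /T.
    elim/tens_ind: (ctx_eta k r) => [e' f'|y z IHy IHz]; last by rewrite !addE IHy IHz.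
    by rewrite !assocE !tmapE assocVE !compbE !assocVE !tmapE assocE.
  rewrite /T; elim/tens_ind: (ctx_eta k r) => [e f|y z IHy IHz]; last by rewrite !addE IHy IHz.
  rewrite assocE !tmapE !assocVE !tmapE ract_pure tmapE left_coactE.
  by rewrite compbE.
have [r <-] := dagger_unit hR k x; rewrite left_coactE -[RHS](ctx_triangle' k) tmap_comp.
by congr (mull_map _ ((_ ⊠ _) _)); apply: bihomP => y; rewrite ?compbE ?thetaU.
Qed.
(** At [x ⊗ r u] both sides are [theta(x ⊗ e_r) ⊗ theta(f_r ⊗ u)], once [r] is moved to [x] on the
    right. *)
Lemma comul_theta x u :
  comul C (theta (pure x u)) = (idb C ⊠ theta) (assoc (pure (left_coact x) u)).
Proof.
elim/(firm_left_ind k): u => [r u|u v IHu IHv]; last by rewrite !addE IHu IHv.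
rewrite -[in RHS]pure_bal -bfunR left_coactE thetaM comatrix_comulE comatrix_coactE.
elim/tens_ind: (ctx_eta k r) => [e f|y z IHy IHz]; last by rewrite !addE IHy IHz.
by rewrite assocE !assocVE !tmapE assocE tmapE.
Qed.
End CoringMorphism.

Section HomCotensor.
Hypothesis hk : is_left_coaction left_coact.

Let L := LComod hk.

Lemma hom_tens_natural (N N' : comod rng0 C) (g : colin N N') w :
  (g ⊠ idb S') (hom_tens N w) = hom_tens N' ((colin_map Sigma g ⊠ idb (regular R)) w).
Proof.
elim/tens_ind: w => [f r|x y IHx IHy]; last by rewrite !bfunD IHx IHy.
rewrite tmapE !hom_tensE.
elim/tens_ind: (ctx_eta k r) => [v x|x y IHx IHy]; last by rewrite !bfunD IHx IHy.
by rewrite !tmapE.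
Qed.

Program Definition to_cotens (N : comod rng0 C) :
  bihom (colin_mod Sigma N ⊗ regular R) (cotens L N) :=
  @BiHom _ _ (colin_mod Sigma N ⊗ regular R) (cotens L N)
    (fun w => @SubElt _ _ (N ⊗ L) _ (hom_tens N w) _) _ _ _.
Next Obligation. by apply/hom_tens_image; exists w. Qed.
Next Obligation. by move=> v w; apply: sub_val_inj; apply: (bfunD (hom_tens N)). Qed.
Next Obligation. by apply: sub_val_inj; apply: (bfunL (hom_tens N)). Qed.
Next Obligation. by apply: sub_val_inj; apply: (bfunR (hom_tens N)). Qed.

Lemma hom_cotens_iso :
  nat_isomorphic (hom_functor Sigma hR) (cotens_functor (L := L) hR (ctx_firm_right' k)).
Proof.
exists to_cotens; split=> [N N' g|N].
  by apply: bihomP => w; apply: sub_val_inj; apply: esym; apply: hom_tens_natural.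
apply/firm_cat_iso; apply: inj_surj_bij => [v w e|[y yP]].
  by apply: (@hom_tens_inj N); apply: (congr1 (@sub_val _ _ _ _) e).
have [w wP] := (hom_tens_image y).1 yP.
by exists w; apply: sub_val_inj.
Qed.
End HomCotensor.
End CoactionThroughContext.

(** * The context of an equivalence *)

Section ContextOfEquivalence.
Variables (A : pzRingType) (C : coring A) (R : rng) (hR : has_local_units R).
Variables (Sigma : comod R C).

Program Definition eval_eps : bihom (dagger Sigma ⊗ Sigma) (regular A) :=
  lift (M := dagger Sigma) (V := regular A)
    (fun x u => (mulr_map (dual Sigma) x : bihom _ _) u) _ _ _ _ _.
Next Obligation. by rewrite (bfunD (mulr_map _)). Qed.
Next Obligation.
exact: (bfunD (mulr_map (dual Sigma) m :
  bihom (forget_left _) (forget_left (regular A)))).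
Qed.
Next Obligation. by rewrite (bfunR (mulr_map _)). Qed.
Next Obligation. by rewrite (bfunL (mulr_map _)). Qed.
Next Obligation.
exact: (bfunR (mulr_map (dual Sigma) m :
  bihom (forget_left _) (forget_left (regular A)))).
Qed.

Lemma eval_epsE (x : dagger Sigma) u :
  eval_eps (pure x u) = (mulr_map (dual Sigma) x : bihom _ _) u.
Proof. exact: liftE. Qed.

Definition can_theta : bihom (dagger Sigma ⊗ Sigma) C :=
  compb (mull_map C) (can Sigma (regular A)).

Lemma can_thetaE (x : dagger Sigma) u :
  can_theta (pure x u) = mull_map C (cohom (mulr_map (dual Sigma) x) u).
Proof. by rewrite compbE canE. Qed.

Program Definition rank_one : bihom (Sigma ⊗ dual Sigma) (rhom Sigma Sigma) :=
  lift (M := Sigma) (N := dual Sigma) (V := rhom Sigma Sigma)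
    (fun v phi => @BiHom _ _ (forget_left Sigma) (forget_left Sigma)
      (fun u => v <* ((phi : bihom _ _) u : A)) _ _ _) _ _ _ _ _.
Next Obligation. by move=> u w; rewrite [X in v <* X]bfunD ractDr. Qed.
Next Obligation. by rewrite !lact_rng0 [X in v <* X]bfun0 rract0. Qed.
Next Obligation. by rewrite [X in v <* X]bfunR ractM. Qed.
Next Obligation. by apply: bihomP => u; apply: ractDl. Qed.
Next Obligation. by apply: bihomP => u; apply: ractDr. Qed.
Next Obligation. by apply: bihomP => u; apply/esym/ractM. Qed.
Next Obligation.
by apply: bihomP => u; exact: (esym (lractA (r : R) m ((n : bihom _ _) u : A))).
Qed.
Next Obligation. exact: bihomP. Qed.

Lemma rank_oneE v (phi : dual Sigma) u :
  (rank_one (pure v phi) : bihom _ _) u = v <* ((phi : bihom _ _) u : A).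
Proof. by rewrite /rank_one liftE. Qed.

Definition rank_one_tens : bihom (Sigma ⊗ dagger Sigma) (rhom Sigma Sigma ⊗ regular R) :=
  compb (rank_one ⊠ idb (regular R)) assocV.

(** Both sides send [(v ⊗ (phi ⊗ r)) ⊗ u] to [v phi((r u)_[0]) ⊗ (r u)_[1]]. The square links the
    canonical maps for [X = Sigma] and [X = A]. *)
Lemma can_rank_one x :
  can Sigma Sigma ((rank_one_tens ⊠ idb Sigma) x) = (idb Sigma ⊠ can_theta) (assoc x).
Proof.
elim/tens_ind: x => [y u|x y IHx IHy]; last by rewrite !bfunD IHx IHy.
elim/tens_ind: y => [v x|x y IHx IHy]; last by rewrite !addE IHx IHy.
elim/tens_ind: x => [phi r|x y IHx IHy]; last by rewrite !addE IHx IHy.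
rewrite assocE !tmapE compbE assocVE tmapE canE can_thetaE !mulr_mapE !cohom_bal /cohom.
rewrite -[coact (comod_forget _) _]/(coact Sigma (_ *> u)).
elim/tens_ind: (coact Sigma _) => [w c|x y IHx IHy]; last first.
  by rewrite [LHS]bfunD [X in pure _ (mull_map _ X)]bfunD IHx IHy !addE.
rewrite [LHS]tmapE [X in mull_map _ X]tmapE mull_mapE -pure_bal; congr pure.
exact: rank_oneE.
Qed.

Section Full.
Hypotheses (Tfull : full (tens_functor Sigma)) (Tfaithful : faithful (tens_functor Sigma))
  (Tdense : essentially_surjective (tens_functor Sigma)).

Lemma can_theta_bij : bijective can_theta.
Proof.
apply: bij_comp.
  exact: (unital_firm_left (@cor_unitl _ C)).
by apply: (can_bij hR) => //; apply: mulr1.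
Qed.

(** The other maps in the square [can_rank_one] are bijective, hence so is [rank_one_tens ⊗ Sigma];
    and [- ⊗ Sigma] reflects isomorphisms. *)
Lemma rank_one_tens_bij : bijective rank_one_tens.
Proof.
have fQ : firm_right (forget_left (Sigma ⊗ dagger Sigma)).
  apply: (sunital_firm hR); apply: (@sunital_tens _ _ _ Sigma).
  by apply/sunital_tens/sunital_regular.
have fE : firm_right (forget_left (rhom Sigma Sigma ⊗ regular R)).
  apply: (sunital_firm hR); apply: (@sunital_tens _ _ _ (rhom Sigma Sigma)).
  exact: sunital_regular.
pose f : hom (FirmModule fQ : firm_cat R) (FirmModule fE) := forget_map rank_one_tens.
suff /firm_cat_iso [g gl gr] : is_iso f by exists g => x; [apply: gl | apply: gr].
apply: (full_faithful_conservative Tfull Tfaithful); apply/comod_cat_iso.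
have canB : bijective (can Sigma Sigma) by apply: (can_bij hR) => //; apply: com_unit.
have fB : bijective (rank_one_tens ⊠ idb Sigma).
  apply: (bij_factor canB _ can_rank_one); apply: bij_comp (@assoc_bij _ _ _ _ _ _ _).
  by apply: tmap_bij can_theta_bij; exists id.
have [g gl gr] := fB.
have e x : (forget_map rank_one_tens ⊠ idb Sigma) x = (rank_one_tens ⊠ idb Sigma) x.
  elim/tens_ind: x => [y u|x y IHx IHy]; last by rewrite [RHS]bfunD -IHx -IHy; apply: bfunD.
  by rewrite [RHS]tmapE; apply: tmapE.
by exists g => x; [rewrite -[RHS]gl -e | rewrite -[RHS]gr -e].
Qed.

Program Definition left_mult : bihom (regular R) (rhom Sigma Sigma) :=
  @BiHom _ _ (regular R) (rhom Sigma Sigma) (fun r => @BiHom _ _ (forget_left Sigma)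
    (forget_left Sigma) (fun u : Sigma => (r : R) *> u) _ _ _) _ _ _.
Next Obligation. by move=> u v; apply: (@lactDr _ _ Sigma). Qed.
Next Obligation. by rewrite !lact_rng0; apply: (lact0 Sigma). Qed.
Next Obligation. exact: (@lractA _ _ Sigma). Qed.
Next Obligation. by move=> r s; apply: bihomP => u; apply: (@lactDl _ _ Sigma). Qed.
Next Obligation. by apply: bihomP => u; apply: (@lactM _ _ Sigma). Qed.
Next Obligation. by apply: bihomP => u; apply: (@lactM _ _ Sigma). Qed.

(** The composite [R ≅ R ⊗ R -> End_A(Sigma) ⊗ R], pulled back along [rank_one_tens]: the action of
    [r] written as a finite sum of rank one maps. *)
Definition eval_eta : bihom (regular R) (Sigma ⊗ dagger Sigma) :=
  compb (binv rank_one_tens_bij)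
    (compb (left_mult ⊠ idb (regular R)) (binv (regular_firm_ring hR).1)).

(** Acting through [eval_eps] is applying the endomorphism that [rank_one_tens] assigns to [y];
    hence the first triangle identity holds by the choice of [eval_eta]. *)
Lemma eval_pair_left y u :
  mulr_map Sigma ((idb Sigma ⊠ eval_eps) (assoc (pure y u)))
  = (mulr_map (rhom Sigma Sigma) (rank_one_tens y) : bihom _ _) u.
Proof.
elim/tens_ind: y => [v x|x y IHx IHy]; last first.
  by rewrite !addE IHx IHy.
elim/tens_ind: x => [phi r|x y IHx IHy]; last first.
  by rewrite !addE IHx IHy.
rewrite assocE tmapE eval_epsE /rank_one_tens compbE assocVE tmapE !mulr_mapE.
exact: (esym (rank_oneE v phi ((r : R) *> u))).
Qed.

Lemma eval_triangle (r : regular R) u :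
  mulr_map Sigma ((idb Sigma ⊠ eval_eps) (assoc (pure (eval_eta r) u))) = (r : R) *> u.
Proof.
rewrite eval_pair_left.
have -> : eval_eta r = binv rank_one_tens_bij
  ((left_mult ⊠ idb (regular R)) (binv (regular_firm_ring hR).1 r)) by [].
by rewrite binvK mulr_map_natural binvK.
Qed.

(** By [mulr_map_inj] both sides may be compared as functionals on [Sigma], where the claim is [x]
    applied to the first triangle identity. *)
Lemma eval_triangle' (x : dagger Sigma) (r : regular R) :
  mull_map (dagger Sigma) ((eval_eps ⊠ idb (dagger Sigma)) (assocV (pure x (eval_eta r))))
  = x <* (r : R).
Proof.
apply: (mulr_map_inj hR); apply: bihomP => u.
rewrite bfunR -[RHS]/((mulr_map (dual Sigma) x : bihom _ _) ((r : R) *> u)).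
rewrite -eval_epsE -eval_triangle.
elim/tens_ind: (eval_eta r) => [e f|y z IHy IHz]; last first.
  by rewrite !addE -IHy -IHz.
rewrite assocVE assocE !tmapE mull_mapE mulr_mapE -lact_pure bfunL (eval_epsE x).
exact: (esym (bfunR (mulr_map (dual Sigma) x :
  bihom (forget_left _) (forget_left (regular A))) _ _)).
Qed.

Hypothesis Sfirm : firm_left Sigma.

(** Kept transparent, because later proofs identify its [ctx_eta] and [ctx_eps] with [eval_eta] and
    [eval_eps] by conversion. *)
Definition eval_context : comatrix_context Sigma (dagger Sigma).
Proof.
apply: (@ComatrixContext _ _ _ _ _ _ _ _ _ _ eval_eta eval_eps eval_triangle eval_triangle').
- exact: regular_firm_ring.
- exact: unital_firm_ring.
- exact: Sfirm.
- exact/unital_firm_right/com_unit.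
- apply/unital_firm_left/(tens_unitl (M := dual Sigma)) => f; apply: bihomP => u.
  exact: mul1r.
- exact: firm_tens_regular.
Defined.

(** By [can_rank_one] the right side at [r u] is the canonical map at the endomorphism [left_mult r]
    and [u], that is [r u_[0] ⊗ u_[1]]. *)
Lemma eval_coactE u :
  coact Sigma u = (idb Sigma ⊠ can_theta) (comatrix_coact eval_context u).
Proof.
elim/(firm_left_ind eval_context): u => [r u|u v IHu IHv]; last by rewrite !bfunD IHu IHv.
rewrite comatrix_coactE bfunL -can_rank_one tmapE canE idbE.
have -> : mulr_map (rhom Sigma Sigma) (rank_one_tens (ctx_eta eval_context r)) = left_mult r.
  by apply: bihomP => v; rewrite -eval_pair_left; apply: eval_triangle.
rewrite /cohom -[coact (comod_forget _) u]/(coact Sigma u).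
elim/tens_ind: (coact Sigma u) => [v c|x y IHx IHy]; last by rewrite lactDr IHx IHy [RHS]bfunD.
by rewrite lact_pure [RHS]tmapE.
Qed.

(** [counit(phi(u_[0]) u_[1]) = phi(u_[0] counit(u_[1])) = phi(u)]. *)
Lemma can_theta_counit d : counit C (can_theta d) = eval_eps d.
Proof.
elim/tens_ind: d => [x u|x y IHx IHy]; last by rewrite !bfunD IHx IHy.
rewrite can_thetaE eval_epsE -(cohom_counit (X := regular A)) /cofree_counit compbE.
elim/tens_ind: (cohom _ u) => [a c|y z IHy IHz]; last by rewrite !bfunD IHy IHz.
by rewrite mull_mapE tmapE mulr_mapE bfunL.
Qed.

Lemma can_theta_comul d :
  comul C (can_theta d) = (can_theta ⊠ can_theta) (comatrix_comul eval_context d).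
Proof.
elim/tens_ind: d => [x u|x y IHx IHy]; last by rewrite !bfunD IHx IHy.
rewrite comatrix_comulE can_thetaE; pose f : rhom Sigma (regular A) := mulr_map (dual Sigma) x.
(* [K] sends [v ⊗ (c ⊗ c')] to [f(v) c ⊗ c']. Both sides turn out to be [K] of the twice iterated
   coaction of [u], the right one by [eval_coactE]. *)
pose K (z : Sigma ⊗ (C ⊗ C)) : C ⊗ C :=
  mull_map (C ⊗ C)
    (((f : bihom (forget_left Sigma) (forget_left (regular A))) ⊠ idb (C ⊗ C)) z).
have KD : {morph K : y z / y + z}.
  by move=> y z; rewrite /K [X in mull_map _ X](bfunD (_ ⊠ _)) (bfunD (mull_map _)).
have KE v z : K (pure v z) = ((f : bihom _ _) v : rng_of A) *> z.
  by rewrite /K [X in mull_map _ X]tmapE mull_mapE.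
transitivity (K ((idb Sigma ⊠ comul C) (coact Sigma u))).
  rewrite /cohom -[coact (comod_forget _) u]/(coact Sigma u).
  elim/tens_ind: (coact Sigma u) => [v c|y z IHy IHz].
    by rewrite [X in mull_map _ X]tmapE tmapE KE mull_mapE bfunL.
  by rewrite [X in mull_map _ X]bfunD !bfunD KD IHy IHz.
rewrite -coact_assoc.
have -> z : (can_theta ⊠ can_theta) (assocV (pure x z))
    = (can_theta ⊠ idb C) (assocV (pure x ((idb Sigma ⊠ can_theta) z))).
  elim/tens_ind: z => [v d|y z IHy IHz]; last by rewrite !addE IHy IHz.
  by rewrite tmapE !assocVE !tmapE.
rewrite -eval_coactE.
elim/tens_ind: (coact Sigma u) => [v c|y z IHy IHz]; last by rewrite !bfunD KD IHy IHz !addE.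
rewrite tmapE assocVE tmapE can_thetaE /cohom -[coact (comod_forget _) v]/(coact Sigma v).
elim/tens_ind: (coact Sigma v) => [w d|y z IHy IHz].
  by rewrite assocE KE [X in mull_map _ X]tmapE mull_mapE lact_pure.
rewrite [X in mull_map _ X]bfunD !addE KD IHy IHz.
by [].
Qed.

(** If [e] fixes the given elements and [eta(e)] is the sum of the [v_i ⊗ x_i], then [u = e u] is
    the sum of the [v_i x_i(u)]. *)
Lemma full_locally_projective : locally_projective Sigma.
Proof.
move=> us; have [e eP] := firm_left_unit hR us Sfirm.
have [s es] := tens_sum (ctx_eta eval_context (e : regular R)).
exists [seq (q.1, mulr_map (dual Sigma) q.2) | q <- s] => u /eP eu.
rewrite -[LHS]eu -(pair_left_eta eval_context) es big_map.
elim: s {es} => [|[v x] s IHs]; first by rewrite !big_nil /pair_left pure0l !bfun0.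
rewrite !big_cons pair_leftDl IHs pair_leftE /=; congr (_ <* _ + _).
exact: eval_epsE.
Qed.

(** Writing [phi ⊗ r = (phi ⊗ e) r] with [e r = r] gives the form required by [left_coactE]; left
    linearity of [eta] accounts for [e]. *)
Lemma dagger_coactE : dagger_coact eval_context = left_coact eval_context can_theta.
Proof.
apply: bihomP => x; elim/tens_ind: x => [phi r|x y IHx IHy]; last by rewrite !bfunD IHx IHy.
have [e eP] := hR [:: (r : R)].
have er : rmul e (r : R) = r by apply: (eP _ _).1; rewrite inE.
have -> : pure phi r = (pure phi (e : regular R) : dagger Sigma) <* (r : R).
  by rewrite ract_pure; congr pure; rewrite -[LHS]er.
rewrite left_coactE ract_pure {1}/dagger_coact liftE.
have -> : (e : regular R) <* (r : R) = (e : R) *> (r : regular R) by [].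
rewrite bfunL; elim/tens_ind: (ctx_eta _ r) => [v f|x y IHx IHy]; last first.
  by rewrite lactDr !(bfunD (contract phi ⊠ _)) IHx IHy !addE.
rewrite lact_pure assocVE [LHS]tmapE [RHS]tmapE can_thetaE mulr_mapE cohom_bal.
by [].
Qed.

Lemma full_comatrix_coring : is_comatrix_coring eval_context.
Proof.
exists can_theta; split; last exact: eval_coactE.
split; [exact: can_theta_bij | exact: can_theta_counit | exact: can_theta_comul].
Qed.

Lemma eval_left_coaction : is_left_coaction (dagger_coact eval_context).
Proof.
rewrite dagger_coactE.
exact: (left_coact_is_coaction hR (k := eval_context) can_theta_counit can_theta_comul).
Qed.

Lemma hom_cotens_eval (hk : is_left_coaction (dagger_coact eval_context)) :
  nat_isomorphic (hom_functor Sigma hR)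
    (cotens_functor (L := LComod hk) hR (ctx_firm_right' eval_context)).
Proof.
move: hk; rewrite dagger_coactE => hk.
exact: (hom_cotens_iso hR eval_coactE).
Qed.
End Full.
End ContextOfEquivalence.

(** * Faithful flatness reflects isomorphisms *)

Section Cokernel.
Variables (R S : rng) (M N : bimod R S) (f : bihom M N).

(** Boolean-valued by classical logic, so that the quotient construction for subgroups applies. *)
Definition im_pred : {pred N} := fun y => `[< exists x, f x = y >].

Lemma im_predP y : reflect (exists x, f x = y) (y \in im_pred).
Proof. exact: asboolP. Qed.

Fact im_zmod_closed : zmod_closed im_pred.
Proof.
split=> [|_ _ /im_predP [x <-] /im_predP [y <-]]; apply/im_predP.
  by exists 0; rewrite bfun0.
by exists (x - y); rewrite bfunB.
Qed.
HB.instance Definition _ := GRing.isZmodClosed.Build N im_pred im_zmod_closed.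

Let Q : zmodType := GRing.Zmodule.clone (Quotient.quot im_pred) _.
Let p (y : N) : Q := \pi_(Quotient.quot im_pred) y.

Let pD y z : p (y + z) = p y + p z.
Proof. by rewrite /p !piE. Qed.
Let pE y z : (p y = p z) <-> exists x, f x = y - z.
Proof.
rewrite /p; split=> [/eqP|/im_predP h]; last by apply/eqP; rewrite -Quotient.idealrBE.
by rewrite -Quotient.idealrBE => /im_predP.
Qed.
Let pS x : exists y, p y = x.
Proof. by exists (repr x); rewrite /p reprK. Qed.

Let la (r : R) (x : Q) : Q := p (r *> (repr x : N)).
Let ra (x : Q) (s : S) : Q := p ((repr x : N) <* s).
Let laE r y : la r (p y) = p (r *> y).
Proof.
apply/pE; have [x xP] : exists x, f x = repr (p y) - y by apply/pE; rewrite /p reprK.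
by exists (r *> x); rewrite bfunL xP lactDr lactN.
Qed.
Let raE y s : ra (p y) s = p (y <* s).
Proof.
apply/pE; have [x xP] : exists x, f x = repr (p y) - y by apply/pE; rewrite /p reprK.
by exists (x <* s); rewrite bfunR xP ractDl ractN.
Qed.

Program Definition coker : bimod R S := @Bimod R S Q la ra _ _ _ _ _ _ _.
Next Obligation. by have [y <-] := pS m; rewrite !laE lactDl pD. Qed.
Next Obligation. by have [y <-] := pS m; have [z <-] := pS m'; rewrite -pD !laE lactDr pD. Qed.
Next Obligation. by have [y <-] := pS m; rewrite !laE lactM. Qed.
Next Obligation. by have [y <-] := pS m; have [z <-] := pS m'; rewrite -pD !raE ractDl pD. Qed.
Next Obligation. by have [y <-] := pS m; rewrite !raE ractDr pD. Qed.
Next Obligation. by have [y <-] := pS m; rewrite !raE ractM. Qed.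
Next Obligation. by have [y <-] := pS m; rewrite raE !laE raE lractA. Qed.

Program Definition coker_proj : bihom N coker := @BiHom R S N coker p _ _ _.
Next Obligation. exact: pD. Qed.
Next Obligation. by rewrite -[RHS]/(la r (p m)) laE. Qed.
Next Obligation. by rewrite -[RHS]/(ra (p m) s) raE. Qed.

Lemma coker_proj_surj x : exists y, coker_proj y = x.
Proof. exact: pS. Qed.

Lemma coker_proj0 y : coker_proj y = 0 <-> exists x, f x = y.
Proof.
rewrite -(bfun0 coker_proj) -[coker_proj y]/(p y) -[coker_proj 0]/(p 0) pE.
by rewrite subr0.
Qed.
End Cokernel.

Section Kernel.
Variables (R S : rng) (M N : bimod R S) (f : bihom M N).

Let P (x : M) : Prop := f x = 0.
Let P0 : P 0. Proof. exact: bfun0. Qed.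
Let PD x y : P x -> P y -> P (x + y).
Proof. by rewrite /P bfunD => -> ->; rewrite addr0. Qed.
Let PN x : P x -> P (- x). Proof. by rewrite /P bfunN => ->; rewrite oppr0. Qed.
Let PL r x : P x -> P (r *> x). Proof. by rewrite /P bfunL => ->; rewrite lact0. Qed.
Let PR x s : P x -> P (x <* s). Proof. by rewrite /P bfunR => ->; rewrite ract0. Qed.

Definition ker : bimod R S := submod P0 PD PN PL PR.

Program Definition ker_incl : bihom ker M := @BiHom R S ker M (@sub_val _ _ M P) _ _ _.
Next Obligation. by []. Qed.
Next Obligation. by []. Qed.
Next Obligation. by []. Qed.

Lemma ker_incl_inj : injective ker_incl.
Proof. exact: sub_val_inj. Qed.

Lemma ker_inclP x : f x = 0 <-> exists y, ker_incl y = x.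
Proof. by split=> [fx0|[y <-]]; [exists (@SubElt _ _ _ P x fx0) | apply: sub_prop y]. Qed.

Lemma ker_sunital : sunital M -> sunital ker.
Proof. exact: sunital_sub. Qed.
End Kernel.

Section FaithfullyFlat.
Variables (R S : rng) (hR : has_local_units R) (N : bimod R S).

Lemma flat_inj (T : rng) (P : bimod rng0 T -> Prop) (L : bimod T S)
  (M M' : bimod rng0 T) (f : bihom M M') :
  flat_on P L -> P M -> P M' -> injective f -> injective (f ⊠ idb L).
Proof.
move=> fl PM PM' fI; apply: bihom_inj => x.
(* The zero endomorphism of [M] stands in for [0 -> M], so that all modules of the sequence lie in
   [P]. *)
have e y : f y = 0 <-> exists x, zerob M M x = y.
  split=> [y0|[z <-]]; last exact: bfun0.
  by exists 0; apply/esym/fI; rewrite y0 !bfun0.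
move/(fl _ _ _ _ _ PM PM PM' e) => [y <-]; exact: (tmap_0l (M := M)).
Qed.

(* Tensoring with [N] sends the kernel and the cokernel of [f] to zero, and a
   faithful functor reflects zero objects. *)
Lemma faithfully_flat_conservative (M M' : firm_module R) (f : bihom M M') :
  faithfully_flat_left N -> bijective (f ⊠ idb N) -> bijective f.
Proof.
move=> [Nflat Nfaith] fB; apply: inj_surj_bij.
  have fK : firm_right (ker f).
    by apply/(sunital_firm hR)/ker_sunital/(firm_sunital hR)/fm_firm.
  have i0 : ker_incl f = 0.
    apply: (Nfaith (FirmModule fK) M); apply: bihomP => x.
    apply: (bij_inj fB); rewrite tmap_0l bfun0 tmap_comp.
    have -> : compb f (ker_incl f) = 0 by apply: bihomP => y; apply: sub_prop y.
    exact: tmap_0l.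
  by apply: bihom_inj => x /ker_inclP [y <-]; rewrite i0.
have fQ : firm_right (coker f).
  apply: (sunital_firm hR) => X; have [c cE] := choice (@coker_proj_surj _ _ _ _ f).
  have [e eP] := firm_sunital hR (fm_firm M') (map c X).
  by exists e => x xX; rewrite -[x]cE -bfunR eP ?map_f.
have p0 : coker_proj f = 0.
  apply: (Nfaith M' (FirmModule fQ)); apply: bihomP => y.
  have [x <-] := bij_surj fB y; rewrite tmap_0l tmap_comp.
  have -> : compb (coker_proj f) f = 0.
    by apply: bihomP => z; rewrite compbE; apply/coker_proj0; exists z.
  exact: tmap_0l.
by move=> y; apply/coker_proj0; rewrite p0.
Qed.
End FaithfullyFlat.

(** * Flat corings *)

Definition exact_at (R S : rng) (M1 M2 M3 : bimod R S) (f : bihom M1 M2) (g : bihom M2 M3) :=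
  forall y, g y = 0 <-> exists x, f x = y.

Lemma exact_at_iso (R S : rng) (M1 M2 M3 N1 N2 N3 : bimod R S)
  (f : bihom M1 M2) (g : bihom M2 M3) (f' : bihom N1 N2) (g' : bihom N2 N3)
  (a1 : M1 -> N1) (a2 : M2 -> N2) (a3 : M3 -> N3) :
  bijective a1 -> bijective a2 -> injective a3 -> a3 0 = 0 ->
  (forall x, f' (a1 x) = a2 (f x)) -> (forall x, g' (a2 x) = a3 (g x)) ->
  exact_at f g -> exact_at f' g'.
Proof.
move=> a1B a2B a3I a30 sf sg fg y; have [x <-] := bij_surj a2B y.
rewrite sg; split=> [gx0|[z zP]].
  have [z <-] : exists z, f z = x by apply/fg/a3I; rewrite a30.
  by exists (a1 z).
have [w ew] := bij_surj a1B z; rewrite -a30; congr a3; apply/fg; exists w.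
by apply: (bij_inj a2B); rewrite -sf ew.
Qed.

Lemma assoc_tmap (Q R S T : rng) (M M' : bimod Q R) (N : bimod R S) (P : bimod S T)
  (f : bihom M M') (x : M ⊗ N ⊗ P) :
  (f ⊠ idb (N ⊗ P)) (assoc x) = assoc ((f ⊠ idb N ⊠ idb P) x).
Proof.
elim/tens_ind: x => [y p|x y IHx IHy]; last by rewrite !bfunD IHx IHy.
elim/tens_ind: y => [m n|x y IHx IHy]; last by rewrite !addE IHx IHy.
by rewrite !(tmapE, assocE).
Qed.

(** * Kernels of colinear maps over a flat coring *)

Section KernelComodule.
Variables (A : pzRingType) (C : coring A) (hC : unital_flat_left C).
Variables (N N' : comod rng0 C) (g : colin N N').

Let K := ker g.
Let i : bihom K N := ker_incl g.

Let KU : unital_right K.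
Proof. by move=> x; apply: sub_val_inj; apply: com_unit. Qed.

Let iC : injective (i ⊠ idb C).
Proof. by apply: (flat_inj hC) => //; [apply: com_unit | apply: ker_incl_inj]. Qed.

(** After reassociation, flatness is used for one factor [C] at a time. *)
Let iCC : injective (i ⊠ idb (C ⊗ C)).
Proof.
have h : injective (i ⊠ idb C ⊠ idb C).
  by apply: (flat_inj hC) => //; apply: tens_unitr; apply: cor_unitr.
move=> x y; rewrite -[x]assocVK -[y]assocVK !assoc_tmap => /(can_inj (@assocK _ _ _ _ _ _ _)).
by move=> /h ->.
Qed.

Let iE : exact_at (i ⊠ idb C) (g ⊠ idb C).
Proof. by apply: hC; [exact: KU | exact: com_unit | exact: com_unit | exact: ker_inclP]. Qed.

Let rho_exists (x : K) : exists w, (i ⊠ idb C) w = coact N (i x).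
Proof.
by apply/iE; rewrite -(colinP g); have -> : g (i x) = 0 by [apply: sub_prop x]; rewrite bfun0.
Qed.
Let rho x := sval (cid (rho_exists x)).
Let rhoE x : (i ⊠ idb C) (rho x) = coact N (i x).
Proof. by rewrite /rho; case: cid. Qed.

(** By flatness [K ⊗ C] is the kernel of [g ⊗ C], so the coaction of [N] restricts to [K]; linearity
    is checked after the injection into [N ⊗ C]. *)
Program Definition ker_coact : bihom K (K ⊗ C) := @BiHom _ _ K (K ⊗ C) rho _ _ _.
Next Obligation. by move=> x y; apply: iC; rewrite bfunD !rhoE !bfunD. Qed.
Next Obligation. by apply: iC; rewrite bfunL !rhoE !bfunL. Qed.
Next Obligation. by apply: iC; rewrite bfunR !rhoE !bfunR. Qed.

Let ker_coactE x : (i ⊠ idb C) (ker_coact x) = coact N (i x).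
Proof. exact: rhoE. Qed.

Program Definition ker_comod : comod rng0 C := @Comod _ _ C K KU ker_coact _ _.
Next Obligation.
apply: iCC; rewrite assoc_tmap tmap_comp.
have -> : compb (i ⊠ idb C) ker_coact = compb (coact N) i.
  by apply: bihomP => x; apply: ker_coactE.
rewrite -tmap_comp ker_coactE coact_assoc.
rewrite -ker_coactE !tmap_comp; congr ((_ ⊠ _) _); exact: bihomP.
Qed.
Next Obligation.
apply: ker_incl_inj; rewrite -[RHS](coact_counit (i m)) -ker_coactE.
rewrite -mulr_map_natural !tmap_comp; congr (mulr_map _ ((_ ⊠ _) _)); exact: bihomP.
Qed.

Lemma ker_incl_colinear : is_colinear (M := ker_comod) (N := N) i.
Proof. by move=> x; rewrite ker_coactE. Qed.
End KernelComodule.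

Section EquivalenceFlat.
Variables (A : pzRingType) (C : coring A) (R : rng) (hR : has_local_units R).
Variables (Sigma : comod R C) (Sfirm : firm_left Sigma).

(** Preimages are chosen on pure tensors only, so [l] need not lift linearly through [f]. *)
Lemma tmap_image (Q S T : rng) (M M' M'' : bimod Q S) (N : bimod S T)
  (f : bihom M M'') (l : bihom M' M'') :
  (forall m, exists z, f z = l m) -> forall w, exists z, (f ⊠ idb N) z = (l ⊠ idb N) w.
Proof.
move=> h; elim/tens_ind => [m n|x y [x' IHx] [y' IHy]]; last first.
  by exists (x' + y'); rewrite !bfunD IHx IHy.
by have [z zP] := h m; exists (pure z n); rewrite !tmapE zP.
Qed.

(** The kernel of [g ⊗ Sigma] is a comodule, hence isomorphic to some [L ⊗ Sigma], and its inclusion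
    is induced by some [l : L -> M2]. Faithfulness gives [g l = 0], so [l] has values in the image
    of [f]. *)
Lemma equivalence_exact (hC : unital_flat_left C) (M1 M2 M3 : firm_module R)
    (f : bihom M1 M2) (g : bihom M2 M3) :
  full (tens_functor Sigma) -> faithful (tens_functor Sigma) ->
  essentially_surjective (tens_functor Sigma) ->
  exact_at f g -> exact_at (f ⊠ idb Sigma) (g ⊠ idb Sigma).
Proof.
move=> T1 T2 T3 fg y; split=> [gy|[x <-]]; last first.
  rewrite tmap_comp; have -> : compb g f = 0.
    by apply: bihomP => z; rewrite compbE; apply/fg; exists z.
  exact: tmap_0l.
pose G : colin (tens_comod Sigma M2) (tens_comod Sigma M3) := tens_colin Sigma g.
pose K := ker_comod hC G.
have [L [j jI]] := T3 (K : comod_cat C).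
pose i : hom (K : comod_cat C) (tens_functor Sigma M2) := Colin (@ker_incl_colinear _ _ hC _ _ G).
have [l lP] := T1 _ _ (comp i j).
have gl : comp (g : hom (M2 : firm_cat R) M3) l = 0.
  apply: T2; rewrite fmapM lP; apply: colin_eq => x.
  rewrite -[LHS]/(G (ker_incl G ((j : colin _ _) x))).
  rewrite -[RHS]/(((0 : bihom L M3) ⊠ idb Sigma) x) tmap_0l.
  by apply/ker_inclP; exists ((j : colin _ _) x).
have [z zP] : exists z, ker_incl G z = y by apply/ker_inclP.
have [w wz] := bij_surj ((comod_cat_iso _).1 jI) z.
have -> : y = ((l : bihom _ _) ⊠ idb Sigma) w.
  rewrite -zP -wz -[LHS]/((comp i j : colin _ _) w) -lP.
  by [].
apply: tmap_image => m; apply/fg.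
exact: (congr1 (fun h : bihom L M3 => h m) gl).
Qed.

(** Firmness of [Sigma] allows any [M] to be replaced by the firm module [M ⊗ R], which extends
    exactness from firm modules to all modules. *)
Definition tens_firm (M : bimod rng0 R) : bihom (M ⊗ regular R ⊗ Sigma) (M ⊗ Sigma) :=
  compb (idb M ⊠ mull_map Sigma) assoc.

Lemma tens_firm_bij M : bijective (tens_firm M).
Proof. by apply: bij_comp (assoc_bij _ _ _); apply: tmap_bij => //; exists id. Qed.

Lemma tens_firm_natural (M M' : bimod rng0 R) (f : bihom M M') x :
  (f ⊠ idb Sigma) (tens_firm M x) = tens_firm M' ((f ⊠ idb (regular R) ⊠ idb Sigma) x).
Proof.
elim/tens_ind: x => [y p|x y IHx IHy]; last by rewrite !bfunD IHx IHy.
elim/tens_ind: y => [m n|x y IHx IHy]; last by rewrite !addE IHx IHy.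
by rewrite !compbE !(tmapE, assocE).
Qed.

Lemma equivalence_faithfully_flat :
  full (tens_functor Sigma) -> faithful (tens_functor Sigma) ->
  essentially_surjective (tens_functor Sigma) ->
  unital_flat_left C -> faithfully_flat_left Sigma.
Proof.
move=> T1 T2 T3 hC; split=> [M1 M2 M3 f g _ _ _ fg|M M' f g efg].
  have fgR : exact_at (f ⊠ idb (regular R)) (g ⊠ idb (regular R)).
    exact: (regular_flat hR I I I fg).
  have fm (M : bimod rng0 R) := firm_tens_regular M hR.
  have fgS := @equivalence_exact hC (FirmModule (fm M1)) (FirmModule (fm M2))
    (FirmModule (fm M3)) _ _ T1 T2 T3 fgR.
  apply: (exact_at_iso (tens_firm_bij M1) (tens_firm_bij M2) (bij_inj (tens_firm_bij M3))
    (bfun0 _) _ _ fgS) => x; exact: tens_firm_natural.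
apply: (T2 M M' f g); apply: colin_eq => x.
by rewrite -[LHS]/((f ⊠ idb Sigma) x) efg.
Qed.
End EquivalenceFlat.

(** * Faithfully flat descent *)

Section Descent.
Variables (A : pzRingType) (C : coring A) (R : rng) (hR : has_local_units R).
Variables (Sigma : comod R C) (S' : bimod A R) (k : comatrix_context Sigma S').
Variable theta : bihom (S' ⊗ Sigma) C.
Hypotheses (coactE : forall u, coact Sigma u = (idb Sigma ⊠ theta) (comatrix_coact k u))
  (thetaB : bijective theta)
  (thetaM : forall d, comul C (theta d) = (theta ⊠ theta) (comatrix_comul k d))
  (Sflat : flat_left Sigma).

Definition dagger_theta (B : rng) (N : bimod B A) : bihom (N ⊗ S' ⊗ Sigma) (N ⊗ C) :=
  compb (idb N ⊠ theta) assoc.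

Lemma dagger_theta_bij (B : rng) (N : bimod B A) : bijective (dagger_theta N).
Proof. by apply: bij_comp (assoc_bij _ _ _); apply: tmap_bij => //; exists id. Qed.

Lemma dagger_theta_natural (B : rng) (N N' : bimod B A) (f : bihom N N') x :
  (f ⊠ idb C) (dagger_theta N x) = dagger_theta N' ((f ⊠ idb S' ⊠ idb Sigma) x).
Proof.
elim/tens_ind: x => [y u|x y IHx IHy]; last by rewrite !bfunD IHx IHy.
elim/tens_ind: y => [n x|x y IHx IHy]; last by rewrite !addE IHx IHy.
by rewrite !compbE !(tmapE, assocE).
Qed.

(** [- ⊗ C] is [(- ⊗ S') ⊗ Sigma], a composite of two exact functors. *)
Lemma descent_coring_flat : unital_flat_left C.
Proof.
move=> N1 N2 N3 f g _ _ _ fg.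
have fgS : exact_at (f ⊠ idb S' ⊠ idb Sigma) (g ⊠ idb S' ⊠ idb Sigma).
  apply: Sflat => //; exact: (dagger_flat hR k (P := fun=> True) I I I fg).
apply: (exact_at_iso (dagger_theta_bij N1) (dagger_theta_bij N2)
  (bij_inj (dagger_theta_bij N3)) (bfun0 _) _ _ fgS) => x; exact: dagger_theta_natural.
Qed.

Section Counit.
Variable N : comod rng0 C.

(** The difference with the cotensor product as kernel; [hom_tens] is injective onto this kernel. *)
Let d : bihom (N ⊗ S') (N ⊗ (C ⊗ S')) :=
  compb assoc (coact N ⊠ idb S') - (idb N ⊠ left_coact k theta).

Let dE y : d y = 0 <-> exists w, hom_tens k N w = y.
Proof.
rewrite -(hom_tens_image hR coactE) -[d y]/(assoc ((coact N ⊠ idb S') y) - _).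
by split=> [/eqP|->]; [rewrite subr_eq0 => /eqP | rewrite subrr].
Qed.

(** At [f ⊗ r ⊗ u] both sides are [f(e_r) ⊗ theta(f_r ⊗ u)]. So, up to the bijection [dagger_theta],
    [ev] followed by the coaction is [hom_tens ⊗ Sigma]. *)
Lemma coact_ev w :
  coact N (@ev A C R hR Sigma N w) = dagger_theta N ((hom_tens k N ⊠ idb Sigma) w).
Proof.
elim/tens_ind: w => [x u|x y IHx IHy]; last by rewrite !bfunD IHx IHy.
elim/tens_ind: x => [f r|x y IHx IHy]; last by rewrite !addE IHx IHy.
rewrite evE mulr_mapE tmapE hom_tensE.
rewrite [LHS](sub_prop f ((r : R) *> u)).
rewrite -[coact (comod_forget Sigma) _]/(coact Sigma ((r : R) *> u)) (coact_lact coactE).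
elim/tens_ind: (ctx_eta k r) => [e x|x y IHx IHy]; last first.
  by rewrite !addE IHx IHy.
rewrite assocE tmapE [LHS]tmapE [(_ ⊠ idb S') _]tmapE compbE assocE tmapE.
by [].
Qed.

Lemma ev_inj : injective (@ev A C R hR Sigma N).
Proof.
move=> w w' /(congr1 (coact N)); rewrite !coact_ev => /(bij_inj (dagger_theta_bij N)).
apply: (flat_inj Sflat I I); exact: (hom_tens_inj hR).
Qed.

(** Under this identification [d ⊗ Sigma] becomes [rho ⊗ C - N ⊗ comul], as [JE] shows. *)
Let J : bihom (N ⊗ (C ⊗ S') ⊗ Sigma) (N ⊗ (C ⊗ C)) :=
  compb (idb N ⊠ compb (idb C ⊠ theta) assoc) assoc.

Let J_inj : injective J.
Proof.
apply/bij_inj/bij_comp/assoc_bij; apply: tmap_bij; first by exists id.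
by apply: bij_comp (assoc_bij _ _ _); apply: tmap_bij => //; exists id.
Qed.

Let JE z : J ((d ⊠ idb Sigma) z) =
  assoc ((coact N ⊠ idb C) (dagger_theta N z)) - (idb N ⊠ comul C) (dagger_theta N z).
Proof.
elim/tens_ind: z => [y u|x y IHx IHy]; last by rewrite !bfunD IHx IHy opprD addrACA.
elim/tens_ind: y => [n x|x y IHx IHy]; last by rewrite !addE IHx IHy opprD addrACA.
have -> : (d ⊠ idb Sigma) (pure (pure n x) u) =
    pure (assoc (pure (coact N n) x)) u - pure (pure n (left_coact k theta x)) u.
  rewrite tmapE -[d _]/(assoc ((coact N ⊠ idb S') (pure n x)) - (idb N ⊠ _) (pure n x)) !tmapE.
  by rewrite pureDl; congr (_ + _); apply: (morphDN (f := pure^~ _)) => a b; apply: pureDl.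
have -> : dagger_theta N (pure (pure n x) u) = pure n (theta (pure x u)).
  by rewrite compbE assocE tmapE.
rewrite bfunB !tmapE; congr (_ - _).
  elim/tens_ind: (coact N n) => [m c|a b IHa IHb]; last by rewrite !addE IHa IHb.
  by rewrite !assocE [LHS]compbE assocE tmapE compbE assocE tmapE.
by rewrite [LHS]compbE assocE tmapE compbE (comul_theta thetaM).
Qed.

(** Coassociativity puts [rho(n)] in the kernel of [d ⊗ Sigma], flatness writes it as the image of
    some [w] under [hom_tens ⊗ Sigma], and [rho] is injective by the counit law. *)
Lemma ev_surj n : exists w, @ev A C R hR Sigma N w = n.
Proof.
have [z zP] := bij_surj (dagger_theta_bij N) (coact N n).
have : (d ⊠ idb Sigma) z = 0.
  by apply: J_inj; rewrite JE zP coact_assoc subrr bfun0.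
move/(Sflat I I I dE) => [w wP]; exists w.
have rhoI : injective (coact N).
  by move=> a b e; rewrite -[a]coact_counit -[b]coact_counit e.
by apply: rhoI; rewrite coact_ev wP.
Qed.

Lemma ev_bij : bijective (@ev A C R hR Sigma N).
Proof. exact: inj_surj_bij ev_inj ev_surj. Qed.
End Counit.

(** Flatness makes the counit [ev] bijective; faithful flatness makes [- ⊗ Sigma] reflect
    isomorphisms, which settles the unit. *)
Lemma descent_inverse_equivalences :
  faithfully_flat_left Sigma ->
  inverse_equivalences (tens_functor Sigma) (hom_functor Sigma hR).
Proof.
move=> ff; pose e (N : comod_cat C) : hom (tens_functor Sigma (hom_functor Sigma hR N)) N :=
  @ev_colin A C R hR Sigma N.
apply: (adjoint_inverse_equivalences (e := e)) => [N|N N' g|N|M M' f].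
- exact: ev_universal.
- by apply: colin_eq => x; apply: ev_natural.
- exact/comod_cat_iso/ev_bij.
move/comod_cat_iso => fB; apply/firm_cat_iso.
exact: (faithfully_flat_conservative hR ff fB).
Qed.
End Descent.

Theorem corollary3p5 (A : pzRingType) (C : coring A) (R : rng)
    (hR : has_local_units R) :
  (forall (F : functor (firm_cat R) (comod_cat C))
          (G : functor (comod_cat C) (firm_cat R)),
     inverse_equivalences F G ->
     exists hF : is_left_action (image_action hR F),
       let Sigma : comod R C := comod_add hF in
       [/\ firm_left Sigma,
           locally_projective Sigma,
           exists k : comatrix_context Sigma (dagger Sigma),
             (nat_isomorphic F (tens_functor Sigma) /\
              exists hk : is_left_coaction (dagger_coact k),
                nat_isomorphic G
                  (cotens_functor (L := LComod hk) hR (ctx_firm_right' k))) /\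
             is_comatrix_coring k
         & unital_flat_left C -> faithfully_flat_left Sigma]) /\
  (forall Sigma : comod R C,
     firm_left Sigma ->
     locally_projective Sigma ->
     (exists k : comatrix_context Sigma (dagger Sigma), is_comatrix_coring k) ->
     faithfully_flat_left Sigma ->
     unital_flat_left C /\
     inverse_equivalences (tens_functor Sigma) (hom_functor Sigma hR)).
Proof.
split=> [F G FG|Sigma _ _ [k [theta [[thetaB thetaU thetaM] coactE]]] ff]; last first.
  split; first exact: (descent_coring_flat hR k thetaB ff.1).
  exact: (descent_inverse_equivalences hR coactE thetaB thetaM ff.1 ff).
have F1 := inverse_equivalences_full FG; have F2 := inverse_equivalences_faithful FG.
have F3 := inverse_equivalences_dense FG.
have hF := image_action_is_left_action hR F1 F2; exists hF => Sigma.
(* From here on [F] is replaced by [- ⊗ Sigma], which is again an equivalence with inverse [G]. *)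
have FT := watts_nat_iso F1 F2 F3 hF; have TG := inverse_equivalences_congr FT FG.
have T1 := inverse_equivalences_full TG; have T2 := inverse_equivalences_faithful TG.
have T3 := inverse_equivalences_dense TG.
have Sfirm := image_firm_left F1 F2 F3 hF.
split=> //; [exact: full_locally_projective | | exact: equivalence_faithfully_flat].
exists (eval_context hR T1 T2 T3 Sfirm); split; last exact: full_comatrix_coring.
split=> //; have hk := eval_left_coaction hR T1 T2 T3 Sfirm; exists hk.
(* [G ≅ Hom^C(Sigma, -) ⊗ R], as both are right inverse to [- ⊗ Sigma], and the latter is the
   cotensor functor. *)
apply: nat_iso_trans (hom_cotens_eval hk).
exact: (inverse_unique TG (hom_functor_counit hR T1 T2 T3)).
Qed.
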